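(* Let $(G,\cdot,\circ)$ be a connected compact Lie skew brace which is solvable (as a Lie skew brace). Then $(G,\cdot)\cong(G,\circ)\cong\mathbb{T}^n$ for some $n\ge 0$, where $\mathbb{T}^n$ is the $n$-dimensional torus. In particular, the Lie skew brace is trivial, i.e. $a\circ b=a\cdot b$ for all $a,b\in G$.
   Context: A Lie skew brace is a triple $(G,\cdot,\circ)$ where $(G,\cdot)$ and $(G,\circ)$ are real (finite-dimensional) Lie groups on the same smooth manifold $G$ such that $a\circ(b\cdot c)=(a\circ b)\cdot a^{-1}\cdot(a\circ c)$ for all $a,b,c\in G$, where $a^{-1}$ is the inverse of $a$ in $(G,\cdot)$. The two groups have the same identity $e$. It is compact (connected) if the manifold $G$ is. For $a\in G$ let $\lambda_a(b)=a^{-1}\cdot(a\circ b)$; each $\lambda_a$ is an automorphism of $(G,\cdot)$. Set $x*y=\lambda_x(y)\cdot y^{-1}$. An ideal of $(G,\cdot,\circ)$ is a connected closed Lie subgroup $I\subseteq G$ that is normal in $(G,\cdot)$, normal in $(G,\circ)$, and satisfies $\lambda_a(I)=I$ for all $a\in G$. For ideals $I,J$ of $G$, $[I,J]_B$ denotes the closed connected ideal generated by (the smallest ideal containing) all commutators $[x,y]_{\cdot}$ in $(G,\cdot)$, all commutators $[x,y]_{\circ}$ in $(G,\circ)$, and all elements $x*y$, for $x\in I$, $y\in J$. Define $\partial^0(G)=G$ and $\partial^{n+1}(G)=[\partial^n(G),\partial^n(G)]_B$ for $n\ge 0$. The Lie skew brace is solvable if $\partial^n(G)=\{e\}$ for some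 $n\ge 0$. *)

(* Defs.v *)
From HB Require Import structures.
From mathcomp Require Import all_boot all_order all_algebra.
From mathcomp Require Import all_classical all_reals all_analysis.
From mathcomp Require Import generic_quotient ring_quotient ring lra.

Set Implicit Arguments.
Unset Strict Implicit.
Unset Printing Implicit Defensive.

Import Order.TTheory GRing.Theory Num.Theory.
Import numFieldNormedType.Exports.

Local Open Scope classical_set_scope.
Local Open Scope ring_scope.

(* f is of class C^k on the open set U.  In finite dimension the differential
   of f is of class C^k as soon as all the directional derivatives are. *)
Fixpoint class_C (R : realType) (V W : normedModType R) (k : nat)
    (U : set V) (f : V -> W) : Prop :=
  if k is k'.+1 then
    (forall x, U x -> differentiable f x) /\
    (forall v, class_C k' U ('D_v f))
  else forall x, U x -> {for x, continuous f}.

Definition smooth_on (R : realType) (V W : normedModType R)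
    (U : set V) (f : V -> W) : Prop := forall k, class_C k U f.

(* The values of chart_to outside chart_dom and of chart_from outside
   chart_cod are junk. *)
Record chart (R : realType) (T : topologicalType) (E : normedModType R) :=
  Chart {
    chart_dom : set T;
    chart_cod : set E;
    chart_to : T -> E;
    chart_from : E -> T
  }.

Record is_chart (R : realType) (T : topologicalType) (E : normedModType R)
    (c : chart T E) : Prop := IsChart {
  open_dom : open (chart_dom c);
  open_cod : open (chart_cod c);
  chart_toP : forall x, chart_dom c x -> chart_cod c (chart_to c x);
  chart_fromP : forall v, chart_cod c v -> chart_dom c (chart_from c v);
  chart_toK : forall x, chart_dom c x -> chart_from c (chart_to c x) = x;
  chart_fromK : forall v, chart_cod c v -> chart_to c (chart_from c v) = v;
  chart_to_continuous :
    forall x, chart_dom c x -> {for x, continuous (chart_to c)};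
  chart_from_continuous :
    forall v, chart_cod c v -> {for v, continuous (chart_from c)}
}.

(* f read in the charts c and c', which is meaningful on the second set. *)
Definition in_charts (R : realType) (T T' : topologicalType)
    (E E' : normedModType R) (c : chart T E) (c' : chart T' E') (f : T -> T') :
  E -> E' := chart_to c' \o f \o chart_from c.

Definition in_charts_dom (R : realType) (T T' : topologicalType)
    (E E' : normedModType R) (c : chart T E) (c' : chart T' E') (f : T -> T') :
  set E := chart_cod c `&` (f \o chart_from c) @^-1` chart_dom c'.

Definition compatible_charts (R : realType) (T : topologicalType)
    (E : normedModType R) (c c' : chart T E) : Prop :=
  smooth_on (in_charts_dom c c' id) (in_charts c c' id) /\
  smooth_on (in_charts_dom c' c id) (in_charts c' c id).

Definition smooth_map (R : realType) (T T' : topologicalType)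
    (E E' : normedModType R) (A : set (chart T E)) (A' : set (chart T' E'))
    (f : T -> T') : Prop :=
  continuous f /\
  forall c c', A c -> A' c' ->
    smooth_on (in_charts_dom c c' f) (in_charts c c' f).

Definition prod_chart (R : realType) (T T' : topologicalType)
    (E E' : normedModType R) (c : chart T E) (c' : chart T' E') :
  chart (T * T')%type (E * E')%type :=
  Chart (chart_dom c `*` chart_dom c') (chart_cod c `*` chart_cod c')
    (fun x => (chart_to c x.1, chart_to c' x.2))
    (fun v => (chart_from c v.1, chart_from c' v.2)).

Definition prod_atlas (R : realType) (T T' : topologicalType)
    (E E' : normedModType R) (A : set (chart T E)) (A' : set (chart T' E')) :
  set (chart (T * T')%type (E * E')%type) :=
  [set prod_chart c.1 c.2 | c in A `*` A'].

Record smoothManifold (R : realType) := SmoothManifold {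
  manifold_points :> topologicalType;
  manifold_dim : nat;
  manifold_atlas : set (chart manifold_points 'rV[R]_manifold_dim);
  manifold_hausdorff : hausdorff_space manifold_points;
  manifold_second_countable : @second_countable manifold_points;
  atlas_chart : forall c, manifold_atlas c -> is_chart c;
  atlas_cover : forall x, exists2 c, manifold_atlas c & chart_dom c x;
  atlas_compatible : forall c c',
    manifold_atlas c -> manifold_atlas c' -> compatible_charts c c'
}.

Definition maximal_atlas (R : realType) (M : smoothManifold R) :
  set (chart M 'rV[R]_(manifold_dim M)) :=
  [set c | is_chart c /\
    forall c', manifold_atlas c' -> compatible_charts c c'].

Record lieGroupOn (R : realType) (M : smoothManifold R) := LieGroupOn {
  lie_mul : M -> M -> M;
  lie_one : M;
  lie_inv : M -> M;
  lie_mulA : associative lie_mul;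
  lie_mul1 : left_id lie_one lie_mul;
  lie_mulV : left_inverse lie_one lie_inv lie_mul;
  lie_mul_smooth : smooth_map
    (prod_atlas (@manifold_atlas R M) (@manifold_atlas R M))
    (@manifold_atlas R M) (fun x => lie_mul x.1 x.2);
  lie_inv_smooth :
    smooth_map (@manifold_atlas R M) (@manifold_atlas R M) lie_inv
}.

Definition lie_isomorphic (R : realType) (M N : smoothManifold R)
    (G : lieGroupOn M) (H : lieGroupOn N) : Prop :=
  exists (f : M -> N) (g : N -> M),
    [/\ cancel f g, cancel g f,
        forall x y, f (lie_mul G x y) = lie_mul H (f x) (f y),
        smooth_map (@manifold_atlas R M) (@manifold_atlas R N) f &
        smooth_map (@manifold_atlas R N) (@manifold_atlas R M) g].

Definition lie_commutator (R : realType) (M : smoothManifold R)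
    (G : lieGroupOn M) (x y : M) : M :=
  lie_mul G (lie_mul G x y) (lie_mul G (lie_inv G x) (lie_inv G y)).

Definition is_subgroup (R : realType) (M : smoothManifold R)
    (G : lieGroupOn M) (I : set M) : Prop :=
  [/\ I (lie_one G), forall x y, I x -> I y -> I (lie_mul G x y) &
      forall x, I x -> I (lie_inv G x)].

Definition is_normal (R : realType) (M : smoothManifold R)
    (G : lieGroupOn M) (I : set M) : Prop :=
  is_subgroup G I /\
  forall a x, I x -> I (lie_mul G (lie_mul G a x) (lie_inv G a)).

(* Embedded submanifold of dimension k: around each of its points, some chart of
   the smooth structure sends I to the slice where the last coordinates vanish *)
Definition is_submanifold (R : realType) (M : smoothManifold R) (k : nat)
    (I : set M) : Prop :=
  forall x, I x -> exists c, [/\ maximal_atlas c, chart_dom c x &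
    chart_to c @` (I `&` chart_dom c) =
    chart_cod c `&`
      [set v | forall i : 'I_(manifold_dim M), (k <= i)%N -> v ord0 i = 0]].

(* dot and circ share the manifold, hence the smooth structure; that they have
   the same identity is a consequence (brace_one). *)
Record lieSkewBrace (R : realType) := LieSkewBrace {
  manifold :> smoothManifold R;
  dot : lieGroupOn manifold;
  circ : lieGroupOn manifold;
  braceP : forall a b c : manifold,
    lie_mul circ a (lie_mul dot b c) =
    lie_mul dot (lie_mul dot (lie_mul circ a b) (lie_inv dot a))
      (lie_mul circ a c)
}.

Lemma brace_one (R : realType) (G : lieSkewBrace R) :
  lie_one (circ G) = lie_one (dot G).
Proof.
have mulA (a b c : G) :
    lie_mul (dot G) a (lie_mul (dot G) b c) =
    lie_mul (dot G) (lie_mul (dot G) a b) c.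
  exact: lie_mulA.
have mul1 (a : G) : lie_mul (dot G) (lie_one (dot G)) a = a by exact: lie_mul1.
have mulV (a : G) : lie_mul (dot G) (lie_inv (dot G) a) a = lie_one (dot G).
  exact: lie_mulV.
have mulVr (a : G) : lie_mul (dot G) a (lie_inv (dot G) a) = lie_one (dot G).
  rewrite -[LHS]mul1 -{1}(mulV (lie_inv (dot G) a)).
  by rewrite -mulA (mulA _ a) mulV mul1 mulV.
have mulr1 (a : G) : lie_mul (dot G) a (lie_one (dot G)) = a.
  by rewrite -(mulV a) mulA mulVr mul1.
have circ1 (a : G) : lie_mul (circ G) (lie_one (circ G)) a = a.
  exact: lie_mul1.
have := braceP (lie_one (circ G)) (lie_one (dot G)) (lie_one (dot G)).
rewrite !circ1 !mul1 mulr1 => /(congr1 (lie_mul (dot G) ^~ (lie_one (circ G)))).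
by rewrite mulV mul1.
Qed.

Definition brace_lambda (R : realType) (G : lieSkewBrace R) (a b : G) : G :=
  lie_mul (dot G) (lie_inv (dot G) a) (lie_mul (circ G) a b).

Definition brace_star (R : realType) (G : lieSkewBrace R) (x y : G) : G :=
  lie_mul (dot G) (brace_lambda x y) (lie_inv (dot G) y).

Record is_ideal (R : realType) (G : lieSkewBrace R) (I : set G) : Prop :=
  IsIdeal {
    ideal_connected : connected I;
    ideal_closed : closed I;
    ideal_submanifold : exists k, is_submanifold k I;
    ideal_normal_dot : is_normal (dot G) I;
    ideal_normal_circ : is_normal (circ G) I;
    ideal_lambda : forall a, brace_lambda a @` I = I
  }.

Definition bracket_gens (R : realType) (G : lieSkewBrace R) (I J : set G) :
  set G :=
  [set z | exists x y, [/\ I x, J y &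
     [\/ z = lie_commutator (dot G) x y, z = lie_commutator (circ G) x y |
         z = brace_star x y]]].

Definition brace_bracket (R : realType) (G : lieSkewBrace R) (I J : set G) :
  set G :=
  smallest (@is_ideal R G) (bracket_gens I J).

Definition brace_derived (R : realType) (G : lieSkewBrace R) (n : nat) : set G :=
  iter n (fun I => brace_bracket I I) setT.
Arguments brace_derived {R} G n.

Definition solvable_brace (R : realType) (G : lieSkewBrace R) : Prop :=
  exists n, brace_derived G n = [set lie_one (dot G)].

Local Open Scope quotient_scope.

Definition int_lattice (R : realType) (n : nat) : {pred 'rV[R]_n} :=
  fun v => [forall i, v ord0 i \is a Num.int].

Lemma lattice_zmod_closed (R : realType) (n : nat) : zmod_closed (@int_lattice R n).
Proof.
split; first by apply/forallP => i; rewrite mxE rpred0.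
move=> u v /forallP uZ /forallP vZ; apply/forallP => i.
by rewrite !mxE rpredB.
Qed.

HB.instance Definition _ (R : realType) (n : nat) :=
  GRing.isZmodClosed.Build _ (@int_lattice R n) (@lattice_zmod_closed R n).

(* The torus T^n is R^n / Z^n with the quotient topology; its charts are the
   local inverses of the projection of R^n onto it. *)
Definition torus_points (R : realType) (n : nat) : Type :=
  quotient_topology (Quotient.quot (@int_lattice R n)).

HB.instance Definition _ (R : realType) (n : nat) :=
  Topological.copy (torus_points R n)
    (quotient_topology (Quotient.quot (@int_lattice R n))).
HB.instance Definition _ (R : realType) (n : nat) :=
  GRing.Zmodule.copy (torus_points R n) (Quotient.quot (@int_lattice R n)).

Definition torus_pi (R : realType) (n : nat) (v : 'rV[R]_n) : torus_points R n :=
  \pi_(Quotient.quot (@int_lattice R n)) v.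

Section TorusTheory.
Context {R : realType} {n : nat}.
Local Notation V := 'rV[R]_n.
Local Notation T := (torus_points R n).
Local Notation pi := (@torus_pi R n).

Lemma torus_piE (u v : V) : pi u = pi v <-> u - v \in @int_lattice R n.
Proof. by rewrite Quotient.idealrBE; split=> [e|/eqP]; [apply/eqP|]. Qed.

Lemma torus_piD (u v : V) : pi (u + v) = pi u + pi v.
Proof. exact: (@Quotient.pi_add _ (@int_lattice R n)). Qed.
Lemma torus_piN (u : V) : pi (- u) = - pi u.
Proof. exact: (@Quotient.pi_opp _ (@int_lattice R n)). Qed.

Lemma torus_pi_surj (x : T) : exists v, pi v = x.
Proof. by exists (repr (x : Quotient.quot (@int_lattice R n))); exact: reprK. Qed.

Lemma torus_openE (U : set T) : open U <-> open (pi @^-1` U).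
Proof. by []. Qed.

Lemma torus_pi_continuous : continuous pi.
Proof. exact: (@pi_continuous _ (Quotient.quot (@int_lattice R n))). Qed.

Lemma lattice_small (w : V) :
  w \in @int_lattice R n -> (forall i, `|w ord0 i| < 1) -> w = 0.
Proof.
move=> /forallP wZ w1; apply/rowP => i; rewrite mxE.
have /intrP[k wk] := wZ i; have := w1 i.
rewrite wk -intr_norm ltrz1 => k1; suff -> : k = 0 by [].
by apply/eqP; rewrite -normr_le0 -ltzD1 add0r.
Qed.

Lemma torus_pi_inj (a u v : V) : ball a (2^-1) u -> ball a (2^-1) v ->
  pi u = pi v -> u = v.
Proof.
move=> [_ au] [_ av] /torus_piE uvZ; apply/eqP; rewrite -subr_eq0; apply/eqP.
apply: lattice_small => // i; rewrite !mxE.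
move: (au ord0 i) (av ord0 i); rewrite /ball/= !ltr_distlC.
by move=> /andP[? ?] /andP[? ?]; apply/andP; split; lra.
Qed.

Lemma translate_near (P : set V) (u l : V) :
  nbhs (u + l) P -> \forall v \near u, P (v + l).
Proof.
by move=> Pul; apply: (@continuousD _ _ _ id (cst l) u) => //; exact: cst_continuous.
Qed.

Lemma torus_pi_nbhs (u : V) (N : set V) : nbhs u N -> nbhs (pi u) (pi @` N).
Proof.
rewrite nbhsE => -[B [oB Bu] BN].
rewrite nbhsE; exists (pi @` B); last by move=> _ [b Bb <-]; exists b => //; exact: BN.
split; last by exists u.
apply/torus_openE; rewrite openE => v [b Bb bv].
rewrite /interior.
have bE : v + (b - v) = b by rewrite addrC subrK.
have : nbhs (v + (b - v)) B by rewrite bE; exact: open_nbhs_nbhs.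
move=> /translate_near; apply: filterS => w Bw.
exists (w + (b - v)) => //; apply/torus_piE.
by rewrite addrC addKr; apply/torus_piE.
Qed.

Lemma torus_pi_open (A : set V) : open A -> open (pi @` A).
Proof.
move=> oA; rewrite openE => _ [a Aa <-].
by apply: torus_pi_nbhs; exact: open_nbhs_nbhs.
Qed.

Lemma lattice_near0 (w : V) : exists2 e : R, 0 < e &
  forall w', w' \in @int_lattice R n -> ball w e w' -> w \in @int_lattice R n.
Proof.
have [wZ|wNZ] := boolP (w \in @int_lattice R n); first by exists 1.
move: wNZ; rewrite [_ \in _]/(int_lattice _) /int_lattice negb_forall => /existsP[i wi].
pose t := w ord0 i; pose f : R := (Num.floor t)%:~R.
have ft : f < t.
  rewrite lt_neqAle floor_le andbT; apply: contra wi => /eqP ft; rewrite -/t -ft.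
  exact: intr_int.
have tf : t < f + 1.
  by rewrite /f -[1]/(1%:~R) -intrD floorD1_gt.
exists (Num.min (t - f) (f + 1 - t)); first by rewrite lt_min !subr_gt0 ft tf.
move=> w' /forallP/(_ i)/intrP[k wk] [_ /(_ ord0 i)].
rewrite /ball/= wk -/t lt_min !ltr_distlC => /andP[/andP[h1 _] /andP[_ h2]].
have : f < k%:~R by lra.
have : k%:~R < f + 1 :> R by lra.
rewrite /f -[1]/(1%:~R) -intrD !ltr_int ltzD1 => h3 h4.
by have := lt_le_trans h4 h3; rewrite ltxx.
Qed.

Lemma torus_hausdorff : hausdorff_space T.
Proof.
rewrite open_hausdorff => x y; have [u <-] := torus_pi_surj x.
have [v <-] := torus_pi_surj y => uv.
have [e e0 eP] := lattice_near0 (u - v).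
have e20 : 0 < e / 2 by rewrite divr_gt0.
exists (pi @` ball u (e / 2), pi @` ball v (e / 2)).
  by split; apply/mem_set; [exists u|exists v] => //; exact: ballxx.
split; [exact/torus_pi_open/ball_open..|].
apply/eqP/seteqP; split=> // _ [[u' uu' <-] [v' vv' /esym/torus_piE u'v']].
case/negP: uv; apply/eqP/torus_piE/(eP _ u'v').
move: uu' vv' => [_ uu'] [_ vv']; split=> // i j.
move: (uu' i j) (vv' i j); rewrite /ball/= !mxE.
rewrite !ltr_distlC.
by move=> /andP[? ?] /andP[? ?]; apply/andP; split; lra.
Qed.


Lemma torus_second_countable : @second_countable T.
Proof.
pose q2r (q : 'rV[rat]_n) : V := map_mx ratr q.
pose B (p : 'rV[rat]_n * rat) : set T := pi @` ball (q2r p.1) (ratr p.2).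
exists (range B); first by apply: (card_le_trans (card_image_le _ _)); exact: countableP.
split; first by move=> _ [p _ <-]; exact/torus_pi_open/ball_open.
move=> x N; have [u <-] := torus_pi_surj x => uN.
have : nbhs u (pi @^-1` N) by exact: torus_pi_continuous.
move=> /nbhs_ballP[e /= e0 ueN].
have /rat_in_itvoo[r] : 0 < e / 2 by rewrite divr_gt0.
rewrite in_itv/= => /andP[r0 re].
have dense (i : 'I_n) : exists q : rat,
    (u ord0 i - ratr r < ratr q < u ord0 i + ratr r)%R.
  have /rat_in_itvoo[q] : u ord0 i - ratr r < u ord0 i + ratr r by lra.
  by rewrite in_itv/= => ?; exists q.
have [q qP] := choice dense.
pose Q : 'rV[rat]_n := \row_i q i.
have QuE i j : ball (q2r Q i j) (ratr r) (u i j).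
  rewrite !mxE (ord1 i) /ball/= ltr_distlC.
  by have /andP[? ?] := qP j; apply/andP; split; lra.
exists (B (Q, r)) => /=.
  by split; [exists (Q, r)|exists u => //; split].
move=> _ [v [_ Qv] <-]; apply: ueN; split=> // i j.
move: (Qv i j) (QuE i j); rewrite /ball/= !ltr_distlC.
by move=> /andP[? ?] /andP[? ?]; apply/andP; split; lra.
Qed.

End TorusTheory.

Section Smooth.
Context {R : realType} {V W : normedModType R}.

Lemma class_C_cst k (U : set V) (w : W) : class_C k U (cst w).
Proof.
elim: k w => [|k IH] w /=; first by move=> x _; exact: cst_continuous.
split; first by move=> x _; exact: differentiable_cst.
move=> v; rewrite (_ : 'D_v _ = cst 0); first exact: IH.
by apply/funext => x; exact: derive_cst.
Qed.

Lemma near_eq_differentiable (f g : V -> W) (x : V) :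
  (\forall y \near x, f y = g y) -> differentiable g x -> differentiable f x.
Proof.
move=> fg dg; pose h := f - g.
have h0 : \forall y \near x, h y = 0.
  by apply: filterS fg => y fgy; rewrite /h !fctE fgy subrr.
suff dh : differentiable h x.
  by rewrite (_ : f = g + h); [exact: differentiableD|rewrite /h addrC subrK].
have hE : h \o shift x = cst (h x) + (\0 : {linear V -> W}) +o_ (0 : V) id.
  apply/eqaddoP => e e0; have hx := nbhs_singleton h0.
  have : \forall z \near (0 : V), h (z + x) = 0.
    by move: h0; rewrite (near_shift 0); apply: filterS => z; rewrite /= subr0.
  apply: filterS => z hz; rewrite !fctE /= hz hx addr0 subrr normr0.
  by rewrite mulr_ge0// ltW.
have c0 : continuous (\0 : {linear V -> W}) by move=> z; exact: cst_continuous.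
by apply/diff_locallyP; rewrite (diff_unique c0 hE).
Qed.

Lemma class_C_near k (U : set V) (f : V -> W) :
  (forall x, U x -> exists2 g, class_C k setT g & \forall y \near x, f y = g y) ->
  class_C k U f.
Proof.
elim: k f => [|k IH] f /= fg.
  move=> x Ux; have [g cg fgx] := fg x Ux.
  have gf : {near x, g =1 f} by apply: filterS fgx => y ->.
  suff : f @ x --> g x by rewrite -(nbhs_singleton fgx).
  exact: (cvg_trans (near_eq_cvg gf) (cg x I)).
split=> [x Ux|v].
  have [g [dg _] fgx] := fg x Ux.
  exact: near_eq_differentiable fgx (dg x I).
apply: IH => x Ux; have [g [_ dg] fgx] := fg x Ux.
exists ('D_v g); first exact: dg.
have : \forall y \near x, \forall z \near y, f z = g z by exact: near_join.
by apply: filterS => y; exact: near_eq_derive.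
Qed.

Lemma class_C_affine k (f : {linear V -> W}) (w : W) : continuous f ->
  class_C k setT (fun x => f x + w).
Proof.
move=> cf; case: k => [|k] /=.
  move=> x _; apply: (@continuousD _ _ _ f (cst w) x); first exact: cf.
  exact: cst_continuous.
have df x : differentiable f x by exact: linear_differentiable.
split=> [x _|v].
  by apply: (@differentiableD _ _ _ f (cst w)) => //; exact: differentiable_cst.
rewrite (_ : 'D_v _ = cst (f v)); first exact: class_C_cst.
apply/funext => x; rewrite -[LHS]/('D_v ((f : V -> W) + cst w) x).
rewrite deriveD//; last exact: diff_derivable.
by rewrite derive_cst addr0 deriveE// diff_lin.
Qed.
End Smooth.

Definition torus_atlas (R : realType) (n : nat) :
    set (chart (torus_points R n) 'rV[R]_n) :=
  [set c | is_chart c /\ forall v, chart_cod c v -> chart_from c v = torus_pi v].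

Section TorusSmooth.
Context {R : realType} {n : nat}.
Local Notation V := 'rV[R]_n.
Local Notation T := (torus_points R n).
Local Notation pi := (@torus_pi R n).

Lemma torus_atlas_cover (x : T) :
  exists2 c, @torus_atlas R n c & chart_dom c x.
Proof.
have [u <-] := torus_pi_surj x; pose B : set V := ball u 2^-1.
have half0 : 0 < 2^-1 :> R by rewrite invr_gt0.
pose s (y : T) : V := get [set v | B v /\ pi v = y].
have sP y : (pi @` B) y -> B (s y) /\ pi (s y) = y.
  by move=> [v Bv vy]; exact: (@getI _ [set v | B v /\ pi v = y] v).
have sK v : B v -> s (pi v) = v.
  move=> Bv; have [] := sP (pi v); first by exists v.
  by move=> Bs /(torus_pi_inj Bs); exact.
exists (Chart (pi @` B) B s pi); last by exists u => //; exact: ballxx.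
split=> //; split=> /=.
- exact/torus_pi_open/ball_open.
- exact: ball_open.
- by move=> y /sP[].
- by move=> v Bv; exists v.
- by move=> y /sP[].
- exact: sK.
- move=> _ [v Bv <-] N; rewrite sK// => vN.
  have : nbhs v (N `&` B) by apply: filterI => //; exact/open_nbhs_nbhs/(conj _ Bv)/ball_open.
  by move=> /torus_pi_nbhs; apply: filterS => _ [w [Nw Bw] <-]; rewrite /= sK.
- by move=> v _; exact: torus_pi_continuous.
Qed.

Lemma torus_in_charts (S : topologicalType) (E : normedModType R)
    (c : chart S E) (c' : chart T V) (f : S -> T) (fl : {linear E -> V}) :
  open (chart_cod c) -> (forall v, chart_cod c v -> {for v, continuous (chart_from c)}) ->
  torus_atlas c' -> continuous f -> continuous fl ->
  (forall v, chart_cod c v -> f (chart_from c v) = pi (fl v)) ->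
  smooth_on (in_charts_dom c c' f) (in_charts c c' f).
Proof.
move=> oc cc [c'P c'pi] cf cfl ffl k; apply: class_C_near => v [cv /= dv].
set g := in_charts c c' f.
have cfc : {for v, continuous (f \o chart_from c)}.
  by apply: continuous_comp; [exact: cc|exact: cf].
have cg : {for v, continuous g}.
  exact: (@continuous_comp _ _ _ (f \o chart_from c) (chart_to c') v cfc
    (chart_to_continuous c'P dv)).
have gfl w : chart_cod c w -> chart_dom c' (f (chart_from c w)) ->
    g w - fl w \in @int_lattice R n.
  move=> cw dw; apply/torus_piE; rewrite -ffl// -c'pi; first by rewrite chart_toK.
  exact: chart_toP.
exists (fun w => fl w + (g v - fl v)); first exact: class_C_affine.
have nd : \forall w \near v, chart_dom c' (f (chart_from c w)).
  by apply: cfc; apply: open_nbhs_nbhs; split=> //; exact: open_dom.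
have nc : \forall w \near v, chart_cod c w by apply: open_nbhs_nbhs.
have nb : \forall w \near v, ball (g v - fl v) 1 (g w - fl w).
  have : {for v, continuous (fun w => g w - fl w)}.
    by apply: (@continuousB _ _ _ g fl v) => //; exact: cfl.
  by apply; exact: nbhsx_ballx.
near=> w.
have cw : chart_cod c w by near: w.
have dw : chart_dom c' (f (chart_from c w)) by near: w.
have [_ bw] : ball (g v - fl v) 1 (g w - fl w) by near: w.
have : (g w - fl w) - (g v - fl v) = 0.
  apply: lattice_small; first by apply: rpredB; exact: gfl.
  by move=> i; move: (bw ord0 i); rewrite /ball/= distrC !mxE.
by move=> /eqP; rewrite subr_eq0 => /eqP <-; rewrite addrC subrK.
Unshelve. all: by end_near. Qed.

Lemma torus_atlas_compatible (c c' : chart T V) :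
  torus_atlas c -> torus_atlas c' -> compatible_charts c c'.
Proof.
move=> cA c'A.
have half (d d' : chart T V) : torus_atlas d -> torus_atlas d' ->
    smooth_on (in_charts_dom d d' id) (in_charts d d' id).
  move=> [dP dpi] d'A; apply: (@torus_in_charts _ _ _ _ id idfun) => //.
  - by case: dP.
  - by case: dP.
  - by move=> x; exact: cvg_id.
  - by move=> x; exact: cvg_id.
by split; exact: half.
Qed.

Lemma torus_add_continuous : continuous (fun x : T * T => x.1 + x.2).
Proof.
move=> [x y] /=; have [u <-] := torus_pi_surj x; have [v <-] := torus_pi_surj y.
move=> N; rewrite -torus_piD => /torus_pi_continuous uvN.
have : nbhs (u, v) [set w : V * V | N (pi (w.1 + w.2))].
  exact: (@add_continuous V (u, v) _ uvN).
move=> [[A B] /= [uA vB] ABN].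
exists (pi @` A, pi @` B); first by split; exact: torus_pi_nbhs.
move=> [_ _] [/= [a Aa <-] [b Bb <-]] /=; rewrite -torus_piD.
exact: (ABN (a, b)).
Qed.

Lemma torus_opp_continuous : continuous (-%R : T -> T).
Proof.
move=> x; have [u <-] := torus_pi_surj x.
move=> N; rewrite -torus_piN => /torus_pi_continuous uN.
have /torus_pi_nbhs : nbhs u [set w | N (pi (- w))] by exact: (@opp_continuous V u _ uN).
by apply: filterS => _ [w Nw <-]; rewrite /= -torus_piN.
Qed.

End TorusSmooth.

Definition torus_manifold (R : realType) (n : nat) : smoothManifold R :=
  SmoothManifold (@torus_hausdorff R n) (@torus_second_countable R n)
    (fun c (cA : torus_atlas c) => cA.1) (@torus_atlas_cover R n)
    (@torus_atlas_compatible R n).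

Section TorusGroup.
Context {R : realType} {n : nat}.
Local Notation V := 'rV[R]_n.
Local Notation T := (torus_points R n).
Local Notation pi := (@torus_pi R n).

Definition sum_pair (v : V * V) : V := v.1 + v.2.
Lemma sum_pair_linear : linear sum_pair.
Proof. by move=> a u v; rewrite /sum_pair/= scalerDr addrACA. Qed.
HB.instance Definition _ := GRing.isLinear.Build R (V * V)%type V *:%R sum_pair
  sum_pair_linear.

Lemma torus_add_smooth :
  smooth_map (prod_atlas (@torus_atlas R n) (@torus_atlas R n))
    (@torus_atlas R n) (fun x => x.1 + x.2).
Proof.
split; first exact: torus_add_continuous.
move=> _ c' [[c1 c2] [/= [c1P c1pi] [c2P c2pi]] <-] c'A.
apply: (@torus_in_charts _ _ _ _ _ _ _ sum_pair) => //=.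
- rewrite openE => -[a b] [/= ca cb]; exists (chart_cod c1, chart_cod c2) => //.
  split; apply: open_nbhs_nbhs; split=> //=.
    by case: c1P.
  by case: c2P.
- move=> [v1 v2] [/= cv1 cv2].
  have h1 : (fun v : V * V => chart_from c1 v.1) @ (v1, v2) --> chart_from c1 v1.
    apply: (@cvg_comp _ _ _ fst (chart_from c1) _ _ _ _ (chart_from_continuous c1P cv1)).
    exact: cvg_fst.
  have h2 : (fun v : V * V => chart_from c2 v.2) @ (v1, v2) --> chart_from c2 v2.
    apply: (@cvg_comp _ _ _ snd (chart_from c2) _ _ _ _ (chart_from_continuous c2P cv2)).
    exact: cvg_snd.
  exact: cvg_pair h1 h2.
- exact: torus_add_continuous.
- exact: add_continuous.
- by move=> [v1 v2] [/= cv1 cv2]; rewrite c1pi// c2pi// -torus_piD.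
Qed.

Lemma torus_opp_smooth :
  smooth_map (@torus_atlas R n) (@torus_atlas R n) -%R.
Proof.
split; first exact: torus_opp_continuous.
move=> c c' [cP cpi] c'A; apply: (@torus_in_charts _ _ _ _ _ _ _ -%R) => //=.
- by case: cP.
- by case: cP.
- exact: torus_opp_continuous.
- exact: opp_continuous.
- by move=> v cv; rewrite cpi// torus_piN.
Qed.
End TorusGroup.

Definition torus (R : realType) (n : nat) : lieGroupOn (torus_manifold R n) :=
  @LieGroupOn R (torus_manifold R n) +%R 0 -%R (@addrA (torus_points R n))
    (@add0r (torus_points R n)) (@addNr (torus_points R n))
    (@torus_add_smooth R n) (@torus_opp_smooth R n).

(* Main.v *)
Require Import Defs.
From HB Require Import structures.
From mathcomp Require Import all_boot all_order all_algebra.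
From mathcomp Require Import all_classical all_reals all_analysis.
From mathcomp Require Import ring lra.

Set Implicit Arguments.
Unset Strict Implicit.
Unset Printing Implicit Defensive.

Import Order.TTheory GRing.Theory Num.Theory.
Import numFieldNormedType.Exports.

Local Open Scope classical_set_scope.
Local Open Scope ring_scope.

(** Call [b] three-step Engel if [[b,[b,[b,x]]] = e] for all [x].  Then
    [(Ad b - 1)^3 = 0], while compactness bounds the powers of [Ad b]; hence
    [Ad b = 1], so [x |-> [b,x]] has zero differential near [e] and, the group
    being connected, [b] is central.  Climbing the derived series from its
    trivial end, each term is three-step Engel because the next one is central,
    so [(G,.)] is abelian.

    In an abelian group the limit [log x] of [2^n x^(1/2^n)] exists near [e] and
    turns products into sums; its local inverse extends to a smooth surjective
    homomorphism from [R^n] onto [G], whose kernel is discrete and cocompact.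
    Lattice vectors of minimal nonzero determinant form a basis of the kernel,
    which identifies [G] with the torus.

    Finally [x |-> lambda_a(x) x^-1] is an endomorphism of the abelian group
    [(G,.)] whose image is uniformly close to [e] when [a] is.  Lie groups have
    no small subgroups, so [lambda_a] is the identity for [a] near [e], hence for
    all [a].

    All estimates on the group law in a chart at [e] derive from one bound on its
    mixed second differences, [class_C_mixed]. *)

(** * Maps of class C^k *)

(** The terms of the derived series are only intersections of ideals: they need carry no manifold
    structure, hence no Lie algebra on which to induct. The induction therefore runs on single
    elements [b], seen through the map [x |-> [b,x]], whose differential at the unit is [Ad b - 1];
    iterating the map iterates the differential. Bounded powers then kill the nilpotent part,
    because [(l - 1)^2 w = 0] gives [l^n w = w + n (l w - w)], which grows linearly unless
    [l w = w].

    The exponential is built without integrating vector fields. Square roots near [e] are fixed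
    points of a contraction. Taking a root shrinks coordinates by at least 2/3, while the group law
    deviates from addition only to second order, so [2^n] times the error on [2^n]-th roots decays
    like [(2 . 4/9)^n = (8/9)^n]. Commutativity enters because the root of a product must be the
    product of the roots. Smoothness comes afterwards: the derivative of the exponential is a smooth
    function of the exponential itself, and that of the logarithm is explicit in the group law and
    the inverse. *)

Section ClassC.
Context {R : realType}.
Implicit Types V W E : normedModType R.

Lemma class_C_sub k V W (U U' : set V) (f : V -> W) :
  U `<=` U' -> class_C k U' f -> class_C k U f.
Proof.
move=> UU'; elim: k f => [|k IH] f /=; first by move=> cf x /UU'; exact: cf.
by move=> [df cf]; split=> [x /UU'|v]; [exact: df|exact: IH].
Qed.

Lemma class_C_S k V W (U : set V) (f : V -> W) :
  class_C k.+1 U f -> class_C k U f.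
Proof.
elim: k f => [|k IH] f [df cf].
  by move=> x Ux; apply: differentiable_continuous; exact: df.
by split=> // v; apply: IH.
Qed.

Lemma class_C_continuous k V W (U : set V) (f : V -> W) :
  class_C k U f -> forall x, U x -> {for x, continuous f}.
Proof. by elim: k => // k IH /class_C_S. Qed.

Lemma class_C_ext k V W (U : set V) (f g : V -> W) : open U ->
  (forall x, U x -> f x = g x) -> class_C k U f -> class_C k U g.
Proof.
move=> oU; elim: k f g => [|k IH] f g fg /=.
  move=> cf x Ux; have fgx : \forall y \near x, f y = g y.
    by apply: filterS fg _; exact: open_nbhs_nbhs.
  have : f @ x --> g x by rewrite -fg//; exact: cf.
  by apply: cvg_trans; exact: near_eq_cvg.
have nfg x : U x -> \forall y \near x, f y = g y.
  by move=> Ux; apply: filterS fg _; exact: open_nbhs_nbhs.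
move=> [df cf]; split=> [x Ux|v].
  apply: near_eq_differentiable (df x Ux).
  by apply: filterS (nfg x Ux) => y ->.
apply: IH (cf v) => x Ux.
exact/near_eq_derive/nfg.
Qed.

Lemma class_C_local k V W (U : set V) (f : V -> W) :
  (forall x, U x -> exists2 O, open_nbhs x O & class_C k O f) -> class_C k U f.
Proof.
elim: k f => [|k IH] f fO /=.
  by move=> x /fO[B [_ Bx] cf]; exact: cf.
split=> [x /fO[B [_ Bx] [df _]]|v]; first exact: df.
apply: IH => x /fO[B Bx [_ cf]]; exists B => //; exact: cf.
Qed.

Lemma class_CD k V W (U : set V) (f g : V -> W) : open U ->
  class_C k U f -> class_C k U g -> class_C k U (f + g).
Proof.
move=> oU; elim: k f g => [|k IH] f g /=.
  by move=> cf cg x Ux; apply: continuousD; [exact: cf|exact: cg].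
move=> [df cf] [dg cg]; split=> [x Ux|v].
  by apply: differentiableD; [exact: df|exact: dg].
apply: class_C_ext (IH _ _ (cf v) (cg v)) => // x Ux.
by rewrite deriveD//; apply: diff_derivable; [exact: df|exact: dg].
Qed.

Lemma class_C_sum k V W (U : set V) n (f : 'I_n -> V -> W) : open U ->
  (forall i, class_C k U (f i)) -> class_C k U (\sum_i f i).
Proof.
move=> oU cf; elim/big_ind : _ => //; first exact: (class_C_cst k U 0).
by move=> g h; exact: class_CD.
Qed.

Lemma class_C_linear k V W E (U : set V) (f : V -> W) (l : {linear W -> E}) :
  open U -> continuous l -> class_C k U f -> class_C k U (l \o f).
Proof.
move=> oU cl; elim: k f => [|k IH] f /=.
  by move=> cf x Ux; apply: continuous_comp; [exact: cf|exact: cl].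
have dl y : differentiable l y by exact: linear_differentiable.
move=> [df cf]; split=> [x Ux|v].
  by apply: differentiable_comp => //; exact: df.
apply: class_C_ext (IH _ (cf v)) => // x Ux /=.
have dfx := df x Ux.
rewrite [RHS]deriveE; last exact: differentiable_comp.
by rewrite diff_comp//= diff_lin// deriveE.
Qed.

Lemma class_C_pair k V W E (U : set V) (f : V -> W) (g : V -> E) : open U ->
  class_C k U f -> class_C k U g -> class_C k U (fun x => (f x, g x)).
Proof.
move=> oU; elim: k f g => [|k IH] f g /=.
  by move=> cf cg x Ux; apply: cvg_pair; [exact: cf|exact: cg].
move=> [df cf] [dg cg]; split=> [x Ux|v].
  by apply: differentiable_pair; [exact: df|exact: dg].
apply: class_C_ext (IH _ _ (cf v) (cg v)) => // x Ux /=.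
have [dfx dgx] := (df x Ux, dg x Ux).
by rewrite !deriveE ?diff_pair//; exact: differentiable_pair.
Qed.

Lemma scale_is_bilinear W :
  bilinear_for
    (GRing.Scale.Law.clone _ _ *:%R _) (GRing.Scale.Law.clone _ _ *:%R _)
    (@GRing.scale R W : R -> W -> W).
Proof.
split=> [u'|u] a x y /=; first by rewrite scalerDl scalerA.
by rewrite scalerDr !scalerA mulrC.
Qed.
HB.instance Definition _ W := bilinear_isBilinear.Build R R W W _ _
  (@GRing.scale R W : R -> W -> W) (@scale_is_bilinear W).

Lemma diff_scale V W (s : V -> R) (f : V -> W) x v :
  differentiable s x -> differentiable f x ->
  differentiable (fun y => s y *: f y) x /\
  'D_v (fun y => s y *: f y) x = s x *: 'D_v f x + 'D_v s x *: f x.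
Proof.
move=> ds df; pose b (p : R * W) : W := p.1 *: p.2.
have bc : continuous b by move=> p; exact: scale_continuous.
have db p : differentiable b p.
  exact: (@differentiable_bilin _ _ _ _ (@GRing.scale R W : R -> W -> W)).
have dp : differentiable (fun y => (s y, f y)) x by exact: differentiable_pair.
have dbc : differentiable (b \o (fun y => (s y, f y))) x.
  exact: differentiable_comp.
split; first exact: dbc.
rewrite -[fun y => _]/(b \o (fun y => (s y, f y))) !deriveE// diff_comp//=.
rewrite (@diff_bilin _ _ _ _ (@GRing.scale R W : R -> W -> W))//=.
by rewrite diff_pair.
Qed.

Lemma class_CZ k V W (U : set V) (s : V -> R) (f : V -> W) : open U ->
  class_C k U s -> class_C k U f -> class_C k U (fun x => s x *: f x).
Proof.
move=> oU; elim: k s f => [|k IH] s f.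
  move=> cs cf x Ux.
  by apply: cvgZ; [exact: cs|exact: cf].
move=> ks kf; have [ds cs] := ks; have [df cf] := kf; split=> [x Ux|v].
  by have [] := diff_scale 0 (ds x Ux) (df x Ux).
apply: class_C_ext (class_CD oU (IH _ _ (class_C_S ks) (cf v))
  (IH _ _ (cs v) (class_C_S kf))) => // x Ux.
by have [_ ->] := diff_scale v (ds x Ux) (df x Ux).
Qed.

(** Finite dimension, in the form that the chain rule needs. [class_C] differentiates in constant
    directions only, whereas composition produces the derivative of [g] in the moving direction
    ['D_v f x]; coordinates expand it over constant directions. *)
Definition has_coords E := exists n (e : 'I_n -> E) (p : 'I_n -> {linear E -> R}),
  (forall i, continuous (p i)) /\ forall x, x = \sum_i p i x *: e i.

Lemma derive_coords V W n (e : 'I_n -> V) (p : 'I_n -> {linear V -> R})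
    (f : V -> W) x v : (forall y, y = \sum_i p i y *: e i) ->
  differentiable f x -> 'D_v f x = \sum_i p i v *: 'D_(e i) f x.
Proof.
move=> pe df; rewrite deriveE// {1}(pe v) linear_sum; apply: eq_bigr => i _.
by rewrite linearZ deriveE.
Qed.

Lemma class_C_comp k V E W (U : set V) (O : set E) (f : V -> E) (g : E -> W) :
  has_coords E -> open U -> (forall x, U x -> O (f x)) ->
  class_C k U f -> class_C k O g -> class_C k U (g \o f).
Proof.
move=> [n [e [p [pc pe]]]] oU UO; elim: k f g UO => [|k IH] f g UO.
  by move=> cf cg x Ux; apply: continuous_comp; [exact: cf|exact/cg/UO].
move=> kf [dg cg]; have [df cf] := kf; split=> [x Ux|v].
  by apply: differentiable_comp; [exact: df|exact/dg/UO].
(* The derivative of the composite, with the moving direction expanded over the [e i]: each term is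
   a product of a scalar of class C^k and a composite to which the induction hypothesis applies. *)
pose F i x := p i ('D_v f x) *: ('D_(e i) g (f x)).
have CF : class_C k U (\sum_i F i).
  apply: class_C_sum => // i; apply: class_CZ => //.
    exact: (@class_C_linear k _ _ _ U ('D_v f) (p i) oU (pc i) (cf v)).
  exact: (IH _ _ UO (class_C_S kf) (cg (e i))).
apply: class_C_ext CF => // x Ux; rewrite fct_sumE.
have [dfx dgx] := (df x Ux, dg _ (UO x Ux)).
rewrite deriveE; last exact: differentiable_comp.
rewrite diff_comp//= -!deriveE// (derive_coords _ pe)//.
Qed.

End ClassC.

Section Coords.
Context {R : realType}.

Lemma has_coords_rV n : has_coords ('rV[R]_n : normedModType R).
Proof.
pose pr (i : 'I_n) (v : 'rV[R]_n) : R := v ord0 i.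
have prl i : linear (pr i) by move=> a u v; rewrite /pr !mxE.
pose p i : {linear 'rV[R]_n -> R} :=
  HB.pack (pr i) (GRing.isLinear.Build _ _ _ _ _ (prl i)).
exists n, (fun i => delta_mx ord0 i), p; split=> [i|x]; first exact: coord_continuous.
exact: row_sum_delta.
Qed.

Lemma has_coords_prod (V W : normedModType R) :
  has_coords V -> has_coords W -> has_coords (V * W)%type.
Proof.
move=> [n [e [p [pc pe]]]] [n' [e' [p' [pc' pe']]]].
pose q (i : 'I_(n + n')) (x : V * W) : R :=
  match fintype.split i with inl j => p j x.1 | inr j => p' j x.2 end.
have ql i : linear (q i).
  by move=> a x y; rewrite /q; case: fintype.split => j; rewrite linearP.
pose qq i : {linear (V * W)%type -> R} :=
  HB.pack (q i) (GRing.isLinear.Build _ _ _ _ _ (ql i)).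
exists (n + n')%N, (fun i => match fintype.split i with inl j => (e j, 0) | inr j => (0, e' j) end), qq.
split=> [i|x].
  rewrite /qq /= /q; case: fintype.split => j x.
    by apply: (@continuous_comp _ _ _ fst (p j)); [exact: cvg_fst|exact: pc].
  by apply: (@continuous_comp _ _ _ snd (p' j)); [exact: cvg_snd|exact: pc'].
rewrite big_split_ord /=.
under eq_bigr do rewrite /q (unsplitK (inl _)).
under [X in _ + X]eq_bigr do rewrite /q (unsplitK (inr _)).
case: x => a b /=.
have h1 r : \sum_(i <- r) p i a *: (e i, 0 : W) = (\sum_(i <- r) p i a *: e i, 0).
  by elim: r => [|i r IH]; rewrite ?big_nil// !big_cons IH; congr pair; rewrite /= scaler0 addr0.
have h2 r : \sum_(i <- r) p' i b *: (0 : V, e' i) = (0, \sum_(i <- r) p' i b *: e' i).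
  by elim: r => [|i r IH]; rewrite ?big_nil// !big_cons IH; congr pair; rewrite /= scaler0 addr0.
rewrite h1 h2 -pe -pe'; congr pair; rewrite /= ?addr0 ?add0r//.
Qed.
End Coords.

(** * Estimates for differentiable maps *)

Section MeanValue.
Context {R : realType}.
Implicit Types V W E : normedModType R.

Lemma rV_norm_le n (v : 'rV[R]_n) (K : R) : 0 <= K ->
  (forall i, `|v ord0 i| <= K) -> `|v| <= K.
Proof.
move=> K0 vK; rewrite /Num.Def.normr/= mx_normrE; apply: bigmax_le => // -[i j] _ /=.
by rewrite (ord1 i).
Qed.

Lemma rV_coord_le n (v : 'rV[R]_n) i : `|v ord0 i| <= `|v|.
Proof.
rewrite [leRHS]/Num.Def.normr/= mx_normrE.
exact: (le_bigmax _ (fun ij : 'I_1 * 'I_n => `|v ij.1 ij.2|) (ord0, i)).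
Qed.

(** The norm on rows is the sup norm, so the scalar mean value theorem along the segment can be
    applied to each coordinate separately. *)
Lemma mean_value_ineq V n (f : V -> 'rV[R]_n) (K : R) x y :
  (forall t : R, 0 <= t <= 1 -> differentiable f (y + t *: (x - y)) /\
    `|'D_(x - y) f (y + t *: (x - y))| <= K) ->
  `|f x - f y| <= K.
Proof.
move=> fK; have K0 : 0 <= K.
  have [_] : differentiable f (y + 0 *: (x - y)) /\ `|'D_(x - y) f (y + 0 *: (x - y))| <= K by apply: fK; rewrite lexx ler01.
  by apply: le_trans.
apply: rV_norm_le => // i.
pose l (t : R) : V := y + t *: (x - y).
pose g (t : R) : R := f (l t) ord0 i.
pose dg (t : R) : R := ('D_(x - y) f (l t)) ord0 i.
have lder (t : R) : differentiable l t /\ 'D_1 l t = x - y.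
  have dl : is_diff t l (fun s : R => s *: (x - y)).
    rewrite -[X in is_diff _ _ X]add0r; exact: is_diffD.
  split; first by case: dl.
  by rewrite deriveE// diff_val scale1r.
have gder (t : R) : 0 <= t <= 1 -> is_derive t 1 g (dg t).
  move=> /fK[df _]; have [dl lE] := lder t.
  have dfl : differentiable (f \o l) t by exact: differentiable_comp.
  have : derivable (f \o l) t 1 by exact: diff_derivable.
  move=> dvfl; have /derivable_mxP/(_ ord0 i) dgi := dvfl.
  have gE : 'D_1 g t = ('D_1 (f \o l) t) ord0 i by rewrite derive_mx// mxE.
  split; [exact: dgi|rewrite gE].
  have -> : 'D_1 (f \o l) t = 'd (f \o l) t 1 by exact: deriveE.
  have -> : 'd (f \o l) t 1 = 'd f (l t) ('d l t 1) by rewrite (diff_comp dl df).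
  by rewrite /dg -lE (deriveE _ df) (deriveE _ dl).
have [c c01 gc] : exists2 c, c \in `[0, 1] & g 1 - g 0 = dg c * (1 - 0).
  apply: (@MVT_segment _ g dg 0 1) => // [t|].
    by rewrite in_itv/= => /andP[t0 t1]; apply: gder; rewrite !ltW.
  apply: derivable_within_continuous => t; rewrite in_itv/= => t01.
  by have [] := gder t t01.
have [l0 l1] : l 0 = y /\ l 1 = x.
  by rewrite /l scale0r scale1r addr0 addrC subrK.
move: gc; rewrite subr0 mulr1 /g l0 l1 !mxE => ->.
move: c01; rewrite in_itv/= => /fK[_]; apply: le_trans.
exact: rV_coord_le.
Qed.

End MeanValue.

(** * Lipschitz and second-difference bounds *)

Section Lipschitz.
Context {R : realType}.
Implicit Types V W E : normedModType R.

Lemma diff_bound V n (e : 'I_n -> V) (p : 'I_n -> {linear V -> R}) :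
  (forall i, continuous (p i)) -> exists2 k : R, 0 < k & forall i v, `|p i v| <= k * `|v|.
Proof.
move=> pc.
have : forall i, exists k, 0 < k /\ forall v, `|p i v| <= k * `|v|.
  by move=> i; have [k k0 kP] := linear_lipschitz (pc i); exists k.
move=> /choice[k kP]; exists (1 + \sum_i k i).
  by rewrite ltr_wpDr// sumr_ge0// => i _; have [/ltW] := kP i.
move=> i v; have [_ /(_ v)/le_trans] := kP i; apply.
rewrite ler_wpM2r// (bigD1 i)//= addrCA lerDl addr_ge0//.
by rewrite sumr_ge0// => j _; have [/ltW] := kP j.
Qed.

Lemma ball_line V (x0 x y : V) (s t : R) : 0 <= t <= 1 ->
  ball x0 s x -> ball x0 s y -> ball x0 s (y + t *: (x - y)).
Proof.
move=> t01 sx sy; rewrite -ball_normE /= in sx sy *.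
have -> : x0 - (y + t *: (x - y)) = (1 - t) *: (x0 - y) + t *: (x0 - x).
  have -> : x0 - x = (x0 - y) - (x - y) by rewrite opprB addrA subrK.
  by rewrite opprD addrA scalerBl scale1r (scalerBr t (x0 - y)) addrA subrK.
move: t01 => /andP[t0 t1].
apply: (@le_lt_trans _ _ ((1 - t) * `|x0 - y| + t * `|x0 - x|)).
  by rewrite (le_trans (ler_normD _ _))// !normrZ !ger0_norm// subr_ge0.
have [->|tn0] := eqVneq t 0; first by rewrite subr0 mul1r mul0r addr0.
have tp : 0 < t by rewrite lt_neqAle eq_sym tn0.
have -> : s = (1 - t) * s + t * s by rewrite -mulrDl subrK mul1r.
by rewrite ler_ltD ?ltr_pM2l// ler_wpM2l ?subr_ge0// ltW.
Qed.

(** Continuous derivatives in the directions [e i] are bounded near [x0], and the mean value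
    inequality applies on balls because they are convex. Quantifying over all small radii lets
    several such bounds be intersected later by [near]. *)
Lemma class_C_lipschitz V n k (U : set V) (f : V -> 'rV[R]_n) x0 : has_coords V ->
  open U -> class_C k.+1 U f -> U x0 ->
  exists2 K : R, 0 < K & \forall r \near 0^'+, forall x y,
    ball x0 r x -> ball x0 r y -> `|f x - f y| <= K * `|x - y|.
Proof.
move=> [N [e [p [pc pe]]]] oU [df cf] Ux0.
have [M M0 pM] := diff_bound e pc.
pose K := \sum_i M * (`|'D_(e i) f x0| + 1).
have K0 : 0 <= K by rewrite sumr_ge0// => i _; rewrite mulr_ge0 ?addr_ge0// ltW.
exists (K + 1); first by rewrite ltr_wpDl.
have : \forall x \near x0, U x /\ forall i, `|'D_(e i) f x| <= `|'D_(e i) f x0| + 1.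
  apply: filterI; first exact: open_nbhs_nbhs.
  apply: filter_forall => i.
  have /cvgrPdist_le/(_ 1 ltr01) : 'D_(e i) f x @[x --> x0] --> 'D_(e i) f x0.
    exact: (class_C_continuous (cf (e i))).
  apply: filterS => x; rewrite distrC => Dx.
  by rewrite -lerBlDl (le_trans (lerB_dist _ _)).
move=> /nbhs_ballP[r /= r0 rP].
near=> s => x y sx sy.
apply: mean_value_ineq => t t01.
have yt_ball : ball x0 s (y + t *: (x - y)) by exact: ball_line.
have /rP[Ut Dt] : ball x0 r (y + t *: (x - y)).
  by apply: le_ball yt_ball; near: s; exact: nbhs_right_le.
split; first exact: df.
rewrite (derive_coords _ pe); last exact: df.
apply: (@le_trans _ _ (K * `|x - y|)); last by rewrite ler_wpM2r// lerDl.
rewrite (le_trans (ler_norm_sum _ _ _))// mulr_suml ler_sum// => i _.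
by rewrite normrZ mulrAC ler_pM.
Unshelve. all: by end_near. Qed.

Lemma prod_norm_r V W (w : W) : `|(0 : V, w)| = `|w|.
Proof. by rewrite prod_normE /= normr0 max_r. Qed.

Lemma derive_pair1 V W E (f : V * W -> E) x y v : differentiable f (x, y) ->
  differentiable (fun z => f (z, y)) x /\ 'D_v (fun z => f (z, y)) x = 'D_(v, 0) f (x, y).
Proof.
move=> df; pose j (z : V) : V * W := (z, y).
have dj : is_diff x j (fun v => (v, 0)) by exact: is_diff_pair.
have djx : differentiable j x by [].
have dfj : differentiable (f \o j) x by exact: differentiable_comp.
split; first exact: dfj.
have -> : 'D_v (fun z => f (z, y)) x = 'd (f \o j) x v by exact: deriveE.
rewrite (diff_comp djx df) (deriveE _ df).
by rewrite /= (@diff_val _ _ _ _ _ _ _ dj).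
Qed.

Lemma derive_pair2 V W E (f : V * W -> E) x y w : differentiable f (x, y) ->
  differentiable (fun z => f (x, z)) y /\ 'D_w (fun z => f (x, z)) y = 'D_(0, w) f (x, y).
Proof.
move=> df; pose j (z : W) : V * W := (x, z).
have dj : is_diff y j (fun w => (0, w)) by exact: is_diff_pair.
have djx : differentiable j y by [].
have dfj : differentiable (f \o j) y by exact: differentiable_comp.
split; first exact: dfj.
have -> : 'D_w (fun z => f (x, z)) y = 'd (f \o j) y w by exact: deriveE.
rewrite (diff_comp djx df) (deriveE _ df).
by rewrite /= (@diff_val _ _ _ _ _ _ _ dj).
Qed.

(** The mean value inequality is applied to [z |-> m (z, y) - m (z, y')]. Its derivative compares
    one first derivative of [m] at two points that differ in the second variable, and first
    derivatives of a C^2 map are locally Lipschitz. *)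
Lemma class_C_mixed V W n (U : set (V * W)) (m : V * W -> 'rV[R]_n) a b :
  has_coords V -> has_coords W -> open U -> class_C 2 U m -> U (a, b) ->
  exists2 C : R, 0 < C & \forall r \near 0^'+, forall x x' y y',
    ball a r x -> ball a r x' -> ball b r y -> ball b r y' ->
    `|m (x, y) - m (x', y) - (m (x, y') - m (x', y'))| <= C * (`|x - x'| * `|y - y'|).
Proof.
move=> cV cW oU [dm cm] Uab; have cVW := has_coords_prod cV cW.
have [N [e [p [pc pe]]]] := cV.
have [M M0 pM] := diff_bound e pc.
have : forall i, exists K : R, 0 < K /\ \forall r \near 0^'+, forall x y,
    ball (a, b) r x -> ball (a, b) r y ->
    `|'D_(e i, 0) m x - 'D_(e i, 0) m y| <= K * `|x - y|.
  by move=> i; have [K K0 KP] := @class_C_lipschitz _ _ 0 _ _ _ cVW oU (cm (e i, 0)) Uab; exists K.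
move=> /choice[K KP].
pose C := \sum_i M * K i.
have C0 : 0 <= C by rewrite sumr_ge0// => i _; rewrite mulr_ge0 ?ltW//; have [] := KP i.
exists (C + 1); first by rewrite ltr_wpDl.
have /nbhs_ballP[r /= r0 rU] : nbhs (a, b) U by exact: open_nbhs_nbhs.
near=> s => x x' y y' sx sx' sy sy'.
have sr : s <= r by near: s; exact: nbhs_right_le.
pose F z := m (z, y) - m (z, y').
have -> : m (x, y) - m (x', y) - (m (x, y') - m (x', y')) = F x - F x'.
  by rewrite /F !opprB [LHS]addrACA [RHS]addrACA; congr (_ + _); exact: addrC.
apply: mean_value_ineq => t t01.
set z := _ + _; have sz : ball a s z by exact: ball_line.
have ab1 w : ball b s w -> ball (a, b) s (z, w) by [].
have dzm w : ball b s w -> differentiable m (z, w).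
  by move=> sw; apply/dm/rU; apply: le_ball sr _ _; exact: ab1.
have [d1 D1] := derive_pair1 (x - x') (dzm _ sy).
have [d2 D2] := derive_pair1 (x - x') (dzm _ sy').
split; first exact: differentiableB.
have -> : 'D_(x - x') F z = 'D_(x - x', 0) m (z, y) - 'D_(x - x', 0) m (z, y').
  by rewrite -D1 -D2 -deriveB//; exact: diff_derivable.
have Dm w : ball b s w -> 'D_(x - x', 0) m (z, w) = \sum_i p i (x - x') *: 'D_(e i, 0) m (z, w).
  move=> sw; have [_ <-] := derive_pair1 (x - x') (dzm _ sw).
  rewrite (derive_coords _ pe); last by have [] := derive_pair1 0 (dzm _ sw).
  by apply: eq_bigr => i _; have [_ ->] := derive_pair1 (e i) (dzm _ sw).
rewrite !Dm// -sumrB.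
apply: (@le_trans _ _ (C * (`|x - x'| * `|y - y'|))); last first.
  by rewrite ler_wpM2r// ?mulr_ge0// lerDl.
rewrite (le_trans (ler_norm_sum _ _ _))// mulr_suml ler_sum// => i _.
rewrite -scalerBr normrZ mulrACA ler_pM//.
have Ki : forall x y, ball (a, b) s x -> ball (a, b) s y ->
    `|'D_(e i, 0) m x - 'D_(e i, 0) m y| <= K i * `|x - y|.
  by move: i; near: s; apply: filter_forall => i; have [] := KP i.
apply: (le_trans (Ki _ _ (ab1 _ sy) (ab1 _ sy'))).
have -> : (z, y) - (z, y') = (0, y - y') by rewrite -[LHS]/(z - z, y - y') subrr.
by rewrite prod_norm_r.
Unshelve. all: by end_near. Qed.

End Lipschitz.

(** * Coordinates at the unit of a Lie group *)

Section LieGroup.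
Context {R : realType} {M : smoothManifold R} (G : lieGroupOn M).
Local Notation "x ** y" := (lie_mul G x y) (at level 40, left associativity).
Local Notation e := (lie_one G).
Local Notation inv := (lie_inv G).

Lemma lmulA x y z : x ** (y ** z) = x ** y ** z.
Proof. exact: lie_mulA. Qed.

Lemma lmul1 x : e ** x = x.
Proof. exact: lie_mul1. Qed.

Lemma lmulV x : inv x ** x = e.
Proof. exact: lie_mulV. Qed.

Lemma lmulrV x : x ** inv x = e.
Proof.
rewrite -[LHS]lmul1 -{1}(lmulV (inv x)).
by rewrite -lmulA (lmulA _ x) lmulV lmul1 lmulV.
Qed.

Lemma lmulr1 x : x ** e = x.
Proof. by rewrite -(lmulV x) lmulA lmulrV lmul1. Qed.

Lemma lmulK x y : x ** y ** inv y = x.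
Proof. by rewrite -lmulA lmulrV lmulr1. Qed.

Lemma lmulVK x y : x ** inv y ** y = x.
Proof. by rewrite -lmulA lmulV lmulr1. Qed.

Lemma lmulKl x y : inv x ** (x ** y) = y.
Proof. by rewrite lmulA lmulV lmul1. Qed.

Lemma lmulVKl x y : x ** (inv x ** y) = y.
Proof. by rewrite lmulA lmulrV lmul1. Qed.

Lemma lmulI x y z : x ** y = x ** z -> y = z.
Proof. by move=> h; rewrite -(lmulKl x y) h lmulKl. Qed.

Lemma lmulIr x y z : y ** x = z ** x -> y = z.
Proof. by move=> h; rewrite -(lmulK y x) h lmulK. Qed.

Lemma linvK x : inv (inv x) = x.
Proof. by apply: (lmulIr (x := inv x)); rewrite lmulV lmulrV. Qed.

Lemma linvM x y : inv (x ** y) = inv y ** inv x.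
Proof. by apply: (lmulIr (x := x ** y)); rewrite lmulV lmulA lmulVK lmulV. Qed.

Lemma linv1 : inv e = e.
Proof. by rewrite -[LHS]lmulr1 lmulV. Qed.

Lemma lie_mul_continuous : continuous (fun x : M * M => x.1 ** x.2).
Proof. exact: (lie_mul_smooth G).1. Qed.

Lemma lie_inv_continuous : continuous inv.
Proof. exact: (lie_inv_smooth G).1. Qed.

Lemma continuous_lmul (T : topologicalType) (f g : T -> M) t :
  {for t, continuous f} -> {for t, continuous g} ->
  {for t, continuous (fun s => f s ** g s)}.
Proof.
move=> cf cg; apply: (@continuous_comp _ _ _ (fun s => (f s, g s)) (fun x => x.1 ** x.2)).
  exact: cvg_pair.
exact: lie_mul_continuous.
Qed.

Lemma continuous_linv (T : topologicalType) (f : T -> M) t :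
  {for t, continuous f} -> {for t, continuous (fun s => inv (f s))}.
Proof. by move=> cf; apply: (@continuous_comp _ _ _ f inv) => //; exact: lie_inv_continuous. Qed.

Lemma lmul_continuous a : continuous (lie_mul G a).
Proof. by move=> x; apply: continuous_lmul; [exact: cst_continuous|exact: cvg_id]. Qed.

Lemma rmul_continuous a : continuous (fun x => x ** a).
Proof. by move=> x; apply: continuous_lmul; [exact: cvg_id|exact: cst_continuous]. Qed.

Lemma near_translate a (U : set M) : nbhs e U -> \forall x \near a, U (inv a ** x).
Proof.
move=> Ue; have /(_ U) := @lmul_continuous (inv a) a.
by rewrite lmulV; apply.
Qed.

(** An open subgroup is closed, its complement being a union of cosets. The lemma serves for a
    centralizer, for the image of the exponential and for the elements with trivial [lambda]. *)
Lemma connected_subgroup (H : set M) : connected [set: M] ->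
  H e -> (forall x y, H x -> H y -> H (x ** y)) -> (forall x, H x -> H (inv x)) ->
  (\forall x \near e, H x) -> forall x, H x.
Proof.
move=> cM He HM HV He' x; suff -> : H = setT by [].
have oH : open H.
  rewrite openE => a Ha; rewrite /interior.
  apply: filterS (near_translate a He') => y Hy.
  by rewrite -(lmulVKl a y); exact: HM.
apply: cM; first by exists e.
  by exists H => //; rewrite setTI.
exists H; last by rewrite setTI.
rewrite -(setCK H); apply: open_closedC.
rewrite openE => a Ha; rewrite /interior.
apply: filterS (near_translate a He') => y Hy Hy'; apply: Ha.
have -> : a = y ** inv (inv a ** y) by rewrite linvM linvK lmulVKl.
by apply: HM => //; exact: HV.
Qed.

Lemma in_charts_dom_open (T T' : topologicalType) (E E' : normedModType R)
    (c : chart T E) (c' : chart T' E') (f : T -> T') :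
  open (chart_cod c) -> (forall v, chart_cod c v -> {for v, continuous (chart_from c)}) ->
  open (chart_dom c') -> continuous f -> open (in_charts_dom c c' f).
Proof.
move=> oc cc oc' cf; rewrite openE => v [cv fv]; rewrite /interior.
apply: filterI; first exact: open_nbhs_nbhs.
have : {for v, continuous (f \o chart_from c)}.
  by apply: continuous_comp; [exact: cc|exact: cf].
by apply; exact: open_nbhs_nbhs.
Qed.

Lemma prod_chart_cod_open (T T' : topologicalType) (E E' : normedModType R)
    (c : chart T E) (c' : chart T' E') : is_chart c -> is_chart c' ->
  open (chart_cod (prod_chart c c')).
Proof.
move=> cP cP'; rewrite openE => -[a b] [/= ca cb].
exists (chart_cod c, chart_cod c') => //.
by split; apply: open_nbhs_nbhs; split=> //; exact: open_cod.
Qed.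

Lemma prod_chart_from_continuous (T T' : topologicalType) (E E' : normedModType R)
    (c : chart T E) (c' : chart T' E') : is_chart c -> is_chart c' ->
  forall v, chart_cod (prod_chart c c') v ->
    {for v, continuous (chart_from (prod_chart c c'))}.
Proof.
move=> cP cP' [v1 v2] [/= cv1 cv2].
have h1 : (fun v : E * E' => chart_from c v.1) @ (v1, v2) --> chart_from c v1.
  apply: (@cvg_comp _ _ _ fst (chart_from c) _ _ _ _ (chart_from_continuous cP cv1)).
  exact: cvg_fst.
have h2 : (fun v : E * E' => chart_from c' v.2) @ (v1, v2) --> chart_from c' v2.
  apply: (@cvg_comp _ _ _ snd (chart_from c') _ _ _ _ (chart_from_continuous cP' cv2)).
  exact: cvg_snd.
exact: cvg_pair h1 h2.
Qed.

Lemma mul_charts_dom_open c1 c2 c' :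
  @manifold_atlas R M c1 -> @manifold_atlas R M c2 -> @manifold_atlas R M c' ->
  open (in_charts_dom (prod_chart c1 c2) c' (fun x => x.1 ** x.2)).
Proof.
move=> /atlas_chart c1P /atlas_chart c2P /atlas_chart c'P.
apply: in_charts_dom_open; [exact: prod_chart_cod_open|exact: prod_chart_from_continuous| |].
  exact: open_dom.
exact: lie_mul_continuous.
Qed.

Lemma class_C_lin k (V W : normedModType R) (U : set V) (l : {linear V -> W}) :
  continuous l -> class_C k U l.
Proof.
move=> cl; apply: (class_C_sub (U' := setT)) => //.
have := class_C_affine k 0 cl; rewrite (_ : (fun x => l x + 0) = l)//.
by apply/funext => x; rewrite addr0.
Qed.

Lemma class_C_id k (V : normedModType R) (U : set V) : class_C k U (@id V).
Proof. by apply: (class_C_lin k U (l := idfun)) => x; exact: cvg_id. Qed.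

(** Translation by [a] is the multiplication with one argument frozen at the coordinates of [a] in a
    chart [c0] around [a]. *)
Lemma lmul_charts_smooth k a c c' : @manifold_atlas R M c -> @manifold_atlas R M c' ->
  class_C k (in_charts_dom c c' (lie_mul G a)) (in_charts c c' (lie_mul G a)).
Proof.
move=> cA c'A; have [c0 c0A c0a] := atlas_cover a.
have [cP c0P c'P] := And3 (atlas_chart cA) (atlas_chart c0A) (atlas_chart c'A).
pose f (w : 'rV[R]_(manifold_dim M)) := (chart_to c0 a, w).
have fP : chart_from c0 (chart_to c0 a) = a by exact: chart_toK.
have oU : open (in_charts_dom c c' (lie_mul G a)).
  apply: in_charts_dom_open; [exact: open_cod|exact: chart_from_continuous|exact: open_dom|].
  exact: lmul_continuous.
pose m := in_charts (prod_chart c0 c) c' (fun x : M * M => x.1 ** x.2).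
have -> : in_charts c c' (lie_mul G a) = m \o f.
  by apply/funext => w; rewrite /m /in_charts /= fP.
apply: (@class_C_comp _ k _ _ _ _ (in_charts_dom (prod_chart c0 c) c' (fun x : M * M => x.1 ** x.2)) f m).
- by apply: has_coords_prod; exact: has_coords_rV.
- exact: oU.
- move=> w [cw dw]; split=> /=; last by rewrite fP.
  by split => //=; exact: chart_toP.
- by apply: class_C_pair => //; [exact: class_C_cst|exact: class_C_id].
- by apply: (lie_mul_smooth G).2 => //; exists (c0, c).
Qed.

Lemma rmul_charts_smooth k a c c' : @manifold_atlas R M c -> @manifold_atlas R M c' ->
  class_C k (in_charts_dom c c' (fun x => x ** a)) (in_charts c c' (fun x => x ** a)).
Proof.
move=> cA c'A; have [c0 c0A c0a] := atlas_cover a.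
have [cP c0P c'P] := And3 (atlas_chart cA) (atlas_chart c0A) (atlas_chart c'A).
pose f (w : 'rV[R]_(manifold_dim M)) := (w, chart_to c0 a).
have fP : chart_from c0 (chart_to c0 a) = a by exact: chart_toK.
have oU : open (in_charts_dom c c' (fun x => x ** a)).
  apply: in_charts_dom_open; [exact: open_cod|exact: chart_from_continuous|exact: open_dom|].
  exact: rmul_continuous.
pose m := in_charts (prod_chart c c0) c' (fun x : M * M => x.1 ** x.2).
have -> : in_charts c c' (fun x => x ** a) = m \o f.
  by apply/funext => w; rewrite /m /in_charts /= fP.
apply: (@class_C_comp _ k _ _ _ _ (in_charts_dom (prod_chart c c0) c' (fun x : M * M => x.1 ** x.2)) f m).
- by apply: has_coords_prod; exact: has_coords_rV.
- exact: oU.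
- move=> w [cw dw]; split=> /=; last by rewrite fP.
  by split => //=; exact: chart_toP.
- by apply: class_C_pair => //; [exact: class_C_id|exact: class_C_cst].
- by apply: (lie_mul_smooth G).2 => //; exists (c, c0).
Qed.

End LieGroup.

Section UnitChart.
Context {R : realType} {M : smoothManifold R} (G : lieGroupOn M).
Local Notation "x ** y" := (lie_mul G x y) (at level 40, left associativity).
Local Notation e := (lie_one G).
Local Notation inv := (lie_inv G).
Local Notation V := ('rV[R]_(manifold_dim M)).

Section Coordinates.
Variable c : chart M V.

Definition chart_coord (x : M) : V := chart_to c x - chart_to c e.
Definition chart_point (v : V) : M := chart_from c (v + chart_to c e).
Definition chart_law (u v : V) : V := chart_coord (chart_point u ** chart_point v).

Definition law_dom : set (V * V) :=
  [set w | in_charts_dom (prod_chart c c) c (fun x => x.1 ** x.2)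
    (w + (chart_to c e, chart_to c e))].

(** The chart is recentred so that [e] has coordinate 0, and [chart_law] is the resulting local
    group law. The bound 1/16 makes each error term at most 1/16 of the quantity that it perturbs,
    which is what the constants 2, 2/3 and 8/9 below rest on. *)
Record unit_chart (r C : R) : Prop := UnitChart {
  uc_atlas : manifold_atlas c;
  uc_unit : chart_dom c e;
  uc_r0 : 0 < r;
  uc_C0 : 0 < C;
  uc_small : C * r <= 16^-1;
  uc_cod : forall v, `|v| < r -> chart_cod c (v + chart_to c e);
  uc_law_dom : forall u v, `|u| < r -> `|v| < r -> law_dom (u, v);
  uc_mixed : forall x x' y y', `|x| < r -> `|x'| < r -> `|y| < r -> `|y'| < r ->
    `|chart_law x y - chart_law x' y - (chart_law x y' - chart_law x' y')| <= C * (`|x - x'| * `|y - y'|)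
}.

End Coordinates.

Lemma law_dom_open c : manifold_atlas c -> open (law_dom c).
Proof.
move=> cA; pose p0 := (chart_to c e, chart_to c e).
pose s := (@id (V * V)%type) + cst p0.
have cs : continuous s.
  by move=> x; apply: continuousD; [exact: cvg_id|exact: cst_continuous].
have oU : open (in_charts_dom (prod_chart c c) c (fun x => x.1 ** x.2)).
  exact: mul_charts_dom_open.
rewrite -[law_dom _]/(s @^-1` in_charts_dom (prod_chart c c) c (fun x => x.1 ** x.2)).
by apply: open_comp => // x _; exact: cs.
Qed.

Lemma law_smooth c k : manifold_atlas c ->
  class_C k (law_dom c) (fun w => chart_law c w.1 w.2).
Proof.
move=> cA; pose p0 := (chart_to c e, chart_to c e).
pose m := in_charts (prod_chart c c) c (fun x : M * M => x.1 ** x.2).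
have -> : (fun w => chart_law c w.1 w.2) = (m \o (@id _ + cst p0)) + cst (- chart_to c e).
  by apply/funext => w.
have oU := law_dom_open cA.
apply: (class_CD oU); last exact: class_C_cst.
apply: (@class_C_comp _ k _ _ _ _ (in_charts_dom (prod_chart c c) c (fun x : M * M => x.1 ** x.2))).
- by apply: has_coords_prod; exact: has_coords_rV.
- exact: oU.
- by [].
- by apply: (class_CD oU); [exact: class_C_id|exact: class_C_cst].
- by apply: (lie_mul_smooth G).2 => //; exists (c, c).
Qed.

Lemma law_dom0 c : manifold_atlas c -> chart_dom c e -> law_dom c (0, 0).
Proof.
move=> cA ce; have cP := atlas_chart cA.
have ceP : chart_from c (chart_to c e) = e by exact: chart_toK.
split => /=; rewrite !add0r.
  by split; exact: chart_toP.
by rewrite ceP lmul1.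
Qed.

Lemma unit_chart_exists : exists c r C, unit_chart c r C.
Proof.
have [c cA ce] := atlas_cover e; have cP := atlas_chart cA.
have [C C0 CP] := class_C_mixed (@has_coords_rV R _) (@has_coords_rV R _)
  (law_dom_open cA) (law_smooth 2 cA) (law_dom0 cA ce).
have /nbhs_ballP[d /= d0 dU] : nbhs ((0, 0) : V * V) (law_dom c).
  by apply: open_nbhs_nbhs; split; [exact: law_dom_open|exact: law_dom0].
have : \forall r \near 0^'+, 0 < r /\ C * r <= 16^-1 /\ r <= d /\ forall x x' y y',
    ball 0 r x -> ball 0 r x' -> ball 0 r y -> ball 0 r y' ->
    `|chart_law c x y - chart_law c x' y - (chart_law c x y' - chart_law c x' y')| <= C * (`|x - x'| * `|y - y'|).
  apply: filterI; first exact: nbhs_right_gt.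
  apply: filterI.
    have : 0 < C^-1 * 16^-1 by rewrite mulr_gt0 ?invr_gt0.
    by move=> /nbhs_right_le; apply: filterS => r; rewrite ler_pdivlMl.
  by apply: filterI; [exact: nbhs_right_le|exact: CP].
move=> /filter_ex[r [r0 [Cr [rd rP]]]]; exists c, r, C.
have bE (v : V) : `|v| < r -> ball 0 r v.
  by rewrite -ball_normE /= sub0r normrN.
have rU (u v : V) : `|u| < r -> `|v| < r -> law_dom c (u, v).
  by move=> ur vr; apply: dU; split => /=; apply: le_ball rd _ _; exact: bE.
split=> //.
  by move=> v vr; have [[]] := rU v v vr vr.
by move=> x x' y y' ? ? ? ?; apply: rP; exact: bE.
Qed.

End UnitChart.

Section UnitChartTheory.
Context {R : realType} {M : smoothManifold R} {G : lieGroupOn M}.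
Local Notation "x ** y" := (lie_mul G x y) (at level 40, left associativity).
Local Notation e := (lie_one G).
Local Notation inv := (lie_inv G).
Local Notation V := ('rV[R]_(manifold_dim M)).
Context {c : chart M V} {r C : R} (cC : unit_chart G c r C).
Local Notation coord := (chart_coord G c).
Local Notation point := (chart_point G c).
Local Notation law := (chart_law G c).
Let cA := uc_atlas cC.
Let cP := atlas_chart cA.
Let r0 := uc_r0 cC.
Let C0 := uc_C0 cC.

Lemma point0 : point 0 = e.
Proof. by rewrite /point add0r chart_toK//; exact: (uc_unit cC). Qed.

Lemma coord1 : coord e = 0.
Proof. by rewrite /coord subrr. Qed.

Lemma coordK x : chart_dom c x -> point (coord x) = x.
Proof. by move=> cx; rewrite /point subrK chart_toK. Qed.

Lemma pointK (v : V) : `|v| < r -> coord (point v) = v.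
Proof. by move=> vr; rewrite /coord chart_fromK ?addrK//; exact: (uc_cod cC). Qed.

Lemma law_pointP u v : `|u| < r -> `|v| < r -> chart_dom c (point u ** point v).
Proof. by move=> ur vr; have [] := uc_law_dom cC ur vr. Qed.

Lemma point_law u v : `|u| < r -> `|v| < r -> point (law u v) = point u ** point v.
Proof. by move=> ur vr; rewrite coordK//; exact: law_pointP. Qed.

Lemma law0r v : `|v| < r -> law v 0 = v.
Proof. by move=> vr; rewrite /chart_law point0 lmulr1 pointK. Qed.

Lemma law0l v : `|v| < r -> law 0 v = v.
Proof. by move=> vr; rewrite /chart_law point0 lmul1 pointK. Qed.

Lemma norm0_lt : `|0 : V| < r. Proof. by rewrite normr0. Qed.

(** [uc_mixed] with [y' = 0], where the law reduces to the identity of its other argument. The next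
    two bounds arise in the same way. *)
Lemma law_lipl x x' y : `|x| < r -> `|x'| < r -> `|y| < r ->
  `|law x y - law x' y - (x - x')| <= C * (`|x - x'| * `|y|).
Proof.
move=> xr xr' yr; have := uc_mixed cC xr xr' yr norm0_lt.
by rewrite !law0r// subr0.
Qed.

Lemma law_lipr x y y' : `|x| < r -> `|y| < r -> `|y'| < r ->
  `|law x y - law x y' - (y - y')| <= C * (`|x| * `|y - y'|).
Proof.
move=> xr yr yr'; have := uc_mixed cC xr norm0_lt yr yr'.
rewrite !law0l// subr0; congr (`|_| <= _).
by rewrite !opprB [LHS]addrACA [RHS]addrACA; congr (_ + _); exact: addrC.
Qed.

Lemma law_add x y : `|x| < r -> `|y| < r ->
  `|law x y - (x + y)| <= C * (`|x| * `|y|).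
Proof.
move=> xr yr; have := law_lipl xr norm0_lt yr.
by rewrite law0l// !subr0 -addrA -opprD (addrC y).
Qed.

Lemma small_le (x : V) : `|x| < r -> C * `|x| <= 16^-1.
Proof. by move=> /ltW xr; apply: le_trans (uc_small cC); rewrite ler_wpM2l// ltW. Qed.

Lemma coord_continuous x : chart_dom c x -> {for x, continuous coord}.
Proof.
move=> cx; apply: (@continuousB _ _ _ (chart_to c) (cst (chart_to c e)) x).
  exact: chart_to_continuous.
exact: cst_continuous.
Qed.

Lemma point_continuous v : `|v| < r -> {for v, continuous point}.
Proof.
move=> vr; apply: (@continuous_comp _ _ _ (fun v => v + chart_to c e) (chart_from c)).
  by apply: (@continuousD _ _ _ id (cst (chart_to c e)) v); [exact: cvg_id|exact: cst_continuous].
by apply: chart_from_continuous => //; exact: (uc_cod cC).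
Qed.

Lemma dom_near : \forall x \near e, chart_dom c x.
Proof. by apply: open_nbhs_nbhs; split; [exact: open_dom|exact: (uc_unit cC)]. Qed.

Lemma coord_near (d : R) : 0 < d -> \forall x \near e, chart_dom c x /\ `|coord x| < d.
Proof.
move=> d0; apply: filterI; first exact: dom_near.
have /cvgr0Pnorm_lt : coord x @[x --> e] --> (0 : V).
  by rewrite -coord1; apply: coord_continuous; exact: (uc_unit cC).
exact.
Qed.

Lemma norm_near (d : R) : 0 < d -> \forall v \near (0 : V), `|v| < d.
Proof.
move=> d0; apply/nbhs_ballP; exists d => //= v.
by rewrite -ball_normE /= sub0r normrN.
Qed.

Lemma point_near (N : set M) : nbhs e N -> \forall v \near (0 : V), N (point v).
Proof. by rewrite -{1}point0 => Ne; exact: (point_continuous norm0_lt). Qed.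

Lemma near_point (P : set V) : (\forall v \near (0 : V), P v) ->
  \forall x \near e, exists2 v, P v & x = point v.
Proof.
move=> /nbhs_ballP[d /= d0 dP]; apply: filterS (coord_near d0) => x [cx xd].
exists (coord x); last by rewrite coordK.
by apply: dP; rewrite -ball_normE /= sub0r normrN.
Qed.

Definition chart_conj a (w : V) : V := coord (a ** point w ** inv a).

Lemma conj_coord_near (N : set M) a : nbhs e N ->
  \forall w \near (0 : V), N (a ** point w ** inv a).
Proof.
move=> Ne; have : {for 0, continuous (fun w : V => a ** point w ** inv a)}.
  apply: continuous_lmul; last exact: cst_continuous.
  by apply: continuous_lmul; [exact: cst_continuous|apply: point_continuous norm0_lt].
by apply; rewrite point0 lmulr1 lmulrV.
Qed.

(** Since [a] may lie outside the chart [c], conjugation is factored through a chart [c0] around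
    [a]: left translation goes from [c] to [c0], and right translation by the inverse comes back. *)
Lemma conj_coord_differentiable a : differentiable (chart_conj a) 0.
Proof.
have [c0 c0A c0a] := atlas_cover a; have c0P := atlas_chart c0A.
pose f := in_charts c c0 (lie_mul G a); pose g := in_charts c0 c (fun x => x ** inv a).
pose p0 := chart_to c e.
have fp0 : in_charts_dom c c0 (lie_mul G a) p0.
  split; first by apply: chart_toP => //; exact: (uc_unit cC).
  by rewrite /= chart_toK ?lmulr1//; exact: (uc_unit cC).
have gp0 : in_charts_dom c0 c (fun x => x ** inv a) (f p0).
  have -> : f p0 = chart_to c0 a.
    by rewrite /f /in_charts /= chart_toK ?lmulr1//; exact: (uc_unit cC).
  split; first exact: chart_toP.
  by rewrite /= chart_toK// lmulrV; exact: (uc_unit cC).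
have [df _] := lmul_charts_smooth G 1 a cA c0A.
have [dg _] := rmul_charts_smooth G 1 (inv a) c0A cA.
pose s (w : V) := w + p0.
have ds : differentiable s 0.
  by apply: (@differentiableD _ _ _ id (cst p0)) => //.
have s0 : s 0 = p0 by rewrite /s add0r.
have dfs : differentiable (f \o s) 0.
  by apply: differentiable_comp; [exact: ds|rewrite s0; exact: df].
have dgfs : differentiable (g \o (f \o s)) 0.
  apply: differentiable_comp; [exact: dfs|apply: dg].
  by have -> : (f \o s) 0 = f p0 by rewrite /= s0.
have dh : differentiable ((g \o (f \o s)) - cst p0) 0.
  by apply: differentiableB; [exact: dgfs|exact: differentiable_cst].
apply: near_eq_differentiable dh.
have : \forall x \near e, chart_dom c0 (a ** x).
  have : {for e, continuous (lie_mul G a)} by exact: lmul_continuous.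
  by apply; rewrite lmulr1; apply: open_nbhs_nbhs; split => //; exact: open_dom.
move=> /point_near; apply: filterS => w aw.
rewrite /chart_conj /chart_coord [RHS]/=; congr (chart_to c (_ ** inv a) - _).
by rewrite chart_toK.
Qed.

End UnitChartTheory.

(** * The adjoint representation of a compact Lie group *)

Section Tangent.
Context {R : realType}.
Implicit Types V W : normedModType R.

Lemma diff_tangent V W (f : V -> W) x (d : R) : differentiable f x -> 0 < d ->
  \forall h \near (0 : V), `|f (h + x) - f x - 'd f x h| <= d * `|h|.
Proof.
move=> /diff_locally df d0.
have /eqaddoP/(_ d d0) := df; apply: filterS => h.
by rewrite !fctE /= opprD addrA.
Qed.

(** The way differentials are computed below: exhibit the linear map and bound the remainder. *)
Lemma tangent_diff V W (f : V -> W) x (l : {linear V -> W}) : continuous l ->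
  (forall d : R, 0 < d ->
    \forall h \near (0 : V), `|f (h + x) - f x - l h| <= d * `|h|) ->
  differentiable f x /\ 'd f x = l :> (V -> W).
Proof.
move=> cl fl; have fE : f \o shift x = cst (f x) + l +o_ (0 : V) id.
  apply/eqaddoP => d d0; apply: filterS (fl d d0) => h.
  by rewrite !fctE /= opprD addrA.
have dE := diff_unique cl fE; split => //.
by apply/diff_locallyP; rewrite dE.
Qed.

Lemma near_eq_diff V W (f g : V -> W) x : (\forall y \near x, f y = g y) ->
  differentiable g x -> 'd f x = 'd g x :> (V -> W).
Proof.
move=> fg dg; apply/funext => v.
by rewrite -!deriveE//; [exact: near_eq_derive|exact: near_eq_differentiable dg].
Qed.

Lemma linear_near_bound V W (l : {linear V -> W}) (K : R) :
  (\forall h \near (0 : V), `|l h| <= K * `|h|) -> forall v, `|l v| <= K * `|v|.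
Proof.
move=> /nbhs_ballP[d /= d0 dK] v.
have [->|v0] := eqVneq v 0; first by rewrite linear0 !normr0 mulr0.
have nv : 0 < `|v| by rewrite normr_gt0.
pose t := d / (2 * `|v|).
have t0 : 0 < t by rewrite divr_gt0// mulr_gt0.
have /dK : ball 0 d (t *: v).
  rewrite -ball_normE /= sub0r normrN normrZ gtr0_norm// /t invfM mulrA divfK ?gt_eqF//.
  by rewrite ltr_pdivrMr// ltr_pMr// ltr1n.
have tn : 0 < `|t| by rewrite normr_gt0 gt_eqF.
by rewrite linearZ !(normrZ t) mulrCA ler_pM2l.
Qed.

(** If [N (N w) = 0], then [l^n w = w + n N w], and bounded powers force [N w = 0]. Two
    applications, first at [N v] and then at [v], bring the exponent down from 3 to 1. *)
Lemma power_bounded_unipotent V (l : {linear V -> V}) (K : R) :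
  (forall n v, `|iter n l v| <= K * `|v|) ->
  let N v := l v - v in
  (forall v, N (N (N v)) = 0) -> forall v, N v = 0.
Proof.
move=> lK N N3.
have step w : N (N w) = 0 -> N w = 0.
  move=> N2; have itE n : iter n l w = w + n%:R *: N w.
    elim: n => [|n IH]; first by rewrite scale0r addr0.
    rewrite iterS IH linearD linearZ.
    have -> : l (N w) = N w by move: N2 => /eqP; rewrite subr_eq0 => /eqP.
    have -> : l w = w + N w by rewrite addrC subrK.
    by rewrite -addrA -[X in _ + (X + _)]scale1r -scalerDl nat1r.
  apply/eqP; rewrite -normr_eq0 eq_le normr_ge0 andbT leNgt; apply/negP => Nw.
  pose n := (Num.truncn ((K * `|w| + `|w|) / `|N w|)).+1.
  have : n%:R * `|N w| <= K * `|w| + `|w|.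
    rewrite -[n%:R]ger0_norm// -normrZ.
    have -> : n%:R *: N w = iter n l w - w by rewrite itE addrC addKr.
    by rewrite (le_trans (ler_normB _ _))// lerD2r.
  rewrite -ler_pdivlMr// leNgt => /negP; apply.
  by rewrite truncnS_gt.
move=> v; apply/step/step; exact: N3.
Qed.


Lemma diff0_const V n (f : V -> 'rV[R]_n) (d : R) :
  (forall x, `|x| < d -> differentiable f x /\ forall v, 'd f x v = 0) ->
  forall x, `|x| < d -> f x = f 0.
Proof.
move=> df x xd; apply/eqP; rewrite -subr_eq0 -normr_le0.
apply: mean_value_ineq => t t01.
have [dft d0] : differentiable f (0 + t *: (x - 0)) /\
    forall v, 'd f (0 + t *: (x - 0)) v = 0.
  apply: df; rewrite add0r subr0 normrZ; apply: le_lt_trans xd.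
  by move: t01 => /andP[t0 t1]; rewrite ger0_norm// ler_piMl.
by split; [exact: dft|rewrite deriveE// d0 normr0].
Qed.

End Tangent.

Section Adjoint.
Context {R : realType} {M : smoothManifold R} {G : lieGroupOn M}.
Local Notation "x ** y" := (lie_mul G x y) (at level 40, left associativity).
Local Notation e := (lie_one G).
Local Notation inv := (lie_inv G).
Local Notation V := ('rV[R]_(manifold_dim M)).
Context {c : chart M V} {r C : R} (cC : unit_chart G c r C).
Local Notation coord := (chart_coord G c).
Local Notation point := (chart_point G c).
Local Notation law := (chart_law G c).
Local Notation conj_coord a := (@chart_conj R M G c a).
Let cA := uc_atlas cC.
Let cP := atlas_chart cA.
Let r0 := uc_r0 cC.
Let C0 := uc_C0 cC.

Definition chart_Ad a : {linear V -> V} := 'd (conj_coord a) 0.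

Lemma Ad_continuous a : continuous (chart_Ad a).
Proof. by apply: diff_continuous; exact: (conj_coord_differentiable cC). Qed.

Lemma conj_coord0 a : conj_coord a 0 = 0.
Proof. by rewrite /chart_conj (point0 cC) lmulr1 lmulrV coord1. Qed.

Lemma AdM a b v : chart_Ad (a ** b) v = chart_Ad a (chart_Ad b v).
Proof.
have da := conj_coord_differentiable cC a.
have db := conj_coord_differentiable cC b.
have dab : differentiable (conj_coord a \o conj_coord b) 0.
  by apply: differentiable_comp; [exact: db|rewrite conj_coord0; exact: da].
have dE : 'd (conj_coord (a ** b)) 0 = 'd (conj_coord a \o conj_coord b) 0 :> (V -> V).
  apply: near_eq_diff dab.
  have := conj_coord_near cC b (dom_near cC); apply: filterS => w bw.
  by rewrite /= /chart_conj (coordK cC)// linvM !lmulA.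
have da' : differentiable (conj_coord a) (conj_coord b 0) by rewrite conj_coord0.
change ('d (conj_coord (a ** b)) 0 v = chart_Ad a (chart_Ad b v)).
apply: (etrans (congr1 (fun f : V -> V => f v) dE)).
apply: (etrans (congr1 (fun f : V -> V => f v) (diff_comp db da'))).
change ('d (conj_coord a) (conj_coord b 0) (chart_Ad b v) = chart_Ad a (chart_Ad b v)).
rewrite conj_coord0.
by [].
Qed.

Lemma Ad1 v : chart_Ad e v = v.
Proof.
rewrite /chart_Ad (@near_eq_diff _ _ _ _ id); first by rewrite diff_val.
  apply: filterS (norm_near r0) => w wr.
  by rewrite /chart_conj linv1 lmulr1 lmul1 (pointK cC).
exact: ex_diff.
Qed.

Lemma Ad_tangent a (d : R) : 0 < d ->
  \forall w \near (0 : V), `|conj_coord a w - chart_Ad a w| <= d * `|w|.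
Proof.
move=> d0; have := diff_tangent (conj_coord_differentiable cC a) d0.
by apply: filterS => w; rewrite addr0 conj_coord0 subr0.
Qed.

Local Opaque chart_Ad.

(* For [z], [w] the coordinates of [g x g^-1], [x] and [g = point u]: conjugation
   by elements near [e] is uniformly Lipschitz at [e]. *)
Lemma law_solve u w z : `|u| < r -> `|w| < r -> `|z| < r ->
  law z u = law u w -> `|z| <= 2 * `|w|.
Proof.
move=> ur wr zr zu.
have h1 := law_lipl cC zr (norm0_lt cC) ur.
have h2 := law_lipr cC ur wr (norm0_lt cC).
rewrite (law0l cC)// subr0 zu in h1; rewrite (law0r cC)// subr0 in h2.
have h3 := small_le cC ur.
have n1 : C * (`|z| * `|u|) <= 16^-1 * `|z|.
  by rewrite mulrCA mulrC ler_wpM2r.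
have n2 : C * (`|u| * `|w|) <= 16^-1 * `|w|.
  by rewrite mulrA ler_wpM2r.
set q := law u w - u in h1 h2.
have e1 : `|z| <= `|q - z| + `|q|.
  by rewrite -{1}(subKr q z) (le_trans (ler_normB _ _))// addrC.
have e2 : `|q| <= `|q - w| + `|w|.
  by rewrite -{1}(subrK w q) ler_normD.
have := normr_ge0 z; have := normr_ge0 w; lra.
Qed.

(** The constant 3 is the 2 of [law_solve], uniform in [g] near [e], plus 1 for the distance between
    conjugation and its differential. *)
Lemma Ad_bound_near : \forall g \near e, forall v, `|chart_Ad g v| <= 3 * `|v|.
Proof.
apply: filterS (near_point cC (norm_near r0)) => _ [u ur ->].
apply: linear_near_bound.
near=> w.
have wr : `|w| < r by near: w; exact: norm_near.
have [Fd Fr] : chart_dom c (point u ** point w ** inv (point u)) /\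
    `|conj_coord (point u) w| < r.
  by near: w; exact: (conj_coord_near cC (point u) (coord_near cC r0)).
have Fw : `|conj_coord (point u) w| <= 2 * `|w|.
  apply: (law_solve ur wr Fr).
  by rewrite /chart_law (coordK cC)// lmulVK.
have : `|conj_coord (point u) w - chart_Ad (point u) w| <= 1 * `|w|.
  by near: w; exact: (Ad_tangent (point u) ltr01).
rewrite mul1r => h.
rewrite -[X in `|X| <= _](subKr (conj_coord (point u) w)).
apply: (le_trans (ler_normB _ _)).
by rewrite [3](_ : _ = 2 + 1) ?mulrDl ?mul1r ?lerD//; lra.
Unshelve. all: by end_near. Qed.

(** No continuity of [g |-> Ad g] is involved. Near [g0] one has [Ad g = Ad g0 . Ad (g0^-1 g)],
    bounded by three times a Lipschitz constant of [Ad g0], and compactness turns these local bounds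
    into a global one. *)
Lemma Ad_bounded : compact [set: M] ->
  exists K : R, forall g v, `|chart_Ad g v| <= K * `|v|.
Proof.
move=> /compact_near_coveringP cM.
pose P (n : nat) (g : M) := forall v, `|chart_Ad g v| <= n%:R * `|v|.
have [n _ nP] : \forall n \near \oo, [set: M] `<=` P n.
  apply: (cM nat \oo P) => g0 _; have [k k0 kP] := linear_lipschitz (@Ad_continuous g0).
  exists ([set g | forall v, `|chart_Ad (inv g0 ** g) v| <= 3 * `|v|],
          [set n | (Num.truncn (k * 3) < n)%N]).
    split => /=; last by exists (Num.truncn (k * 3)).+1.
    exact: near_translate Ad_bound_near.
  move=> [g n] /= [gP nP] v.
  rewrite -(lmulVKl G g0 g) AdM; apply: (le_trans (kP _)).
  apply: (@le_trans _ _ (k * (3 * `|v|))).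
    by apply: ler_wpM2l; [exact: ltW|exact: gP].
  rewrite mulrA; apply: ler_wpM2r; first exact: normr_ge0.
  by rewrite ltW// (lt_le_trans (truncnS_gt _))// ler_nat.
by exists n%:R => g v; apply: (nP n) => //=.
Qed.

Definition lpow b n := iter n (lie_mul G b) e.

Lemma Ad_pow b n v : chart_Ad (lpow b n) v = iter n (chart_Ad b) v.
Proof.
elim: n => [|n IH]; first exact: Ad1.
rewrite (_ : lpow b n.+1 = b ** lpow b n)//.
apply: (etrans (AdM _ _ _)).
rewrite iterS.
congr (chart_Ad b _).
exact: IH.
Qed.

Definition chart_comm b (w : V) : V := coord (lie_commutator G b (point w)).

Lemma commutatorE b x : lie_commutator G b x = b ** x ** inv b ** inv x.
Proof. by rewrite /lie_commutator !lmulA. Qed.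

Lemma commutator_continuous b : continuous (lie_commutator G b).
Proof.
move=> x; apply: continuous_lmul.
  by apply: continuous_lmul; [exact: cst_continuous|exact: cvg_id].
apply: continuous_lmul; first exact: cst_continuous.
by apply: continuous_linv; exact: cvg_id.
Qed.

Lemma commutator1 b : lie_commutator G b e = e.
Proof. by rewrite commutatorE linv1 !lmulr1 lmulrV. Qed.

Lemma comm_coord_near b (N : set M) : nbhs e N ->
  \forall w \near (0 : V), N (lie_commutator G b (point w)).
Proof.
move=> Ne; apply: (point_near cC (N := [set x | N (lie_commutator G b x)])).
by have := @commutator_continuous b e; apply; rewrite commutator1.
Qed.

Lemma comm_coord0 b : chart_comm b 0 = 0.
Proof. by rewrite /chart_comm (point0 cC) commutator1 coord1. Qed.

(** Since [[b,x] x = b x b^-1], the law at the coordinates of [[b,x]] and [x] gives conjugation. By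
    [law_add] it is their sum up to [C] times the product of their norms, and [[b,x]] is close to
    [e], so the error is as small a multiple of the norm of [w] as desired. *)
Lemma comm_coord_diff b : differentiable (chart_comm b) 0 /\
  forall v, 'd (chart_comm b) 0 v = chart_Ad b v - v.
Proof.
pose l : {linear V -> V} := chart_Ad b \- idfun.
have cl : continuous l.
  by move=> v; apply: continuousB; [exact: Ad_continuous|exact: cvg_id].
have [|dq qE] := @tangent_diff _ _ _ (chart_comm b) 0 l cl; last first.
  by split; [exact: dq|move=> v; exact: (congr1 (fun f : V -> V => f v) qE)].
move=> d d0; have d20 : 0 < d / 2 by rewrite divr_gt0.
near=> w.
have wr : `|w| < r by near: w; exact: norm_near.
have [qd] : chart_dom c (lie_commutator G b (point w)) /\
    `|chart_comm b w| < Num.min r (C^-1 * (d / 2)).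
  near: w; apply: (comm_coord_near b (coord_near cC _)).
  by rewrite lt_min r0 mulr_gt0// invr_gt0.
rewrite lt_min => /andP[qr qd2].
have h1 : `|conj_coord b w - chart_Ad b w| <= d / 2 * `|w|.
  by near: w; exact: Ad_tangent.
have h2 := law_add cC qr wr.
have qE : law (chart_comm b w) w = conj_coord b w.
  by rewrite /chart_law (coordK cC)// commutatorE lmulVK.
rewrite qE in h2.
rewrite addr0 comm_coord0 subr0.
have -> : chart_comm b w - l w =
    (conj_coord b w - chart_Ad b w) - (conj_coord b w - (chart_comm b w + w)).
  rewrite -[l w]/(chart_Ad b w - w).
  by apply/rowP => i; rewrite !mxE; ring.
apply: (le_trans (ler_normB _ _)).
have : C * (`|chart_comm b w| * `|w|) <= d / 2 * `|w|.
  by rewrite mulrA ler_wpM2r// -ler_pdivlMl// ltW.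
lra.
Unshelve. all: by end_near. Qed.

Lemma near_comm_coord b : \forall w \near (0 : V), chart_dom c (lie_commutator G b (point w)).
Proof. exact: (comm_coord_near b (dom_near cC)). Qed.

Lemma Ad_engel b : compact [set: M] ->
  (forall x, lie_commutator G b (lie_commutator G b (lie_commutator G b x)) = e) ->
  forall v, chart_Ad b v = v.
Proof.
move=> cM b3 v; have [K AdK] := Ad_bounded cM.
have [dq qE] := comm_coord_diff b.
have dqq : differentiable (chart_comm b \o chart_comm b) 0.
  by apply: differentiable_comp; [exact: dq|rewrite comm_coord0; exact: dq].
have dqqq : differentiable (chart_comm b \o (chart_comm b \o chart_comm b)) 0.
  apply: differentiable_comp; [exact: dqq|].
  by rewrite /= !comm_coord0; exact: dq.
apply/eqP; rewrite -subr_eq0; apply/eqP.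
apply: (@power_bounded_unipotent _ _ (chart_Ad b) K) => [n w|w].
  by rewrite -Ad_pow.
(* Near 0 the intermediate commutators stay in the chart, so iterating in coordinates agrees with
   iterating in the group. *)
have q30 : \forall w \near (0 : V),
    (chart_comm b \o (chart_comm b \o chart_comm b)) w = cst 0 w.
  have h1 := near_comm_coord b.
  have h2 : \forall w \near (0 : V), chart_dom c (lie_commutator G b (lie_commutator G b (point w))).
    apply: (comm_coord_near b (N := [set x | chart_dom c (lie_commutator G b x)])).
    have := @commutator_continuous b e; apply; rewrite commutator1; exact: (dom_near cC).
  apply: filterS2 h1 h2 => z h1 h2.
  by rewrite /= /chart_comm (coordK cC)// (coordK cC)// b3 coord1.
have E := near_eq_diff q30 (differentiable_cst _ _).
have : 'd (chart_comm b \o (chart_comm b \o chart_comm b)) 0 w = 0.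
  by apply: (etrans (congr1 (fun f : V -> V => f w) E)); rewrite diff_cst.
have d0 : (chart_comm b \o chart_comm b) 0 = 0 by rewrite /= !comm_coord0.
have dq' : differentiable (chart_comm b) ((chart_comm b \o chart_comm b) 0) by rewrite d0.
have dq'' : differentiable (chart_comm b) (chart_comm b 0) by rewrite comm_coord0.
move=> /(etrans (esym (congr1 (fun f : V -> V => f w) (diff_comp dqq dq')))).
move=> h; pose N1 := chart_Ad b w - w; pose N2 := chart_Ad b N1 - N1.
have E2 : 'd (chart_comm b \o chart_comm b) 0 w = N2.
  apply: (etrans (congr1 (fun f : V -> V => f w) (diff_comp dq dq''))).
  have E1 := f_equal2 (fun x v => 'd (chart_comm b) x v) (comm_coord0 b) (qE w).
  exact: (etrans E1 (qE N1)).
have E3 := f_equal2 (fun x v => 'd (chart_comm b) x v) d0 E2.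
exact: (etrans (esym (etrans E3 (qE N2))) h).
Qed.

End Adjoint.

(** * Elements with trivial adjoint action are central *)

Section Central.
Context {R : realType} {M : smoothManifold R} {G : lieGroupOn M}.
Local Notation "x ** y" := (lie_mul G x y) (at level 40, left associativity).
Local Notation e := (lie_one G).
Local Notation inv := (lie_inv G).
Local Notation V := ('rV[R]_(manifold_dim M)).
Context {c : chart M V} {r C : R} (cC : unit_chart G c r C).
Local Notation coord := (chart_coord G c).
Local Notation point := (chart_point G c).
Local Notation law := (chart_law G c).
Local Notation Ad := (@chart_Ad R M G c).
Local Notation conj_coord a := (@chart_conj R M G c a).
Local Notation comm_coord := (@chart_comm R M G c).
Let r0 := uc_r0 cC.
Local Opaque chart_Ad.

(** Here [h] is the coordinate of the left quotient of the points with coordinates [h'] and [w0]: it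
    is comparable to the difference of the coordinates. *)
Lemma law_div w0 h h' : `|w0| < r -> `|h| < r -> `|h'| < r -> law w0 h = h' ->
  `|h| <= 2 * `|h' - w0|.
Proof.
move=> w0r hr hr' hE.
have := law_lipr cC w0r hr (norm0_lt cC).
rewrite (law0r cC)// subr0 hE => h1.
have n1 : C * (`|w0| * `|h|) <= 16^-1 * `|h|.
  by rewrite mulrA ler_wpM2r// (small_le cC).
have e1 : `|h| <= `|h' - w0 - h| + `|h' - w0|.
  by rewrite -{1}(subKr (h' - w0) h) (le_trans (ler_normB _ _))// addrC.
have := normr_ge0 h; lra.
Qed.

Lemma commutatorM b x y : lie_commutator G b (x ** y) =
  (b ** x ** inv b) ** lie_commutator G b y ** inv (b ** x ** inv b) **
  lie_commutator G b x.
Proof.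
by rewrite !commutatorE !linvM linvK !lmulA !lmulVK lmulK.
Qed.

(* By [commutatorM], [[b,xy]] differs from [[b,x]] by a conjugate of [[b,y]] under
   an element near [e], and [[b,y]] is of second order in [y] since [Ad b = 1]. *)
Lemma comm_coord_locally_const b w0 : (forall v, Ad b v = v) ->
  `|w0| < r -> chart_dom c (b ** point w0 ** inv b) -> `|conj_coord b w0| < r ->
  chart_dom c (lie_commutator G b (point w0)) -> `|comm_coord b w0| < r ->
  forall d : R, 0 < d ->
  \forall h \near (0 : V), `|comm_coord b (h + w0) - comm_coord b w0| <= d * `|h|.
Proof.
move=> Adb w0r ud ur qd qr d d0.
set x := point w0 in ud qd; set u := conj_coord b w0 in ur.
have pu : point u = b ** x ** inv b by rewrite (coordK cC).
have pq : point (comm_coord b w0) = lie_commutator G b x by rewrite (coordK cC).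
(* The estimates below lose a factor 17/16 in the law, 2 in [law_solve] and 2 in [law_div]: in all
   less than 8. *)
have d80 : 0 < d / 8 by rewrite divr_gt0.
have [dq qE] := comm_coord_diff cC b.
have : \forall h \near (0 : V), `|comm_coord b h| <= d / 8 * `|h|.
  have := diff_tangent dq d80; apply: filterS => h.
  by rewrite addr0 (comm_coord0 cC) subr0 qE Adb subrr subr0.
move=> /nbhs_ballP[t /= t0 tP].
pose s := Num.min r t.
have s0 : 0 < s by rewrite lt_min r0.
have near_y : \forall y \near e, [/\ chart_dom c y /\ `|coord y| < s,
    chart_dom c (lie_commutator G b y) /\ `|coord (lie_commutator G b y)| < r &
    chart_dom c (point u ** lie_commutator G b y ** inv (point u)) /\
    `|coord (point u ** lie_commutator G b y ** inv (point u))| < r].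
  have cb := @commutator_continuous _ _ G b e.
  have h1 := coord_near cC s0.
  have h2 : \forall y \near e, chart_dom c (lie_commutator G b y) /\
      `|coord (lie_commutator G b y)| < r.
    by apply: (cb [set z | chart_dom c z /\ `|coord z| < r]); rewrite commutator1; exact: (coord_near cC r0).
  have h3 : \forall y \near e,
      chart_dom c (point u ** lie_commutator G b y ** inv (point u)) /\
      `|coord (point u ** lie_commutator G b y ** inv (point u))| < r.
    have cc : {for e, continuous (fun y => point u ** lie_commutator G b y ** inv (point u))}.
      apply: continuous_lmul; last exact: cst_continuous.
      by apply: continuous_lmul; [exact: cst_continuous|exact: cb].
    by apply: (cc [set z | chart_dom c z /\ `|coord z| < r]); rewrite commutator1 lmulr1 lmulrV; exact: (coord_near cC r0).
  by near=> y; split; near: y.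
have cy : {for 0, continuous (fun h : V => inv x ** point (h + w0))}.
  apply: continuous_lmul; first exact: cst_continuous.
  apply: (@continuous_comp _ _ _ (fun h : V => h + w0) point).
    by apply: (@continuousD _ _ _ id (cst w0) 0); [exact: cvg_id|exact: cst_continuous].
  by rewrite add0r; exact: (point_continuous cC).
have {}near_y : \forall h \near (0 : V), let y := inv x ** point (h + w0) in
    [/\ chart_dom c y /\ `|coord y| < s,
    chart_dom c (lie_commutator G b y) /\ `|coord (lie_commutator G b y)| < r &
    chart_dom c (point u ** lie_commutator G b y ** inv (point u)) /\
    `|coord (point u ** lie_commutator G b y ** inv (point u))| < r].
  move: near_y; set P := (X in \forall y \near e, X y) => near_y.
  by apply: (cy P); rewrite add0r lmulV.
have hw0 : \forall h \near (0 : V), `|h + w0| < r.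
  have d1 : 0 < r - `|w0| by rewrite subr_gt0.
  apply: filterS (norm_near d1) => h hd.
  by rewrite (le_lt_trans (ler_normD _ _))// -ltrBrDr.
apply: filterS2 near_y hw0 => h' [[yd ys] [fd fr] [zd zr]] h'r.
set y := inv x ** point (h' + w0) in yd ys fd fr zd zr.
have xy : x ** y = point (h' + w0) by rewrite /y lmulVKl.
pose h := coord y; pose z := coord (point u ** lie_commutator G b y ** inv (point u)).
have py : point h = y by rewrite (coordK cC).
have hr : `|h| < r by rewrite (lt_le_trans ys)// ge_min lexx.
have hlaw : law w0 h = h' + w0 by rewrite /chart_law py xy (pointK cC).
have hh' := law_div w0r hr h'r hlaw.
rewrite addrK in hh'.
have qh : comm_coord b h = coord (lie_commutator G b y) by rewrite /chart_comm py.
have qhd : `|comm_coord b h| <= d / 8 * `|h|.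
  by apply: tP; rewrite -ball_normE /= sub0r normrN (lt_le_trans ys)// ge_min lexx orbT.
have qhr : `|comm_coord b h| < r by rewrite qh.
have zE : `|z| <= 2 * `|comm_coord b h|.
  apply: (law_solve cC ur qhr zr).
  by rewrite /chart_law /z qh (coordK cC zd) (coordK cC fd) lmulVK.
have qz : comm_coord b (h' + w0) = law z (comm_coord b w0).
  by rewrite {1}/chart_comm -xy commutatorM /chart_law pq /z (coordK cC zd) pu.
have h1 := law_lipl cC zr (norm0_lt cC) qr.
rewrite (law0l cC)// subr0 -qz in h1.
have n1 : C * (`|z| * `|comm_coord b w0|) <= 16^-1 * `|z|.
  by rewrite mulrCA mulrC ler_wpM2r// (small_le cC).
set q1 := comm_coord b (h' + w0) - comm_coord b w0 in h1 *.
have e1 : `|q1| <= `|q1 - z| + `|z| by rewrite -{1}(subrK z q1) ler_normD.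
have dh : d / 8 * `|h| <= d / 8 * (2 * `|h'|) by rewrite ler_wpM2l// ltW.
have := normr_ge0 z; have := normr_ge0 h'.
have E : d * `|h'| = 4 * (d / 8 * (2 * `|h'|)) by field.
rewrite E; set D := d / 8 * (2 * `|h'|) in dh *; lra.
Unshelve. all: by end_near. Qed.

Lemma Ad_trivial_central b : connected [set: M] -> (forall v, Ad b v = v) ->
  forall x, lie_commutator G b x = e.
Proof.
move=> cM Adb.
have h1 := conj_coord_near cC b (coord_near cC r0).
have h2 := comm_coord_near cC b (coord_near cC r0).
have /nbhs_ballP[t /= t0 tP] : \forall w \near (0 : V),
    (chart_dom c (b ** point w ** inv b) /\ `|conj_coord b w| < r) /\
    (chart_dom c (lie_commutator G b (point w)) /\ `|comm_coord b w| < r) /\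
    `|w| < r.
  by apply: filterI; [exact: h1|apply: filterI; [exact: h2|exact: norm_near]].
have dq w : `|w| < t -> differentiable (comm_coord b) w /\
    forall v, 'd (comm_coord b) w v = 0.
  move=> wt; have /tP[[ud ur] [[qd qr] wr]] : ball 0 t w.
    by rewrite -ball_normE /= sub0r normrN.
  have c0 : continuous (\0 : {linear V -> V}) by move=> z; exact: cst_continuous.
  have [d0|dw qE] := tangent_diff (f := comm_coord b) (x := w) c0.
    move=> /(comm_coord_locally_const Adb wr ud ur qd qr); apply: filterS => h.
    by rewrite subr0.
  by split; [exact: dw|move=> v; exact: (congr1 (fun f : V -> V => f v) qE)].
have q0 : forall w, `|w| < t -> comm_coord b w = 0.
  by move=> w wt; rewrite (diff0_const dq wt) (comm_coord0 cC).
have comP x : lie_commutator G b x = e <-> b ** x = x ** b.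
  rewrite commutatorE; split=> [h|->]; last by rewrite lmulK lmulrV.
  by rewrite -(lmulVK G (b ** x) b) -(lmulVK G (b ** x ** inv b) x) h lmul1.
apply: (connected_subgroup cM).
- exact: commutator1.
- by move=> x y /comP bx /comP By; apply/comP; rewrite lmulA bx -lmulA By lmulA.
- move=> x /comP bx; apply/comP.
  by apply: (lmulI (G := G) (x := x)); rewrite lmulVKl lmulA -bx lmulK.
have : \forall w \near (0 : V), lie_commutator G b (point w) = e.
  apply: filterS2 h2 (norm_near t0) => w [qd _] wt.
  by rewrite -(coordK cC qd) -[chart_coord _ _ _]/(comm_coord b w) q0// (point0 cC).
by move=> /(near_point cC); apply: filterS => _ [w + ->].
Qed.

End Central.

(** * A connected compact group with a derived series ending at the unit is abelian *)

Section Solvable.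
Context {R : realType} {M : smoothManifold R} (G : lieGroupOn M).
Local Notation "x ** y" := (lie_mul G x y) (at level 40, left associativity).
Local Notation e := (lie_one G).
Local Notation inv := (lie_inv G).

Lemma engel_central b : compact [set: M] -> connected [set: M] ->
  (forall x, lie_commutator G b (lie_commutator G b (lie_commutator G b x)) = e) ->
  forall x, b ** x = x ** b.
Proof.
move=> cM coM b3 x.
have [c [r [C cC]]] := unit_chart_exists G.
have := Ad_trivial_central cC coM (Ad_engel cC cM b3) x.
rewrite commutatorE => h.
by rewrite -(lmulVK G (b ** x) b) -(lmulVK G (b ** x ** inv b) x) h lmul1.
Qed.

Lemma solvable_abelian (D : nat -> set M) n : compact [set: M] -> connected [set: M] ->
  D 0%N = setT -> D n `<=` [set e] ->
  (forall k, is_normal G (D k)) ->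
  (forall k x y, D k x -> D k y -> D k.+1 (lie_commutator G x y)) ->
  forall x y, x ** y = y ** x.
Proof.
move=> cM coM D0 Dn DN DD.
suff central k : (k <= n)%N -> forall x y, D (n - k)%N x -> x ** y = y ** x.
  by move=> x y; apply: (central n) => //; rewrite subnn D0.
elim: k => [|k IH] kn x y; first by rewrite subn0 => /Dn ->; rewrite lmul1 lmulr1.
move=> Dx; apply: engel_central => // z.
have Dk : (n - k = (n - k.+1).+1)%N by rewrite -subSn.
have [[_ DM DV] Dc] := DN (n - k.+1)%N.
(* [[x,z]] is [x] times a conjugate of its inverse, so normality keeps it in the same term;
   bracketing once more with [x] lands in the next term, which is central by induction, and the
   third bracket is trivial. *)
have D1 : D (n - k.+1)%N (lie_commutator G x z).
  rewrite /lie_commutator -lmulA (lmulA _ z) ; apply: DM => //.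
  by apply: Dc; exact: DV.
have D2 : D (n - k)%N (lie_commutator G x (lie_commutator G x z)).
  by rewrite Dk; exact: DD.
set w := lie_commutator G x (lie_commutator G x z) in D2 *.
by rewrite commutatorE -(IH (ltnW kn) w x D2) lmulK lmulrV.
Qed.

End Solvable.

(** * Logarithm and exponential of an abelian Lie group *)

(** Rows become a complete normed module, as the fixed point theorem and the summation of
    telescoping series require. *)
HB.instance Definition _ (R : realType) (m n : nat) :=
  Uniform_isComplete.Build 'M[R]_(m, n) (@mx_complete R m n).

(** * Fixed points and geometric convergence *)

Section Analysis.
Context {R : realType}.

(** A solution of [f x = y] is a fixed point of [x |-> y - (f x - x)], a contraction of ratio 1/2
    that preserves the ball of radius [d] as soon as [y] has norm at most [d / 2]. It yields square
    roots and, later, the local inverse of the logarithm. *)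
Lemma perturbed_id_surjective (V : completeNormedModType R) (f : V -> V) (d : R) :
  0 <= d -> f 0 = 0 ->
  (forall x y, `|x| <= d -> `|y| <= d -> `|f x - f y - (x - y)| <= 2^-1 * `|x - y|) ->
  forall y, `|y| <= d / 2 -> exists2 x, `|x| <= d & f x = y.
Proof.
move=> d0 f0 fP y yd; pose U := [set x : V | `|x| <= d].
pose g x := y - (f x - x).
have gU : set_fun U U g.
  move=> x Ux; rewrite /U /g /=.
  have h := fP x 0 Ux; rewrite normr0 f0 !subr0 in h.
  have {}h := h d0; rewrite (le_trans (ler_normB _ _))//.
  by move: Ux; rewrite /U /= => Ux; lra.
have cU : closed U.
  rewrite (_ : U = closed_ball_ (@Num.norm R V) 0 d); first exact: closed_closed_ball_.
  by apply/funext => x; rewrite /closed_ball_ /U /= sub0r normrN.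
have gc : is_contraction (mkfun_fun gU).
  exists (NngNum (ltW (divr_gt0 (@ltr01 R) (ltr0Sn R 1)))); split => /=.
    by rewrite div1r invf_lt1// ltr1n.
  move=> -[a b] [/= Ua Ub]; rewrite /mkfun /g div1r.
  have -> : y - (f a - a) - (y - (f b - b)) = - (f a - f b - (a - b)).
    have cancel (p q : V) : y - p - (y - q) = - (p - q).
      by rewrite (opprB y) (addrC y) addrACA subrr addr0 opprB addrC.
    rewrite cancel; congr (- _).
    by rewrite !opprB [LHS]addrACA [RHS]addrACA (addrC (- a)).
  by rewrite normrN; exact: fP.
have [|x Ux xg] := banach_fixed_point gc cU.
  by exists 0; rewrite /U /= normr0.
exists x => //; have : g x = x by rewrite [RHS]xg.
by rewrite /g opprB addrCA -[RHS]addr0 => /addrI/eqP; rewrite subr_eq0 => /eqP.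
Qed.

(** The explicit distance from the limit to [z 0], the sum of the dominating series, is what makes
    the logarithm tangent to the identity. *)
Lemma geometric_limit (V : completeNormedModType R) (z : nat -> V) (K q : R) :
  0 < q < 1 -> (forall n, `|z n.+1 - z n| <= K * q ^+ n) ->
  exists2 l, z @ \oo --> l & `|l - z 0%N| <= K / (1 - q).
Proof.
move=> /andP[q0 q1] zK.
have q1' : 0 < 1 - q by rewrite subr_gt0.
have cs : cvgn (series (telescope z)).
  apply: normed_cvg; apply: (@series_le_cvg _ _ (geometric K q)).
  - by move=> n; exact: normr_ge0.
  - by move=> n; exact: le_trans (normr_ge0 _) (zK n).
  - by move=> n; exact: zK.
  - by apply: is_cvg_geometric_series; rewrite gtr0_norm.
rewrite telescopeK in cs.
pose l := lim ((fun n => z n - z 0%N) @ \oo) + z 0%N.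
have zl : z @ \oo --> l.
  have h : (fun n => (z n - z 0%N) + z 0%N) @ \oo --> l by apply: cvgD => //; exact: cvg_cst.
  by apply: cvg_trans h; apply: near_eq_cvg; apply: nearW => n; rewrite subrK.
exists l => //.
have K0 : 0 <= K by have := le_trans (normr_ge0 _) (zK 0%N); rewrite expr0 mulr1.
have zB n : `|z n - z 0%N| <= K / (1 - q) * (1 - q ^+ n).
  elim: n => [|n IH]; first by rewrite subrr normr0 expr0 subrr mulr0.
  rewrite -(subrK (z n) (z n.+1)) -addrA (le_trans (ler_normD _ _))//.
  apply: (le_trans (lerD (zK n) IH)).
  rewrite le_eqVlt; apply/orP; left; apply/eqP; rewrite exprS; field.
  by rewrite gt_eqF.
have cN : (fun n => `|z n - z 0%N|) @ \oo --> `|l - z 0%N|.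
  by apply: cvg_norm; apply: cvgB => //; exact: cvg_cst.
apply: (@closed_cvg _ _ \oo _ (fun n => `|z n - z 0%N|) (fun t => t <= K / (1 - q)) _ _ _ cN).
  exact: closed_le.
apply: nearW => n; apply: (le_trans (zB n)).
have := divr_ge0 K0 (ltW q1').
have : 0 <= q ^+ n by rewrite exprn_ge0// ltW.
by move=> ? ?; rewrite ler_piMr// lerBlDr lerDl.
Qed.

End Analysis.

(** * Extending a local homomorphism to the whole vector space *)

Section Extension.
Context {R : realType} {M : smoothManifold R} {G : lieGroupOn M}.
Local Notation "x ** y" := (lie_mul G x y) (at level 40, left associativity).
Hypothesis abel : forall x y, x ** y = y ** x.

Lemma lmulACA x y z t : x ** y ** (z ** t) = x ** z ** (y ** t).
Proof. by rewrite !lmulA -(lmulA _ x y z) (abel y z) lmulA. Qed.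

(* The extension is [v |-> f (2^-n v) ^ (2^n)] for any large [n]. *)
Lemma extend_hom (V : normedModType R) (f : V -> M) (d : R) : 0 < d ->
  (forall u v, `|u| < d -> `|v| < d -> `|u + v| < d -> f (u + v) = f u ** f v) ->
  exists2 g : V -> M, forall u v, g (u + v) = g u ** g v &
    forall v, `|v| < d -> g v = f v.
Proof.
move=> d0 fD; pose sq x := x ** x.
have itM n x y : iter n sq (x ** y) = iter n sq x ** iter n sq y.
  by elim: n => //= n ->; rewrite /sq lmulACA.
pose h n v := iter n sq (f ((2 ^+ n)^-1 *: v)).
pose P n (v : V) := `|v| < d * 2 ^+ n.
have p2 n : 0 < 2 ^+ n :> R by rewrite exprn_gt0.
have PE n v : P n v -> `|(2 ^+ n)^-1 *: v| < d.
  by rewrite /P normrZ gtr0_norm ?invr_gt0// ltr_pdivrMl// mulrC.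
have PS n v : P n v -> P n.+1 v.
  move=> /lt_le_trans; apply; rewrite exprS mulrCA ler_peMl// ?ler1n//.
  by rewrite mulr_ge0// ltW.
(* One more halving followed by one more squaring changes nothing, because [f w = f (w / 2) ^ 2] for
   small [w]. Hence [h n v] is constant in [n] once [P n v] holds. *)
have hS n v : P n v -> h n.+1 v = h n v.
  move=> Pv; rewrite /h iterSr; congr (iter n sq _).
  have e2 : (2 ^+ n)^-1 *: v = (2 ^+ n.+1)^-1 *: v + (2 ^+ n.+1)^-1 *: v.
    rewrite -scalerDl; congr (_ *: _); rewrite exprS; field.
    by rewrite gt_eqF.
  have an : `|(2 ^+ n.+1)^-1 *: v| < d by exact/PE/PS.
  by rewrite /sq e2 fD// -e2; exact: PE.
have hA k n v : P n v -> h (k + n)%N v = h n v /\ P (k + n)%N v.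
  move=> Pv; elim: k => // k [IH IP].
  by rewrite addSn hS//; split => //; exact: PS.
have exN v : exists n, P n v.
  exists (Num.truncn (`|v| / d)).+1; rewrite /P mulrC -ltr_pdivrMr//.
  apply: (lt_le_trans (truncnS_gt _)).
  by rewrite -natrX ler_nat ltnW// ltn_expl.
pose N v := sval (cid (exN v)).
have NP v : P (N v) v by rewrite /N; case: cid.
have hN n v : P n v -> h n v = h (N v) v.
  move=> Pv; have [<- _] := hA (N v) n v Pv.
  by have [<- _] := hA n (N v) v (NP v); rewrite addnC.
exists (fun v => h (N v) v); last first.
  move=> v vd; rewrite -(hN 0%N) /P ?expr0 ?mulr1//.
  by rewrite /h /= expr0 invr1 scale1r.
(* A common stage, large enough for [u], [v] and their sum, at which [f] is additive. *)
move=> u v; pose n := (N u + (N v + N (u + v)%R))%N.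
have Pu : P n u by rewrite /n addnC; have [] := hA (N v + N (u + v)%R)%N _ _ (NP u).
have Pv : P n v.
  by rewrite /n addnA addnAC; have [] := hA (N u + N (u + v)%R)%N _ _ (NP v).
have Puv : P n (u + v).
  by rewrite /n addnA; have [] := hA (N u + N v)%N _ _ (NP (u + v)).
rewrite -(hN n u)// -(hN n v)// -(hN n (u + v))// /h -itM scalerDr fD//; try exact: PE.
by rewrite -scalerDr; exact: PE.
Qed.

End Extension.

(** * The logarithm by repeated square roots *)

Section LocalLog.
Context {R : realType} {M : smoothManifold R} {G : lieGroupOn M}.
Local Notation "x ** y" := (lie_mul G x y) (at level 40, left associativity).
Local Notation e := (lie_one G).
Local Notation inv := (lie_inv G).
Local Notation V := ('rV[R]_(manifold_dim M)).
Hypothesis abel : forall x y, x ** y = y ** x.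
Context {c : chart M V} {r C : R} (cC : unit_chart G c r C).
Local Notation coord := (chart_coord G c).
Local Notation point := (chart_point G c).
Local Notation law := (chart_law G c).
Let r0 := uc_r0 cC.
Let C0 := uc_C0 cC.

(** Squaring is a small Lipschitz perturbation of [x |-> 2 x]: this gives both existence and
    uniqueness of small square roots. *)
Lemma law_double_lip x y : `|x| < r -> `|y| < r ->
  `|law x x - law y y - 2 *: (x - y)| <= 8^-1 * `|x - y|.
Proof.
move=> xr yr; have h1 := law_lipl cC xr yr xr; have h2 := law_lipr cC yr xr yr.
have -> : law x x - law y y - 2 *: (x - y) =
    (law x x - law y x - (x - y)) + (law y x - law y y - (x - y)).
  by apply/rowP => i; rewrite !mxE; ring.
apply: (le_trans (ler_normD _ _)).
have := small_le cC xr; have := small_le cC yr => sy sx.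
have n1 : C * (`|x - y| * `|x|) <= 16^-1 * `|x - y|.
  by rewrite mulrCA mulrC ler_wpM2r.
have n2 : C * (`|y| * `|x - y|) <= 16^-1 * `|x - y|.
  by rewrite mulrA ler_wpM2r.
lra.
Qed.

Lemma law_double_inj x y : `|x| < r -> `|y| < r -> law x x = law y y -> x = y.
Proof.
move=> xr yr xy; have := law_double_lip xr yr.
rewrite xy subrr sub0r normrN normrZ ger0_norm// => h.
apply/eqP; rewrite -subr_eq0 -normr_le0.
by have := normr_ge0 (x - y); lra.
Qed.

Lemma law_double x : `|x| < r -> `|law x x - 2 *: x| <= C * `|x| ^+ 2.
Proof.
move=> xr; have := law_add cC xr xr.
by rewrite scaler_nat mulr2n expr2.
Qed.

(** The estimate gives 16/31, rounded up to 2/3. What matters for the logarithm is that the square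
    of the ratio stay below 1/2, so that [2 . (2/3)^2 = 8/9] is below 1. *)
Lemma law_half_norm x : `|x| < r -> `|x| <= 2 / 3 * `|law x x|.
Proof.
move=> xr; have h := law_double xr; have s := small_le cC xr.
have n1 : C * `|x| ^+ 2 <= 16^-1 * `|x| by rewrite expr2 mulrA ler_wpM2r.
have e1 : `|2 *: x| <= `|law x x - 2 *: x| + `|law x x|.
  by rewrite -{1}(subKr (law x x) (2 *: x)) (le_trans (ler_normB _ _))// addrC.
rewrite normrZ ger0_norm// in e1.
have := normr_ge0 x; lra.
Qed.

Lemma law_root_exists y : `|y| <= r / 2 -> exists2 x, `|x| <= r / 2 & law x x = y.
Proof.
move=> yr; pose f (x : V) := 2^-1 *: law x x.
have rr : r / 2 < r by have := r0; lra.
have r20 : 0 <= r / 2 by rewrite divr_ge0// ltW.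
have [|||x xr fx] := @perturbed_id_surjective _ V f (r / 2) r20 _ _ (2^-1 *: y).
- by rewrite /f (law0r cC) ?scaler0// normr0.
- move=> a b ar br.
  have -> : f a - f b - (a - b) = 2^-1 *: (law a a - law b b - 2 *: (a - b)).
    by apply/rowP => i; rewrite /f !mxE; field.
  rewrite normrZ gtr0_norm ?invr_gt0//.
  have := law_double_lip (le_lt_trans ar rr) (le_lt_trans br rr).
  by have := normr_ge0 (a - b); lra.
- by rewrite normrZ gtr0_norm ?invr_gt0//; lra.
exists x => //.
by apply: (scalerI (a := 2^-1)) => //; rewrite gt_eqF// invr_gt0.
Qed.

(* The square root of [point y] in coordinates; junk if [r / 2 < `|y|]. *)
Definition law_root (y : V) : V := get [set x | `|x| <= r / 2 /\ law x x = y].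

Lemma law_rootP y : `|y| <= r / 2 ->
  [/\ `|law_root y| <= r / 2, law (law_root y) (law_root y) = y & `|law_root y| <= 2 / 3 * `|y|].
Proof.
move=> /law_root_exists[x xr xy].
have [h1 h2] : `|law_root y| <= r / 2 /\ law (law_root y) (law_root y) = y.
  by apply: (@getPex _ [set x | `|x| <= r / 2 /\ law x x = y]); exists x.
split => //; rewrite -{2}h2; apply: law_half_norm.
by have := r0; lra.
Qed.

Lemma iter_root y n : `|y| <= r / 2 -> `|iter n law_root y| <= (2 / 3) ^+ n * `|y| /\
  `|iter n law_root y| <= r / 2.
Proof.
move=> yr; elim: n => [|n [IH1 IH2]]; first by rewrite expr0 mul1r.
have [h1 _ h3] := law_rootP IH2; split => //=.
by rewrite exprS -mulrA (le_trans h3)// ler_wpM2l.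
Qed.

Lemma eight_ninth n : (8 / 9) ^+ n = 2 ^+ n * ((2 / 3) ^+ n) ^+ 2 :> R.
Proof. by rewrite exprAC -exprMn; congr (_ ^+ n); field. Qed.

Definition log_approx (y : V) (n : nat) : V := 2 ^+ n *: iter n law_root y.

(** Consecutive approximations differ by [2^n] times the defect of doubling at the next root; this
    defect is quadratic in a root of size [(2/3)^n]. *)
Lemma log_approx_step y n : `|y| <= r / 2 ->
  `|log_approx y n.+1 - log_approx y n| <= C * `|y| ^+ 2 * (8 / 9) ^+ n.
Proof.
move=> yr; have [h1 h2] := iter_root n yr; have [h3 h4] := iter_root n.+1 yr.
have rr : r / 2 < r by have := r0; lra.
have [_ rE _] := law_rootP h2.
have -> : log_approx y n.+1 - log_approx y n =
    - (2 ^+ n *: (law (iter n.+1 law_root y) (iter n.+1 law_root y) - 2 *: iter n.+1 law_root y)).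
  rewrite (_ : law _ _ = iter n law_root y); last exact: rE.
  rewrite /log_approx; move: (iter n.+1 law_root y) (iter n law_root y) => a b.
  by apply/rowP => i; rewrite !mxE exprS; ring.
rewrite normrN normrZ gtr0_norm ?exprn_gt0//.
have hd := law_double (le_lt_trans h4 rr).
apply: (@le_trans _ _ (2 ^+ n * (C * ((2 / 3) ^+ n * `|y|) ^+ 2))).
  rewrite ler_wpM2l ?exprn_ge0//; apply: (le_trans hd).
  rewrite ler_wpM2l ?(ltW C0)// lerXn2r ?nnegrE ?mulr_ge0 ?exprn_ge0//.
  apply: (le_trans h3); rewrite ler_wpM2r// exprS ler_piMl ?exprn_ge0//; lra.
rewrite le_eqVlt; apply/orP; left; apply/eqP.
rewrite eight_ninth; ring.
Qed.

Definition chart_log (y : V) : V := lim (log_approx y @ \oo).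

(** The factor 9 is [1 / (1 - 8/9)], from the sum of the geometric series. *)
Lemma log_spec y : `|y| <= r / 2 ->
  log_approx y @ \oo --> chart_log y /\ `|chart_log y - y| <= 9 * C * `|y| ^+ 2.
Proof.
move=> yr.
have q01 : 0 < (8 / 9 : R) < 1 by apply/andP; split; lra.
have [l yl lB] := geometric_limit q01 (fun n => log_approx_step n yr).
have lE : chart_log y = l by exact: cvg_lim.
rewrite lE; split => //.
have -> : y = log_approx y 0 by rewrite /log_approx expr0 scale1r.
apply: (le_trans lB); rewrite /log_approx expr0 scale1r /=.
by rewrite le_eqVlt; apply/orP; left; apply/eqP; field.
Qed.

Lemma log0 : chart_log 0 = 0.
Proof.
have z : `|0 : V| <= r / 2 by rewrite normr0 divr_ge0// ltW.
have [_] := log_spec z; rewrite normr0 expr0n mulr0 subr0.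
by rewrite normr_le0 => /eqP.
Qed.

Lemma law_norm x y : `|x| < r -> `|y| < r -> `|law x y| <= 2 * (`|x| + `|y|).
Proof.
move=> xr yr; have h := law_add cC xr yr; have s := small_le cC xr.
have n1 : C * (`|x| * `|y|) <= 16^-1 * `|y| by rewrite mulrA ler_wpM2r.
have e1 : `|law x y| <= `|law x y - (x + y)| + `|x + y|.
  by rewrite -{1}(subrK (x + y) (law x y)) ler_normD.
have e2 := ler_normD x y; have := normr_ge0 x; have := normr_ge0 y; lra.
Qed.

(** By commutativity both sides are square roots of the product, and small square roots are unique.
    The radius [r / 8] is chosen so that [law_norm] puts the product within [r / 2], the range of
    [law_root]. *)
Lemma root_law x y : `|x| <= r / 8 -> `|y| <= r / 8 ->
  law_root (law x y) = law (law_root x) (law_root y).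
Proof.
move=> x8 y8; have rr := r0.
have x2 : `|x| <= r / 2 by lra.
have y2 : `|y| <= r / 2 by lra.
have xr : `|x| < r by lra.
have yr : `|y| < r by lra.
have xy2 : `|law x y| <= r / 2 by have := law_norm xr yr; lra.
have [h1 h2 h3] := law_rootP xy2; have [x1 xE x3] := law_rootP x2; have [y1 yE y3] := law_rootP y2.
have rxr : `|law_root x| < r by lra.
have ryr : `|law_root y| < r by lra.
have lr : `|law (law_root x) (law_root y)| < r.
  by have := law_norm rxr ryr; have := normr_ge0 x; have := normr_ge0 y; lra.
apply: law_double_inj => //; first by lra.
rewrite h2 -[in LHS]xE -[in LHS]yE /chart_law.
by rewrite !(point_law cC)// lmulACA.
Qed.

Lemma log_law x y : `|x| <= r / 8 -> `|y| <= r / 8 ->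
  chart_log (law x y) = chart_log x + chart_log y.
Proof.
move=> x8 y8; have rr := r0.
have x2 : `|x| <= r / 2 by lra.
have y2 : `|y| <= r / 2 by lra.
have xr : `|x| < r by lra.
have yr : `|y| < r by lra.
have xy2 : `|law x y| <= r / 2 by have := law_norm xr yr; lra.
have [cx _] := log_spec x2; have [cy _] := log_spec y2; have [cxy _] := log_spec xy2.
have itE n : iter n law_root (law x y) = law (iter n law_root x) (iter n law_root y) /\
    (`|iter n law_root x| <= r / 8 /\ `|iter n law_root y| <= r / 8).
  elim: n => // n [IH [ix iy]] /=; rewrite IH root_law//.
  have ix2 : `|iter n law_root x| <= r / 2 by lra.
  have iy2 : `|iter n law_root y| <= r / 2 by lra.
  have [_ _ hx] := law_rootP ix2; have [_ _ hy] := law_rootP iy2.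
  by split => //; split; [have := normr_ge0 (iter n law_root x)|have := normr_ge0 (iter n law_root y)]; lra.
have cs : (fun n => log_approx x n + log_approx y n) @ \oo --> chart_log x + chart_log y.
  exact: (cvgD cx cy).
have cd : (fun n => log_approx (law x y) n - (log_approx x n + log_approx y n)) @ \oo -->
    chart_log (law x y) - (chart_log x + chart_log y).
  exact: (cvgB cxy cs).
(* On the [n]-th roots the law differs from addition by a product of two norms of order [(2/3)^n],
   which beats the factor [2^n]. *)
have c0 : (fun n => log_approx (law x y) n - (log_approx x n + log_approx y n)) @ \oo --> (0 : V).
  pose K := C * (`|x| * `|y|).
  have q9 : `|8 / 9 : R| < 1 by rewrite ger0_norm; lra.
  have cq := @cvg_geometric R K (8 / 9) q9.
  apply/cvgr0Pnorm_le => d d0.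
  have : \forall n \near \oo, `|geometric K (8 / 9) n| <= d by move/cvgr0Pnorm_le : cq; exact.
  apply: filterS => n; rewrite /geometric /= => nd.
  have [iE [ix iy]] := itE n.
  have [hx _] := iter_root n x2; have [hy _] := iter_root n y2.
  have ixr : `|iter n law_root x| < r by lra.
  have iyr : `|iter n law_root y| < r by lra.
  rewrite /log_approx iE -scalerDr -scalerBr normrZ gtr0_norm ?exprn_gt0//.
  apply: le_trans nd; apply: le_trans (ler_norm _).
  apply: (@le_trans _ _ (2 ^+ n * (C * ((2 / 3) ^+ n * `|x| * ((2 / 3) ^+ n * `|y|))))).
    rewrite ler_wpM2l ?exprn_ge0//; apply: (le_trans (law_add cC ixr iyr)).
    by rewrite ler_wpM2l ?(ltW C0)// ler_pM.
  rewrite le_eqVlt; apply/orP; left; apply/eqP; rewrite /K.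
  by rewrite eight_ninth; ring.
apply/eqP; rewrite -subr_eq0; apply/eqP.
exact: (cvg_unique (@norm_hausdorff _ V) cd c0).
Qed.

End LocalLog.

(** * The exponential as local inverse of the logarithm *)

Section Exponential.
Context {R : realType} {M : smoothManifold R} {G : lieGroupOn M}.
Local Notation "x ** y" := (lie_mul G x y) (at level 40, left associativity).
Local Notation e := (lie_one G).
Local Notation inv := (lie_inv G).
Local Notation V := ('rV[R]_(manifold_dim M)).
Hypothesis abel : forall x y, x ** y = y ** x.
Context {c : chart M V} {r C : R} (cC : unit_chart G c r C).
Local Notation coord := (chart_coord G c).
Local Notation point := (chart_point G c).
Local Notation law := (chart_law G c).
Local Notation log := (@chart_log R M G c r).
Let r0 := uc_r0 cC.
Let C0 := uc_C0 cC.

Lemma div_near (d : R) : 0 < d ->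
  exists2 t : R, 0 < t & forall x y, `|x| <= t -> `|y| <= t ->
    chart_dom c (inv (point y) ** point x) /\ `|coord (inv (point y) ** point x)| < d.
Proof.
move=> d0; have cd : {for (0, 0), continuous (fun w : V * V => inv (point w.2) ** point w.1)}.
  have p1 : {for (0, 0), continuous (fun w : V * V => point w.1)}.
    apply: (@continuous_comp _ _ _ fst point); first exact: cvg_fst.
    exact: (point_continuous cC (norm0_lt cC)).
  have p2 : {for (0, 0), continuous (fun w : V * V => point w.2)}.
    apply: (@continuous_comp _ _ _ snd point); first exact: cvg_snd.
    exact: (point_continuous cC (norm0_lt cC)).
  exact: (continuous_lmul (continuous_linv p2) p1).
have : \forall w \near ((0, 0) : V * V), chart_dom c (inv (point w.2) ** point w.1) /\
    `|coord (inv (point w.2) ** point w.1)| < d.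
  apply: (cd [set z | chart_dom c z /\ `|coord z| < d]).
  by rewrite /= (point0 cC) lmulV; exact: (coord_near cC d0).
move=> /nbhs_ballP[t /= t0 tP]; exists (t / 2); first by rewrite divr_gt0.
have bE (v : V) : `|v| <= t / 2 -> ball 0 t v.
  by rewrite -ball_normE /= sub0r normrN => /le_lt_trans; apply; lra.
by move=> x y xt yt; apply: (tP (x, y)); split; exact: bE.
Qed.

(** By additivity [log x - log y = log h], with [h] the coordinate of the left quotient of the two
    points. [log h] is [h] up to second order, and [h] is [x - y] up to a small multiple of itself.
    So [log] is a perturbation of the identity to which [perturbed_id_surjective] applies. *)
Lemma log_lip : exists2 d : R, 0 < d <= r / 8 &
  forall x y, `|x| <= d -> `|y| <= d ->
    `|log x - log y - (x - y)| <= 2^-1 * `|x - y|.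
Proof.
have r8 : 0 < r / 8 by rewrite divr_gt0.
have [t t0 tP] := div_near r8.
exists (Num.min t (r / 8)); first by rewrite lt_min t0 r8 ge_min lexx orbT.
move=> x y; rewrite !le_min => /andP[xt x8] /andP[yt y8].
have [hd h8] := tP x y xt yt; set h := coord _ in h8.
have rr := r0.
have xr : `|x| < r by lra.
have yr : `|y| < r by lra.
have hr : `|h| < r by lra.
have ph : point h = inv (point y) ** point x by rewrite (coordK cC).
have hE : law y h = x by rewrite /chart_law ph lmulVKl (pointK cC).
have lE : log x = log y + log h by rewrite -{1}hE; apply: (log_law abel cC) => //; exact: ltW.
have n1 := law_div cC yr hr xr hE.
have n2 := law_lipr cC yr hr (norm0_lt cC).
rewrite hE (law0r cC)// subr0 in n2.
have h2 : `|h| <= r / 2 by lra.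
have [_ n3] := log_spec cC h2.
have -> : log x - log y - (x - y) = (log h - h) - (x - y - h).
  by rewrite lE; apply/rowP => i; rewrite !mxE; ring.
apply: (le_trans (ler_normB _ _)).
have s := uc_small cC.
have Ch : C * `|h| <= 128^-1.
  have : C * `|h| <= C * (r / 8) by apply: ler_wpM2l; [exact: ltW C0|]; lra.
  lra.
have Cy : C * `|y| <= 128^-1.
  have : C * `|y| <= C * (r / 8) by apply: ler_wpM2l; [exact: ltW C0|]; lra.
  lra.
have m1 : 9 * C * `|h| ^+ 2 <= 9 * (128^-1 * `|h|).
  by rewrite expr2 -mulrA ler_wpM2l// mulrA ler_wpM2r.
have m2 : C * (`|y| * `|h|) <= 128^-1 * `|h| by rewrite mulrA ler_wpM2r.
have := normr_ge0 h; lra.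
Qed.

(** [E] is the global exponential and [l] its expression in the chart near 0; calculus is done on
    [l], and the homomorphism [E] transports the results everywhere. *)
Record exp_spec (E : V -> M) (l : V -> V) (d : R) : Prop := ExpSpec {
  exp_d0 : 0 < d;
  exp_dr : d <= r / 64;
  expD : forall u v, E (u + v) = E u ** E v;
  exp_point : forall v, `|v| < d -> E v = point (l v);
  exp_norm : forall v, `|v| < d -> `|l v| <= 2 * `|v|;
  exp_logK : forall v, `|v| < d -> log (l v) = v;
  log_expK : forall x, `|x| < d / 2 -> `|log x| < d /\ l (log x) = x;
  exp_law : forall u v, `|u| < d -> `|v| < d -> `|u + v| < d ->
    l (u + v) = law (l u) (l v)
}.

Lemma exp_exists : exists E l d, exp_spec E l d.
Proof.
have [t /andP[t0 t8] tP] := log_lip; have rr := r0.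
have log_inj x y : `|x| <= t -> `|y| <= t -> log x = log y -> x = y.
  move=> xt yt xy; have := tP x y xt yt; rewrite xy subrr sub0r normrN => h.
  apply/eqP; rewrite -subr_eq0 -normr_le0.
  by have := normr_ge0 (x - y); lra.
pose l (v : V) : V := get [set x | `|x| <= t /\ log x = v].
have lP v : `|v| <= t / 2 -> `|l v| <= t /\ log (l v) = v.
  move=> vt; have [x xt xv] := perturbed_id_surjective (ltW t0) (log0 cC) tP vt.
  by apply: (@getPex _ [set x | `|x| <= t /\ log x = v]); exists x.
have tP0 x : `|x| <= t -> `|log x - x| <= 2^-1 * `|x|.
  move=> xt; have t00 : `|0 : V| <= t by rewrite normr0 ltW.
  by have := tP x 0 xt t00; rewrite (log0 cC) !subr0.
have lnorm v : `|v| <= t / 2 -> `|l v| <= 2 * `|v|.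
  move=> vt; have [lt lv] := lP v vt; have := tP0 _ lt; rewrite lv => h.
  have : `|l v| <= `|v - l v| + `|v|.
    by rewrite -{1}(subKr v (l v)) (le_trans (ler_normB _ _))// addrC.
  lra.
(* For [u] and [v] of norm below [d], [l u] and [l v] have norm below [2 d], so by [law_norm] their
   product has norm below [8 d = t], where [log] is injective. *)
pose d := t / 8.
have ld u v : `|u| < d -> `|v| < d -> `|u + v| < d -> l (u + v) = law (l u) (l v).
  rewrite /d => ud vd uvd.
  have u2 : `|u| <= t / 2 by lra.
  have v2 : `|v| <= t / 2 by lra.
  have uv2 : `|u + v| <= t / 2 by lra.
  have [ut lu] := lP u u2; have [vt lv] := lP v v2; have [uvt luv] := lP _ uv2.
  have nu := lnorm _ u2; have nv := lnorm _ v2.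
  have ur : `|l u| < r by lra.
  have vr : `|l v| < r by lra.
  apply: log_inj => //; first by have := law_norm cC ur vr; lra.
  rewrite luv (log_law abel cC) ?lu ?lv//; lra.
pose e0 (v : V) := point (l v).
have d0 : 0 < d by rewrite divr_gt0.
have e0D u v : `|u| < d -> `|v| < d -> `|u + v| < d -> e0 (u + v) = e0 u ** e0 v.
  move=> ud vd uvd; rewrite /e0 ld// (point_law cC)//.
    have : `|l u| <= 2 * `|u| by apply: lnorm; move: ud; rewrite /d; lra.
    by move: ud; rewrite /d; lra.
  have : `|l v| <= 2 * `|v| by apply: lnorm; move: vd; rewrite /d; lra.
  by move: vd; rewrite /d; lra.
have [E ED Ee0] := extend_hom abel d0 e0D.
have dh (v : V) : `|v| < d -> `|v| <= t / 2 by rewrite /d; lra.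
exists E, l, d; split => //.
- by rewrite /d; lra.
- by move=> v /dh /lnorm.
- by move=> v /dh /lP[].
- move=> x; rewrite /d => xd; have xt : `|x| <= t by have := normr_ge0 x; lra.
  have h := tP0 x xt.
  have lx : `|log x| < d.
    have : `|log x| <= `|log x - x| + `|x| by rewrite -{1}(subrK x (log x)) ler_normD.
    by rewrite /d; lra.
  split => //; have [h1 h2] := lP _ (dh _ lx).
  exact: log_inj.
Qed.

End Exponential.

Section NormBall.
Context {R : realType} {V : normedModType R}.
Definition nball (d : R) : set V := [set v | `|v| < d].

Lemma nballE d : nball d = ball 0 d.
Proof. by apply/funext => v; rewrite -ball_normE /= sub0r normrN. Qed.

Lemma nball_open d : open (nball d).
Proof. by rewrite nballE; exact: ball_open. Qed.

Lemma nball_nbhs d v : nball d v -> nbhs v (nball d).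
Proof. by move=> vd; apply: open_nbhs_nbhs; split => //; exact: nball_open. Qed.

Lemma near_nball_add d v : nball d v -> \forall h \near (0 : V), nball d (h + v).
Proof.
move=> vd; have d1 : 0 < d - `|v| by rewrite subr_gt0.
apply/nbhs_ballP; exists (d - `|v|) => //= h.
rewrite -ball_normE /= sub0r normrN => hd.
by rewrite /nball /= (le_lt_trans (ler_normD _ _))// -ltrBrDr.
Qed.

(** Bootstrapping: if the derivatives of [f] are smooth functions of [f] itself, then [f] of class
    C^k has derivatives of class C^k, hence is of class C^(k+1). *)
Lemma class_C_ode (W : normedModType R) (U : set V) (O : set W) (f : V -> W)
    (g : V -> W -> W) : has_coords W -> open U ->
  (forall x, U x -> O (f x)) ->
  (forall v k, class_C k O (g v)) ->
  (forall x, U x -> differentiable f x) ->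
  (forall x v, U x -> 'D_v f x = g v (f x)) ->
  forall k, class_C k U f.
Proof.
move=> cW oU UO cg df Df; elim=> [|k IH].
  by move=> x Ux; apply: differentiable_continuous; exact: df.
split=> // v; apply: (class_C_ext (f := g v \o f)) => //.
  by move=> x Ux; rewrite Df.
exact: (class_C_comp cW oU UO IH (cg v k)).
Qed.

End NormBall.

(** * Smoothness of the exponential and of the logarithm *)

Section ExpSmooth.
Context {R : realType} {M : smoothManifold R} {G : lieGroupOn M}.
Local Notation "x ** y" := (lie_mul G x y) (at level 40, left associativity).
Local Notation e := (lie_one G).
Local Notation inv := (lie_inv G).
Local Notation V := ('rV[R]_(manifold_dim M)).
Hypothesis abel : forall x y, x ** y = y ** x.
Context {c : chart M V} {r C : R} (cC : unit_chart G c r C).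
Local Notation coord := (chart_coord G c).
Local Notation point := (chart_point G c).
Local Notation law := (chart_law G c).
Local Notation log := (@chart_log R M G c r).
Context {E : V -> M} {l : V -> V} {d : R} (spec : exp_spec (c := c) (r := r) (G := G) E l d).
Let r0 := uc_r0 cC.
Let C0 := uc_C0 cC.
Let cA := uc_atlas cC.
Let cP := atlas_chart cA.
Let law2 (w : V * V) := law w.1 w.2.

Lemma law2_diff u v : `|u| < r -> `|v| < r -> differentiable law2 (u, v).
Proof.
move=> ur vr; have [dl _] := law_smooth G 1 cA.
by apply: dl; exact: (uc_law_dom cC).
Qed.

(* [k] is an infinitesimal displacement in the group, [law u k] its translate. *)
Lemma tangent_translate (u : V) (k : V -> V) (K1 K2 : R) : `|u| < r -> 0 <= K1 -> 0 <= K2 ->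
  (\forall h \near (0 : V), `|k h| < r /\ `|k h| <= K1 * `|h|) ->
  (\forall h \near (0 : V), `|k h - h| <= K2 * `|h| ^+ 2) ->
  forall t : R, 0 < t -> \forall h \near (0 : V),
    `|law u (k h) - u - 'd law2 (u, 0) (0, h)| <= t * `|h|.
Proof.
move=> ur K10 K20 kr kh t t0.
have dl := law2_diff ur (norm0_lt cC).
pose B : {linear V -> V} := 'd (fun z => law u z) 0.
have [dy DyE] : differentiable (fun z => law u z) 0 /\ forall v, B v = 'd law2 (u, 0) (0, v).
  have [dy _] := derive_pair2 0 dl; split; first exact: dy.
  move=> v; have [_ Dy] := derive_pair2 v dl.
  have h1 : 'D_v (fun z => law u z) 0 = B v by exact: deriveE.
  have h2 : 'D_(0, v) law2 (u, 0) = 'd law2 (u, 0) (0, v) by exact: deriveE.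
  by rewrite -h1 -h2.
have [m m0 mB] := linear_lipschitz (diff_continuous dy : continuous B).
(* Half of [t] pays for the tangent approximation of the law at [k h], the other half, through [t2],
   for replacing [k h] by [h]. Adding 1 keeps the denominators positive. *)
pose t1 := t / 2 / (K1 + 1).
have K1' : 0 < K1 + 1 by rewrite ltr_wpDl.
have t10 : 0 < t1 by rewrite !divr_gt0.
have /nbhs_ballP[s /= s0 sP] := diff_tangent dy t10.
pose t2 := t / 2 / (m * (K2 + 1)).
have K2' : 0 < K2 + 1 by rewrite ltr_wpDl.
have t20 : 0 < t2 by rewrite !divr_gt0// mulr_gt0.
near=> h.
have [hr hk] : `|k h| < r /\ `|k h| <= K1 * `|h| by near: h.
have hkh : `|k h - h| <= K2 * `|h| ^+ 2 by near: h.
have hs : `|h| < s / (K1 + 1) by near: h; apply: norm_near; rewrite divr_gt0.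
have ht : `|h| < t2 by near: h; exact: norm_near.
have ks : `|k h| < s.
  rewrite (le_lt_trans hk)//; move: hs; rewrite ltr_pdivlMr// mulrC mulrDl mul1r.
  by have := normr_ge0 h; lra.
have h1 : `|law u (k h) - u - B (k h)| <= t1 * `|k h|.
  have /sP : ball 0 s (k h) by rewrite -ball_normE /= sub0r normrN.
  by rewrite /= addr0 (law0r cC)//.
have h2 : `|B (k h) - B h| <= m * (K2 * `|h| ^+ 2).
  by rewrite -linearB (le_trans (mB _))// ler_wpM2l// ltW.
rewrite -DyE.
have -> : law u (k h) - u - B h = (law u (k h) - u - B (k h)) + (B (k h) - B h).
  by move: (B _) (B _) => b1 b2; rewrite addrA subrK.
apply: (le_trans (ler_normD _ _)).
have n1 : t1 * `|k h| <= t / 2 * `|h|.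
  apply: (@le_trans _ _ (t1 * ((K1 + 1) * `|h|))).
    apply: ler_wpM2l; first exact: ltW.
    by apply: (le_trans hk); apply: ler_wpM2r => //; rewrite lerDl.
  by rewrite mulrA /t1 divfK// gt_eqF.
have n2 : m * (K2 * `|h| ^+ 2) <= t / 2 * `|h|.
  rewrite expr2 !mulrA ler_wpM2r//.
  apply: (@le_trans _ _ (m * (K2 + 1) * t2)).
    by rewrite ler_pM ?mulr_ge0 ?(ltW m0) ?(ltW ht)// ler_wpM2l ?(ltW m0)// lerDl.
  by rewrite /t2 mulrC divfK// gt_eqF// mulr_gt0.
lra.
Unshelve. all: by end_near. Qed.

Lemma l_small v : `|v| < d -> `|l v| < r.
Proof.
move=> vd; have := exp_norm spec vd; have := exp_dr spec; have := r0; lra.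
Qed.

(** The bound of [log_spec] at [l v], whose norm is at most twice that of [v]: 36 is 9 times 4. *)
Lemma l_tangent v : `|v| < d -> `|l v - v| <= 36 * C * `|v| ^+ 2.
Proof.
move=> vd; have lr : `|l v| <= r / 2.
  by have := exp_norm spec vd; have := exp_dr spec; have := r0; lra.
have [_] := log_spec cC lr; rewrite (exp_logK spec vd) distrC => /le_trans; apply.
have -> : 36 * C * `|v| ^+ 2 = 9 * C * (2 * `|v|) ^+ 2 by ring.
rewrite ler_wpM2l ?mulr_ge0 ?(ltW C0)// lerXn2r ?nnegrE ?mulr_ge0//.
exact: (exp_norm spec vd).
Qed.

(** Since [l (u + h) = law (l u) (l h)] and [l h] is [h] up to second order, the derivative at [u]
    is the left-invariant field at [l u]. This is the differential equation fed to [class_C_ode]. *)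
Lemma l_diff u : `|u| < d ->
  differentiable l u /\ forall v, 'D_v l u = 'D_(0, v) law2 (l u, 0).
Proof.
move=> ud; have lr := l_small ud; have d0 := exp_d0 spec.
have dl := law2_diff lr (norm0_lt cC).
pose j (v : V) : V := 'd law2 (l u, 0) (0, v).
have jl : linear j.
  move=> a x y; rewrite /j -linearP; congr ('d law2 _ _).
  by congr pair; rewrite /= ?scaler0 ?addr0.
pose jj : {linear V -> V} := HB.pack j (GRing.isLinear.Build _ _ _ _ _ jl).
have cj : continuous jj.
  move=> v; apply: (@continuous_comp _ _ _ (fun v : V => (0 : V, v)) ('d law2 (l u, 0))).
    have h1 : {for v, continuous (cst 0 : V -> V)} by exact: cst_continuous.
    have h2 : (fun z : V => z) @ v --> v by exact: cvg_id.
    exact: cvg_pair h1 h2.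
  exact: (diff_continuous dl).
have K2 : 0 <= 36 * C by rewrite mulr_ge0// ltW.
have nd : \forall h \near (0 : V), `|h| < d by exact: norm_near.
have tt : forall t : R, 0 < t -> \forall h \near (0 : V),
    `|law (l u) (l h) - l u - 'd law2 (l u, 0) (0, h)| <= t * `|h|.
  apply: (tangent_translate lr (ler0n R 2) K2).
    by apply: filterS nd => h hd; split; [exact: l_small|exact: (exp_norm spec)].
  by apply: filterS nd => h hd; exact: l_tangent.
have [|dlu dE] := tangent_diff (f := l) (x := u) cj; last first.
  split; first exact: dlu.
  move=> v; have h1 : 'D_v l u = 'd l u v by exact: deriveE.
  have h2 : 'D_(0, v) law2 (l u, 0) = j v by exact: deriveE.
  by rewrite h1 h2; exact: (congr1 (fun f : V -> V => f v) dE).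
move=> t t0; apply: filterS3 nd (tt t t0) (near_nball_add ud) => h hd h1 hu.
rewrite /nball /= (addrC h) in hu.
by rewrite (addrC h) (exp_law spec).
Qed.

Lemma derive_law2_smooth k v : class_C k (law_dom G c) ('D_v law2).
Proof. by have [_] := law_smooth G k.+1 cA; apply. Qed.

Lemma l_smooth k : class_C k (nball d) l.
Proof.
apply: (@class_C_ode _ _ _ (nball d) (nball r) l
  (fun v x => 'D_(0, v) law2 (x, 0))).
- exact: has_coords_rV.
- exact: nball_open.
- by move=> x xd; exact: l_small.
- move=> v k'.
  apply: (@class_C_comp _ k' _ _ _ (nball r) (law_dom G c) (fun x : V => (x, 0 : V)) ('D_(0, v) law2)).
  + by apply: has_coords_prod; exact: has_coords_rV.
  + exact: nball_open.
  + by move=> x xr; apply: (uc_law_dom cC) => //; rewrite normr0.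
  + apply: class_C_pair; [exact: nball_open|exact: class_C_id|exact: class_C_cst].
  + exact: derive_law2_smooth.
- by move=> x xd; have [] := l_diff xd.
- by move=> x v xd; have [_ ->] := l_diff xd.
Qed.

Definition inv_coord (x : V) : V := coord (inv (point x)).

Definition inv_dom : set V :=
  [set x | in_charts_dom c c inv (x + chart_to c e)].

Lemma inv_dom_open : open inv_dom.
Proof.
pose s := (@id V) + cst (chart_to c e).
have cs : continuous s.
  by move=> x; apply: continuousD; [exact: cvg_id|exact: cst_continuous].
have oU : open (in_charts_dom c c inv).
  apply: in_charts_dom_open; [exact: open_cod|exact: chart_from_continuous|exact: open_dom|].
  exact: lie_inv_continuous.
rewrite -[inv_dom]/(s @^-1` in_charts_dom c c inv).
by apply: open_comp => // x _; exact: cs.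
Qed.

Lemma inv_coord_smooth k : class_C k inv_dom inv_coord.
Proof.
pose i := in_charts c c inv.
have -> : inv_coord = (i \o (@id V + cst (chart_to c e))) + cst (- chart_to c e).
  by apply/funext => w.
have oU := inv_dom_open.
apply: (class_CD oU); last exact: class_C_cst.
apply: (@class_C_comp _ k _ _ _ _ (in_charts_dom c c inv)).
- exact: has_coords_rV.
- exact: oU.
- by [].
- by apply: (class_CD oU); [exact: class_C_id|exact: class_C_cst].
- by apply: (lie_inv_smooth G).2.
Qed.

(** A radius on which inverses stay in the chart and the quotients of two points stay within
    [r / 8], the range of [log_law]. *)
Lemma log_smooth_radius : exists2 t : R, 0 < t <= r / 8 &
  forall x, `|x| < t -> [/\ inv_dom x, `|inv_coord x| < r &
    forall y, `|y| < t -> `|law (inv_coord x) y| < r / 8].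
Proof.
have r8 : 0 < r / 8 by rewrite divr_gt0.
have [t t0 tP] := div_near cC r8.
have inv0 : inv_dom 0.
  have ce := uc_unit cC; split => /=; rewrite add0r; first exact: chart_toP.
  by rewrite /= chart_toK// linv1.
have near_inv : \forall x \near (0 : V), inv_dom x /\ `|inv_coord x| < r.
  apply: filterI; first by apply: open_nbhs_nbhs; split; [exact: inv_dom_open|].
  have ci : {for 0, continuous inv_coord} by exact: (class_C_continuous (inv_coord_smooth 0)).
  have i0 : inv_coord 0 = 0 by rewrite /inv_coord (point0 cC) linv1 coord1.
  apply: (ci [set z | `|z| < r]); rewrite i0; exact: norm_near.
have /nbhs_ballP[s /= s0 sP] := near_inv.
exists (Num.min (Num.min t s) (r / 8)).
  by rewrite !lt_min t0 s0 r8 ge_min lexx orbT.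
move=> x; rewrite !lt_min => /andP[/andP[xt xs] x8].
have /sP[idx ix] : ball 0 s x by rewrite -ball_normE /= sub0r normrN.
split => // y; rewrite !lt_min => /andP[/andP[yt _] _].
have [_] := tP y x (ltW yt) (ltW xt).
rewrite /chart_law /inv_coord (coordK cC)//.
by have [_] := idx.
Qed.

(** With [k h] the coordinate of the left quotient of the points [h + x] and [x], one has
    [log (h + x) = log x + log (k h)], and [log (k h)] is [k h] up to second order. The derivative
    is thus that of [k] at 0, an explicit smooth function of [x], so no bootstrapping is
    involved. *)
Lemma log_diff x t : `|x| < t -> t <= r / 8 ->
  (forall x, `|x| < t -> [/\ inv_dom x, `|inv_coord x| < r &
    forall y, `|y| < t -> `|law (inv_coord x) y| < r / 8]) ->
  differentiable log x /\ forall v, 'D_v log x = 'D_(0, v) law2 (inv_coord x, x).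
Proof.
move=> xt t8 tP; have rr := r0; have [idx ir iP] := tP x xt.
have xr : `|x| < r by lra.
have dl := law2_diff ir xr.
have pi : point (inv_coord x) = inv (point x).
  by rewrite /inv_coord (coordK cC)//; have [] := idx.
pose k (h : V) := law (inv_coord x) (h + x).
have [dk DkE] : differentiable k 0 /\ forall v, 'd k 0 v = 'D_(0, v) law2 (inv_coord x, x).
  have [dz _] := derive_pair2 0 dl.
  have ds : differentiable (fun h : V => h + x) 0.
    by apply: (@differentiableD _ _ _ id (cst x)).
  have s0 : 0 + x = x by rewrite add0r.
  have dk : differentiable ((fun z => law2 (inv_coord x, z)) \o (fun h : V => h + x)) 0.
    by apply: differentiable_comp; [exact: ds|rewrite s0; exact: dz].
  split; first exact: dk.
  move=> v; have [_ <-] := derive_pair2 v dl.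
  have h1 : 'D_v k 0 = 'd k 0 v by exact: deriveE.
  rewrite -h1 /derive; congr (lim _).
  rewrite (_ : (fun h => _) = (fun h => h^-1 *: (law2 (inv_coord x, h *: v + x) - law2 (inv_coord x, x))))//.
  by apply/funext => h; rewrite /= /k addr0 add0r.
pose j : {linear V -> V} := 'd k 0.
have cj : continuous j by exact: (diff_continuous dk).
have k0 : k 0 = 0.
  by rewrite /k add0r /chart_law pi lmulV coord1.
have [m m0 mB] := linear_lipschitz cj.
have [|dlog dE] := tangent_diff (f := log) (x := x) cj; last first.
  split; first exact: dlog.
  move=> v; have h1 : 'D_v log x = 'd log x v by exact: deriveE.
  by rewrite h1 -DkE; exact: (congr1 (fun f : V -> V => f v) dE).
move=> t' t'0.
have K0 : 0 < 36 * C by rewrite mulr_gt0.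
have t20 : 0 < t' / 2 by rewrite divr_gt0.
(* The second-order error is at most [36 C] times the squared norm of [h], since [k h] has at most
   twice the norm of [h]; this radius brings it below [t' / 2] times the norm. *)
have t30 : 0 < t' / (72 * C) by rewrite divr_gt0// mulr_gt0.
near=> h.
have hx : `|h + x| < t by near: h; exact: (near_nball_add xt).
have kt : `|k h - j h| <= t' / 2 * `|h|.
  near: h; have := diff_tangent dk t20; apply: filterS => h.
  by rewrite addr0 k0 subr0.
have ht : `|h| < t' / (72 * C) by near: h; exact: norm_near.
have k8 : `|k h| < r / 8 by exact: iP.
have kr : `|k h| < r by lra.
have hxr : `|h + x| < r by lra.
have pk : point (k h) = inv (point x) ** point (h + x) by rewrite /k (point_law cC)// pi.
have lk : law x (k h) = h + x by rewrite /chart_law pk lmulVKl (pointK cC).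
have k2 := law_div cC xr kr hxr lk.
rewrite addrK in k2.
have x8 : `|x| <= r / 8 by lra.
have lE : log (h + x) = log x + log (k h) by rewrite -{1}lk (log_law abel cC)// ltW.
have kr2 : `|k h| <= r / 2 by lra.
have [_ hl] := log_spec cC kr2.
have -> : log (h + x) - log x - j h = (log (k h) - k h) + (k h - j h).
  by rewrite lE; move: (j h) => jh; apply/rowP => i; rewrite !mxE; ring.
apply: (le_trans (ler_normD _ _)).
have n1 : 9 * C * `|k h| ^+ 2 <= t' / 2 * `|h|.
  apply: (@le_trans _ _ (9 * C * (2 * `|h|) ^+ 2)).
    by rewrite ler_wpM2l ?mulr_ge0 ?(ltW C0)// lerXn2r ?nnegrE ?mulr_ge0.
  have -> : 9 * C * (2 * `|h|) ^+ 2 = 36 * C * `|h| * `|h| by ring.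
  rewrite ler_wpM2r//.
  have -> : t' / 2 = 36 * C * (t' / (72 * C)) by field; rewrite gt_eqF.
  by rewrite ler_wpM2l ?(ltW K0)// ltW.
lra.
Unshelve. all: by end_near. Qed.

Lemma log_smooth : exists2 t : R, 0 < t & forall k, class_C k (nball t) log.
Proof.
have [t /andP[t0 t8] tP] := log_smooth_radius; exists t => // k.
have rr := r0.
case: k => [|k].
  move=> x xt; have [dl _] := log_diff xt t8 tP.
  exact: differentiable_continuous.
split=> [x xt|v]; first by have [dl _] := log_diff xt t8 tP.
have oU := @nball_open _ V t.
apply: (class_C_ext (f := 'D_(0, v) law2 \o (fun x => (inv_coord x, x)))) => //.
  by move=> x xt; have [_ ->] := log_diff xt t8 tP.
apply: (@class_C_comp _ k _ _ _ (nball t) (law_dom G c)) => //.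
- by apply: has_coords_prod; exact: has_coords_rV.
- move=> x xt; have [_ ix _] := tP x xt.
  by apply: (uc_law_dom cC) => //; have : `|x| < t by []; lra.
- apply: class_C_pair => //; last exact: class_C_id.
  by apply: class_C_sub (inv_coord_smooth k) => x /tP[].
- exact: derive_law2_smooth.
Qed.

End ExpSmooth.

(** * Bases of lattices *)

Section Lattice.
Context {R : realType} {n : nat}.
Local Notation V := 'rV[R]_n.

Lemma norm_mulmx_le (u : V) (B : 'M[R]_n) (b : R) : (forall i j, `|B i j| <= b) ->
  forall j, `|(u *m B) ord0 j| <= n%:R * b * `|u|.
Proof.
move=> Bb j; rewrite mxE (le_trans (ler_norm_sum _ _ _))//.
apply: (@le_trans _ _ (\sum_(i < n) b * `|u|)).
  apply: ler_sum => i _; rewrite normrM mulrC ler_pM//.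
  exact: rV_coord_le.
by rewrite sumr_const card_ord -mulrA mulr_natl.
Qed.

(** In the expansion along row [i] the cofactors ignore that row, so they are those of the identity
    matrix. *)
Lemma det_replace_row (A : 'M[R]_n) i : (forall k, k != i -> row k A = row k 1%:M) ->
  \det A = A i i.
Proof.
move=> Ai.
have cofE j : cofactor A i j = cofactor 1%:M i j.
  rewrite /cofactor; congr (_ * \det _); apply/matrixP => k m.
  have := Ai (lift i k); rewrite eq_sym neq_lift => /(_ isT)/rowP/(_ (lift j m)).
  by rewrite !mxE.
have adj1 : \adj (1%:M : 'M[R]_n) = 1%:M.
  by rewrite -[LHS]mul1mx mul_mx_adj det1.
rewrite (expand_det_row A i) (bigD1 i)//= big1 ?addr0.
  have := congr1 (fun B : 'M[R]_n => B i i) adj1; rewrite !mxE eqxx cofE => ->.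
  by rewrite mulr1.
move=> j ji; have := congr1 (fun B : 'M[R]_n => B j i) adj1.
by rewrite !mxE (negbTE ji) cofE => ->; rewrite mulr0.
Qed.

Context (Lam : set V).
Hypotheses (Lam0 : Lam 0) (LB : forall u v, Lam u -> Lam v -> Lam (u - v)).

Lemma latticeN u : Lam u -> Lam (- u).
Proof. by move=> Lu; rewrite -sub0r; exact: LB. Qed.

Lemma latticeD u v : Lam u -> Lam v -> Lam (u + v).
Proof. by move=> Lu Lv; rewrite -[v]opprK; apply: LB => //; exact: latticeN. Qed.

Lemma latticeZ (z : int) u : Lam u -> Lam (z%:~R *: u).
Proof.
move=> Lu; have Ln (m : nat) : Lam (m%:R *: u).
  elim: m => [|m IH]; first by rewrite scale0r.
  by rewrite -natr1 scalerDl scale1r; exact: latticeD.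
case: z => m; first exact: Ln.
by rewrite NegzE intrN scaleNr; apply: latticeN; exact: Ln.
Qed.

Lemma lattice_mulmx (B : 'M[R]_n) (z : V) : (forall i, Lam (row i B)) ->
  z \in @int_lattice R n -> Lam (z *m B).
Proof.
move=> LBr /forallP zZ; rewrite mulmx_sum_row.
elim/big_ind : _ => //; first exact: latticeD.
by move=> i _; have /intrP[m ->] := zZ i; exact: latticeZ.
Qed.

(* Lattice vectors close to [K e_i] for large [K] form a diagonally dominant
   matrix. *)
Lemma lattice_frame (rho : R) : (forall v, exists2 w, Lam w & `|v - w| <= rho) ->
  exists2 B : 'M[R]_n, B \in unitmx & forall i, Lam (row i B).
Proof.
move=> Lrho; pose K := n%:R * rho + 1.
have /choice[b bP] : forall i : 'I_n, exists w, Lam w /\ `|K *: delta_mx 0 i - w| <= rho.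
  by move=> i; have [w Lw wr] := Lrho (K *: delta_mx 0 i); exists w.
pose B : 'M[R]_n := \matrix_i b i.
exists B; last by move=> i; rewrite rowK; have [] := bP i.
pose D := K%:M - B.
have Dr i j : `|D i j| <= rho.
  have [_] := bP i; apply: le_trans.
  have -> : D i j = (K *: delta_mx 0 i - b i) ord0 j.
    by rewrite !mxE /= eq_sym; case: eqP => _; rewrite ?mulr1n ?mulr0n ?mulr1 ?mulr0.
  exact: rV_coord_le.
(* If [u B = 0], then [K u = u (K - B)] has norm at most [n rho] times that of [u], and [K] exceeds
   [n rho]. *)
rewrite -row_free_unit; apply: inj_row_free => u uB.
have uD : u *m D = K *: u by rewrite /D mulmxBr uB subr0 mul_mx_scalar.
have r0 : 0 <= rho.
  by have [w _] := Lrho 0; apply: le_trans.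
have uK : `|K *: u| <= n%:R * rho * `|u|.
  rewrite -uD; apply: rV_norm_le; first by do 2![apply: mulr_ge0 => //].
  by move=> j; exact: norm_mulmx_le.
move: uK; rewrite normrZ gtr0_norm; last by rewrite ltr_wpDl// mulr_ge0.
rewrite /K mulrDl mul1r gerDl => un.
by apply/eqP; rewrite -normr_le0.
Qed.

(** Dirichlet's simultaneous approximation: the [m^n + 1] multiples [0 c, ..., m^n c] fall modulo 1
    into [m^n] cubes of side [1/m], so two of them share a cube. *)
Lemma pigeonhole_int (c : V) (m : nat) : (0 < m)%N ->
  exists k : nat, (0 < k <= m ^ n)%N /\ exists2 z : V, z \in @int_lattice R n &
    forall i, `|(k%:R *: c - z) ord0 i| < m%:R^-1.
Proof.
case: m => // m _; pose M := m.+1.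
have M0 : 0 < M%:R :> R by rewrite ltr0n.
pose frac (x : R) := x - (Num.floor x)%:~R.
have frac0 x : 0 <= frac x by rewrite subr_ge0 floor_le.
have frac1 x : frac x < 1 by rewrite ltrBlDl -[1]/(1%:~R) -intrD floorD1_gt.
pose cell (k : 'I_(M ^ n).+1) : {ffun 'I_n -> 'I_M} :=
  [ffun i => inord (Num.truncn (M%:R * frac (k%:R * c ord0 i)))].
have : ~ injective cell.
  move=> /leq_card; rewrite card_ffun !card_ord ltnn//.
move=> /existsNP[k1 /existsNP[k2 /not_implyP[ck kk]]].
wlog k12 : k1 k2 ck kk / (k1 < k2)%N.
  move=> W; have [lt|gt|/val_inj//] := ltngtP k1 k2; first exact: (W k1 k2).
  by apply: (W k2 k1) => // /esym.
exists (k2 - k1)%N; split.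
  by rewrite subn_gt0 k12 (leq_trans (leq_subr _ _))// -ltnS.
exists (\row_i ((Num.floor (k2%:R * c ord0 i))%:~R - (Num.floor (k1%:R * c ord0 i))%:~R)).
  by apply/forallP => i; rewrite mxE rpredB// intr_int.
move=> i; rewrite !mxE natrB ?(ltnW k12)//.
have -> : (k2%:R - k1%:R) * c ord0 i - ((Num.floor (k2%:R * c ord0 i))%:~R -
    (Num.floor (k1%:R * c ord0 i))%:~R) = frac (k2%:R * c ord0 i) - frac (k1%:R * c ord0 i).
  by rewrite /frac; ring.
have := congr1 (fun f : {ffun 'I_n -> 'I_M} => val (f i)) ck; rewrite !ffunE /=.
have tM x : (Num.truncn (M%:R * frac x) < M)%N.
  rewrite -(ltr_nat R); have /truncn_itv/andP[h _] : 0 <= M%:R * frac x by rewrite mulr_ge0// ltW.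
  by rewrite (le_lt_trans h)// gtr_pMr.
rewrite !inordK//.
move: (frac0 (k1%:R * c ord0 i)) (frac0 (k2%:R * c ord0 i)).
set f1 := frac _; set f2 := frac _ => f10 f20 tE.
have /truncn_itv/andP[a1 a2] : 0 <= M%:R * f1 by rewrite mulr_ge0// ltW.
have /truncn_itv/andP[b1 b2] : 0 <= M%:R * f2 by rewrite mulr_ge0// ltW.
rewrite -tE in b1 b2.
rewrite -(ltr_pM2l M0) mulfV ?gt_eqF// -{1}(gtr0_norm M0) -normrM mulrBr.
rewrite ltr_norml; rewrite -natr1 in a2 b2; lra.
Qed.

(* Two multiples of [v] have nearly equal coordinates modulo 1, so their
   difference is an integer combination of the rows of [B] up to a short lattice
   vector, which is zero. *)
Lemma lattice_rational (d : R) (B : 'M[R]_n) : 0 < d ->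
  (forall v, Lam v -> `|v| < d -> v = 0) -> B \in unitmx -> (forall i, Lam (row i B)) ->
  exists2 N : nat, (0 < N)%N &
    forall v, Lam v -> N%:R *: (v *m invmx B) \in @int_lattice R n.
Proof.
move=> d0 Ld Bu LBr.
pose b := \sum_i \sum_j `|B i j|.
have Bb i j : `|B i j| <= b.
  rewrite /b (bigD1 i)//= (bigD1 j)//= -!addrA lerDl addr_ge0//.
    by apply: sumr_ge0.
  by apply: sumr_ge0 => *; apply: sumr_ge0.
have b0 : 0 <= b by apply: sumr_ge0 => *; apply: sumr_ge0.
(* A combination of the rows of [B] with coefficients at most [1/m] has norm at most [n b / m],
   below [d]; if it is a lattice vector, it vanishes. *)
pose m := (Num.truncn (n%:R * b / d)).+1.
have md : n%:R * b * m%:R^-1 < d.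
  rewrite ltr_pdivrMr ?ltr0n// (mulrC d) -ltr_pdivrMr//; exact: truncnS_gt.
(* The multiplier [k] found below depends on [v], but it is at most [m^n] and so divides this
   factorial, which does not. *)
exists (m ^ n)`!; first exact: fact_gt0.
move=> v Lv; set c := v *m invmx B.
have vc : v = c *m B by rewrite /c mulmxKV.
have [k [/andP[k0 km] [z zZ kz]]] := pigeonhole_int c (ltn0Sn (Num.truncn (n%:R * b / d))).
have t0 : (k%:R *: c - z) *m B = 0.
  apply: Ld.
    rewrite mulmxBl -scalemxAl -vc; apply: LB; last exact: lattice_mulmx.
    exact: (latticeZ k).
  have tn : `|k%:R *: c - z| <= m%:R^-1.
    by apply: rV_norm_le => [|i]; [rewrite invr_ge0|exact/ltW/kz].
  apply: le_lt_trans md; apply: rV_norm_le.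
    by rewrite !mulr_ge0// invr_ge0.
  move=> j; rewrite (le_trans (norm_mulmx_le _ Bb _))//.
  by rewrite ler_wpM2l// mulr_ge0.
have kc : k%:R *: c = z.
  apply/eqP; rewrite -subr_eq0; apply/eqP.
  by rewrite -[LHS](mulmxK Bu) t0 mul0mx.
have /dvdnP[q ->] : (k %| (m ^ n)`!)%N by apply: dvdn_fact; rewrite k0.
rewrite natrM -scalerA kc.
apply/forallP => i; rewrite mxE rpredM//; last by move: zZ => /forallP.
by rewrite natr_int.
Qed.

(* If [v] has a coordinate with fractional part [t <> 0] in a frame of minimal
   determinant, then exchanging a row with [v] minus integer multiples of rows
   multiplies the determinant by [t < 1]. *)
Lemma lattice_basis (d rho : R) : 0 < d ->
  (forall v, Lam v -> `|v| < d -> v = 0) ->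
  (forall v, exists2 w, Lam w & `|v - w| <= rho) ->
  exists2 B : 'M[R]_n, B \in unitmx &
    forall v, Lam v <-> v *m invmx B \in @int_lattice R n.
Proof.
move=> d0 Ld Lrho; have [B0 B0u LB0] := lattice_frame Lrho.
have [N N0 NP] := lattice_rational d0 Ld B0u LB0.
(* Relative to [B0], a frame has integer coordinates after scaling by [N]. Its determinant is thus
   measured by a natural number, and a smallest positive value exists. *)
pose P (B : 'M[R]_n) (k : nat) := (forall i, Lam (row i B)) /\
  exists Z : 'M[int]_n, N%:R *: (B *m invmx B0) = map_mx intr Z /\ `|\det Z|%N = k.
have PZ B : (forall i, Lam (row i B)) -> exists k, P B k.
  move=> LBr; have /choice[Z ZP] : forall i, exists z : 'I_n -> int,
      forall j, (N%:R *: (B *m invmx B0)) i j = (z j)%:~R.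
    move=> i; have /choice[z zP] : forall j, exists z : int,
        (N%:R *: (B *m invmx B0)) i j = z%:~R.
      move=> j; have /NP/forallP/(_ j)/intrP[m mP] := LBr i.
      by exists m; rewrite -mP -row_mul !mxE.
    by exists z.
  exists (`|\det (\matrix_(i, j) Z i j)|%N); split => //.
  by exists (\matrix_(i, j) Z i j); split => //; apply/matrixP => i j; rewrite ZP !mxE.
have detP B k : P B k -> `|\det B| = k%:R * (`|\det B0| / N%:R ^+ n).
  move=> [_ [Z [ZP <-]]].
  have : \det (N%:R *: (B *m invmx B0)) = \det (map_mx intr Z : 'M[R]_n) by rewrite ZP.
  rewrite detZ det_mulmx det_inv det_map_mx => /(congr1 Num.norm).
  rewrite !normrM normfV ger0_norm ?exprn_ge0// -intr_norm => E.
  have B00 : `|\det B0| != 0 by rewrite normr_eq0 -unitfE -unitmxE.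
  have Nn0 : N%:R ^+ n != 0 :> R by rewrite expf_neq0// pnatr_eq0 -lt0n.
  rewrite natr_absz -E; move: (N%:R ^+ n) Nn0 => q q0.
  by field; rewrite q0 B00.
have exk : exists k, `[< exists2 B, P B k & (0 < k)%N >].
  have [k Pk] := PZ B0 LB0; exists k; apply/asboolP; exists B0 => //.
  rewrite lt0n; apply/eqP => k0; have := detP _ _ Pk; rewrite k0 mul0r => /eqP.
  by rewrite normr_eq0; move: B0u; rewrite unitmxE unitfE => /negP.
case: (ex_minnP exk) => k /asboolP[B PB k0] kmin.
have s0 : 0 < `|\det B0| / N%:R ^+ n.
  by rewrite divr_gt0 ?exprn_gt0 ?ltr0n// normr_gt0 -unitfE -unitmxE.
have Bu : B \in unitmx.
  by rewrite unitmxE unitfE -normr_gt0 (detP _ _ PB) mulr_gt0// ltr0n.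
exists B => // v; split; last first.
  by move=> /(lattice_mulmx PB.1); rewrite mulmxKV.
move=> Lv; set c := v *m invmx B; have vc : v = c *m B by rewrite mulmxKV.
clearbody c.
apply/forallP => i; apply/negPn/negP => ci.
pose f : int := Num.floor (c ord0 i); pose t := c ord0 i - f%:~R.
have t0 : 0 < t.
  rewrite subr_gt0 lt_neqAle floor_le andbT; apply: contra ci => /eqP <-; exact: intr_int.
have t1 : t < 1 by rewrite ltrBlDl -[1]/(1%:~R) -intrD floorD1_gt.
pose T : 'M[R]_n := \matrix_k (if k == i then c - f%:~R *: delta_mx 0 i else row k 1%:M).
have Tdet : \det T = t.
  rewrite (@det_replace_row T i); last by move=> k' ki; rewrite rowK (negbTE ki).
  by rewrite !mxE eqxx !mxE !eqxx mulr1.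
have LT k' : Lam (row k' (T *m B)).
  rewrite row_mul rowK; case: ifPn => ki; last by rewrite -row_mul mul1mx; exact: PB.1.
  rewrite mulmxBl -vc -scalemxAl -rowE; apply: LB => //.
  by apply: latticeZ; exact: PB.1.
have [k' Pk'] := PZ _ LT.
have kk' : t * k%:R = k'%:R.
  apply: (mulIf (lt0r_neq0 s0)).
  by rewrite -mulrA -(detP _ _ PB) -(detP _ _ Pk') det_mulmx Tdet normrM gtr0_norm.
have k'0 : (0 < k')%N by rewrite -(ltr_nat R) -kk' mulr_gt0// ltr0n.
have : (k <= k')%N by apply: kmin; apply/asboolP; exists (T *m B).
by rewrite leqNgt -(ltr_nat R) -kk' gtr_pMl ?ltr0n// t1.
Qed.

End Lattice.

(** * The isomorphism with the torus *)

Section Auxiliary.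
Context {R : realType}.

Lemma class_C_germ k (V W : normedModType R) (U : set V) (f : V -> W) :
  (forall x, U x -> exists h : V -> W,
    (exists2 O, open_nbhs x O & class_C k O h) /\ \forall y \near x, f y = h y) ->
  class_C k U f.
Proof.
move=> fh; apply: class_C_local => x /fh[h [[B [oB Bx] ch] fE]].
exists (B `&` interior [set y | f y = h y]).
  by split; [apply: openI => //; exact: open_interior|split].
apply: (@class_C_ext _ k _ _ (B `&` interior [set y | f y = h y]) h f).
- by apply: openI => //; exact: open_interior.
- by move=> y [_ /interior_subset/esym].
- by apply: class_C_sub ch => y [].
Qed.

Lemma mulmxr_continuous m n (B : 'M[R]_(m, n)) : continuous (fun u : 'rV[R]_m => u *m B).
Proof.
move=> u; have [N [p [q [qc qe]]]] := has_coords_rV (R := R) m.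
pose l : {linear 'rV[R]_m -> 'rV[R]_n} := mulmxr B.
rewrite -[fun u => _]/(l : 'rV[R]_m -> 'rV[R]_n).
have -> : (l : 'rV[R]_m -> 'rV[R]_n) = \sum_i (fun x => q i x *: l (p i)).
  apply/funext => x; rewrite fct_sumE {1}(qe x) linear_sum.
  by apply: eq_bigr => i _; rewrite linearZ.
elim/big_ind : _ => [|f g cf cg|i _].
- exact: cst_continuous.
- exact: continuousD.
- by apply: continuousZr_tmp; exact: qc.
Qed.

(** Both [h] and the composite with the chart lift the same map to the torus. Their difference is
    continuous with lattice values, hence locally constant. *)
Lemma torus_lift n (E : normedModType R) (c : chart (torus_points R n) 'rV[R]_n)
    (h : E -> 'rV[R]_n) (w0 : E) : torus_atlas c -> {for w0, continuous h} ->
  chart_dom c (torus_pi (h w0)) ->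
  \forall w \near w0,
    chart_to c (torus_pi (h w)) = h w + (chart_to c (torus_pi (h w0)) - h w0).
Proof.
move=> [cP cpi] ch d0; pose g w := chart_to c (torus_pi (h w)).
have cth : {for w0, continuous (fun w => torus_pi (h w))}.
  by apply: (@continuous_comp _ _ _ h (@torus_pi R n)) => //; exact: torus_pi_continuous.
have cg : {for w0, continuous g}.
  apply: (@continuous_comp _ _ _ (fun w => torus_pi (h w)) (chart_to c)) => //.
  exact: chart_to_continuous.
have gh w : chart_dom c (torus_pi (h w)) -> g w - h w \in @int_lattice R n.
  by move=> dw; apply/torus_piE; rewrite -cpi ?chart_toK//; exact: chart_toP.
have nd : \forall w \near w0, chart_dom c (torus_pi (h w)).
  by apply: cth; apply: open_nbhs_nbhs; split => //; exact: open_dom.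
have nb : \forall w \near w0, ball (g w0 - h w0) 1 (g w - h w).
  have : {for w0, continuous (fun w => g w - h w)} by exact: (continuousB cg ch).
  by apply; exact: nbhsx_ballx.
apply: filterS2 nd nb => w dw [_ bw].
have : (g w - h w) - (g w0 - h w0) = 0.
  apply: lattice_small; first by apply: rpredB; exact: gh.
  by move=> i; move: (bw ord0 i); rewrite /ball/= distrC !mxE.
by move=> /eqP; rewrite subr_eq0 => /eqP <-; rewrite addrC subrK.
Qed.

End Auxiliary.

Section TorusIso.
Context {R : realType} {M : smoothManifold R} {G : lieGroupOn M}.
Local Notation "x ** y" := (lie_mul G x y) (at level 40, left associativity).
Local Notation e := (lie_one G).
Local Notation inv := (lie_inv G).
Local Notation n := (manifold_dim M).
Local Notation V := ('rV[R]_n).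
Hypothesis abel : forall x y, x ** y = y ** x.
Hypothesis Mcompact : compact [set: M].
Hypothesis Mconnected : connected [set: M].
Context {c : chart M V} {r C : R} (cC : unit_chart G c r C).
Local Notation coord := (chart_coord G c).
Local Notation point := (chart_point G c).
Local Notation log := (@chart_log R M G c r).
Context {E : V -> M} {l : V -> V} {d : R} (spec : exp_spec (c := c) (r := r) (G := G) E l d).
Let d0 := exp_d0 spec.
Let cA := uc_atlas cC.
Let cP := atlas_chart cA.
Local Notation pi := (@torus_pi R n).

Lemma exp0 : E 0 = e.
Proof. by apply: (lmulI (G := G) (x := E 0)); rewrite -(expD spec) addr0 lmulr1. Qed.

Lemma expN v : E (- v) = inv (E v).
Proof. by apply: (lmulIr (G := G) (x := E v)); rewrite -(expD spec) addNr exp0 lmulV. Qed.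

Lemma expB u v : E (u - v) = E u ** inv (E v).
Proof. by rewrite (expD spec) expN. Qed.

Lemma local_exp0 : l 0 = 0.
Proof.
have := exp_norm spec (v := 0); rewrite normr0 mulr0 => /(_ d0).
by rewrite normr_le0 => /eqP.
Qed.

Lemma l_continuous0 : {for 0, continuous l}.
Proof.
apply: (class_C_continuous (l_smooth cC spec 0)).
by rewrite /nball /= normr0.
Qed.

Lemma exp_continuous : continuous E.
Proof.
have c0 : {for 0, continuous E}.
  have h : {for 0, continuous (point \o l)}.
    apply: continuous_comp; first exact: l_continuous0.
    by rewrite local_exp0; apply: (point_continuous cC); exact: (norm0_lt cC).
  have : \forall v \near (0 : V), (point \o l) v = E v.
    by apply: filterS (norm_near d0) => v vd; rewrite (exp_point spec).
  move=> /near_eq_cvg hE; rewrite /prop_for /continuous_at.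
  have -> : E 0 = (point \o l) 0 by rewrite exp0 /= local_exp0 (point0 cC).
  exact: cvg_trans hE h.
move=> v; have -> : E = fun u => E v ** E (u - v).
  by apply/funext => u; rewrite -(expD spec) addrC subrK.
apply: continuous_lmul; first exact: cst_continuous.
apply: (@continuous_comp _ _ _ (fun u : V => u - v) E).
  by apply: (@continuousB _ _ _ id (cst v) v); [exact: cvg_id|exact: cst_continuous].
by rewrite subrr.
Qed.

Lemma log_near1 : \forall x \near e, E (log (coord x)) = x /\ `|log (coord x)| < d.
Proof.
have d2 : 0 < d / 2 by rewrite divr_gt0.
apply: filterS (coord_near cC d2) => x [cx xd].
have [lx xE] := log_expK spec xd.
by split => //; rewrite (exp_point spec)// xE (coordK cC).
Qed.

Lemma exp_surj x : exists v, E v = x.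
Proof.
apply: (connected_subgroup (G := G) (H := [set x | exists v, E v = x])) => //.
- by exists 0; exact: exp0.
- by move=> _ _ [u <-] [v <-]; exists (u + v); exact: (expD spec).
- by move=> _ [u <-]; exists (- u); exact: expN.
- by apply: filterS log_near1 => y [yE _]; exists (log (coord y)).
Qed.

Let Lam : set V := [set v | E v = e].

Lemma exp_kernel_discrete v : Lam v -> `|v| < d -> v = 0.
Proof.
move=> Ev vd; have := exp_point spec vd; rewrite Ev => h.
have := congr1 coord h; rewrite coord1 (pointK cC); last exact: (l_small cC spec).
by move=> lv; rewrite -(exp_logK spec vd) -lv (log0 cC).
Qed.

(** The images of the balls of radius [k] exhaust the compact group, so one [k] is enough: every
    vector has the same image as a vector of norm below [k], and differs from it by an element of
    the kernel. *)
Lemma exp_cocompact : exists rho : R, forall v, exists2 w, Lam w & `|v - w| <= rho.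
Proof.
have /compact_near_coveringP cM := Mcompact.
pose P (k : nat) (x : M) := exists2 v, `|v| < k%:R & E v = x.
have [k _ kP] : \forall k \near \oo, [set: M] `<=` P k.
  apply: (cM nat \oo P) => x0 _; have [v0 v0E] := exp_surj x0.
  exists ([set x | exists2 w, `|w| < d & E w = inv x0 ** x],
          [set k | (Num.truncn (`|v0| + d) < k)%N]).
    split => /=; last by exists (Num.truncn (`|v0| + d)).+1.
    apply: (near_translate (G := G) x0 (U := [set y | exists2 w, `|w| < d & E w = y])).
    by apply: filterS log_near1 => y [yE yd]; exists (log (coord y)).
  move=> [x k] /= [[w wd wE] kd]; exists (v0 + w); last first.
    by rewrite (expD spec) wE v0E lmulVKl.
  apply: (le_lt_trans (ler_normD _ _)).
  apply: (@lt_le_trans _ _ (`|v0| + d)); first by rewrite ltrD2l.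
  by rewrite ltW// (lt_le_trans (truncnS_gt _))// ler_nat.
exists k%:R => v; have [u uk uE] : P k (E v) by apply: (kP k) => //=.
exists (v - u); first by rewrite /Lam /= expB uE lmulrV.
by rewrite opprB addrCA subrr addr0 ltW.
Qed.

Lemma exp_lattice : exists2 B : 'M[R]_n, B \in unitmx &
  forall v, E v = e <-> v *m invmx B \in @int_lattice R n.
Proof.
have [rho rhoP] := exp_cocompact.
apply: (lattice_basis (Lam := Lam) _ _ d0 exp_kernel_discrete rhoP).
  exact: exp0.
by move=> u v Eu Ev; rewrite /Lam /= expB Eu Ev lmulrV.
Qed.

(** An arbitrary section of [E], with no continuity; only its class modulo the kernel has a meaning,
    and regularity is read off from [torus_local]. *)
Definition exp_inv (x : M) : V := sval (cid (exp_surj x)).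

Lemma exp_invK x : E (exp_inv x) = x.
Proof. by rewrite /exp_inv; case: cid. Qed.

Section Maps.
Variable B : 'M[R]_n.
Hypothesis Bu : B \in unitmx.
Hypothesis BL : forall v, E v = e <-> v *m invmx B \in @int_lattice R n.

Definition to_torus (x : M) : torus_points R n := pi (exp_inv x *m invmx B).

Definition of_torus (t : torus_points R n) : M :=
  E (sval (cid (torus_pi_surj t)) *m B).

Lemma to_torus_exp v : to_torus (E v) = pi (v *m invmx B).
Proof.
apply/torus_piE; rewrite -mulmxBl; apply/BL.
by rewrite expB exp_invK lmulrV.
Qed.

Lemma of_torus_pi w : of_torus (pi w) = E (w *m B).
Proof.
rewrite /of_torus; case: cid => w' /= /torus_piE ww'.
suff : E ((w' - w) *m B) = e.
  rewrite mulmxBl expB => h.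
  by rewrite -[LHS](lmulVK G _ (E (w *m B))) h lmul1.
by apply/BL; rewrite mulmxK.
Qed.

Lemma to_torusK : cancel to_torus of_torus.
Proof. by move=> x; rewrite /to_torus of_torus_pi mulmxKV// exp_invK. Qed.

Lemma of_torusK : cancel of_torus to_torus.
Proof.
move=> t; have [w <-] := torus_pi_surj t.
by rewrite of_torus_pi to_torus_exp mulmxK.
Qed.

Lemma to_torusM x y : to_torus (x ** y) = (to_torus x + to_torus y)%R.
Proof.
rewrite -(exp_invK x) -(exp_invK y) -(expD spec) !to_torus_exp.
by rewrite mulmxDl torus_piD.
Qed.

(* Around [x0], the map to the torus lifts to the chart [log] translated. *)
Definition torus_local (x0 x : M) : V :=
  (exp_inv x0 + log (coord (inv x0 ** x))) *m invmx B.

Lemma to_torus_local x0 : \forall x \near x0, to_torus x = pi (torus_local x0 x).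
Proof.
have : \forall x \near x0, E (log (coord (inv x0 ** x))) = inv x0 ** x.
  apply: (near_translate (G := G) x0 (U := [set y | E (log (coord y)) = y])).
  by apply: filterS log_near1 => y [].
apply: filterS => x xE.
by rewrite -to_torus_exp (expD spec) exp_invK xE lmulVKl.
Qed.

Lemma log_continuous0 : {for 0, continuous log}.
Proof.
have [t t0 lt] := log_smooth abel cC.
by apply: (class_C_continuous (lt 0%N)); rewrite /nball /= normr0.
Qed.

Lemma torus_local_continuous x0 : {for x0, continuous (torus_local x0)}.
Proof.
have c1 : {for x0, continuous (fun x => log (coord (inv x0 ** x)))}.
  apply: (@continuous_comp _ _ _ (fun x => coord (inv x0 ** x)) log).
    apply: (@continuous_comp _ _ _ (fun x => inv x0 ** x) coord).
      exact: lmul_continuous.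
    by rewrite lmulV; apply: (coord_continuous cC); exact: (uc_unit cC).
  by rewrite lmulV coord1; exact: log_continuous0.
apply: (@continuous_comp _ _ _ (fun x => exp_inv x0 + log (coord (inv x0 ** x)))
   (fun u : V => u *m invmx B)).
  by apply: continuousD c1; exact: cst_continuous.
exact: mulmxr_continuous.
Qed.

Lemma to_torus_continuous : continuous to_torus.
Proof.
move=> x0; have h : {for x0, continuous (pi \o torus_local x0)}.
  by apply: continuous_comp; [exact: torus_local_continuous|exact: torus_pi_continuous].
have nE := to_torus_local x0.
have /near_eq_cvg hE : \forall x \near x0, (pi \o torus_local x0) x = to_torus x.
  by apply: filterS nE => x ->.
rewrite /prop_for /continuous_at (nbhs_singleton nE).
exact: cvg_trans hE h.
Qed.

Lemma exp_mulmx_continuous : continuous (fun w : V => E (w *m B)).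
Proof.
move=> w; apply: (@continuous_comp _ _ _ (fun w : V => w *m B) E).
  exact: mulmxr_continuous.
exact: exp_continuous.
Qed.

Lemma of_torus_continuous : continuous of_torus.
Proof.
move=> t; have [w <-] := torus_pi_surj t => N.
rewrite of_torus_pi => /exp_mulmx_continuous wN.
have := torus_pi_nbhs wN; apply: filterS => _ [w' Nw <-].
by rewrite /= of_torus_pi.
Qed.

(** By [torus_lift] the map in charts is [torus_local] plus a constant. There [log] follows a left
    translation that brings [x0] to [e], where [log] is smooth. *)
Lemma to_torus_smooth :
  smooth_map (@manifold_atlas R M) (@torus_atlas R n) to_torus.
Proof.
split; first exact: to_torus_continuous.
move=> c1 c' c1A c'A k; have c1P := atlas_chart c1A.
apply: class_C_germ => w0 [/= cw0 dw0].
set x0 := chart_from c1 w0 in dw0.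
pose lam (w : V) := torus_local x0 (chart_from c1 w).
have clam : {for w0, continuous lam}.
  apply: (@continuous_comp _ _ _ (chart_from c1) (torus_local x0)).
    exact: chart_from_continuous.
  exact: torus_local_continuous.
have near_pi : \forall w \near w0, to_torus (chart_from c1 w) = pi (lam w).
  exact: (chart_from_continuous c1P cw0 (to_torus_local x0)).
have dlam : chart_dom c' (pi (lam w0)) by rewrite -(nbhs_singleton near_pi).
pose a := chart_to c' (pi (lam w0)) - lam w0.
exists (fun w => lam w + a); split; last first.
  apply: filterS2 near_pi (torus_lift c'A clam dlam) => w wE <-.
  by rewrite /in_charts /= wE.
have [t t0 logC] := log_smooth abel cC.
pose p0 := chart_to c e.
pose f := in_charts c1 c (lie_mul G (inv x0)).
have oD : open (in_charts_dom c1 c (lie_mul G (inv x0))).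
  apply: in_charts_dom_open; [exact: open_cod|exact: chart_from_continuous|exact: open_dom|].
  exact: lmul_continuous.
have D0 : in_charts_dom c1 c (lie_mul G (inv x0)) w0.
  by split => //=; rewrite lmulV; exact: (uc_unit cC).
pose g := f + cst (- p0).
have gC : class_C k (in_charts_dom c1 c (lie_mul G (inv x0))) g.
  by apply: (class_CD oD); [exact: lmul_charts_smooth|exact: class_C_cst].
have gE w : g w = coord (inv x0 ** chart_from c1 w) by [].
have g0 : g w0 = 0 by rewrite gE lmulV coord1.
pose O := in_charts_dom c1 c (lie_mul G (inv x0)) `&` interior (g @^-1` nball t).
have oO : open O by apply: openI => //; exact: open_interior.
have Ow0 : O w0.
  split => //; have gc : {for w0, continuous g} by exact: (class_C_continuous gC).
  by apply: gc; apply: nball_nbhs; rewrite g0 /nball /= normr0.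
exists O => //.
pose lB : {linear V -> V} := mulmxr (invmx B).
have lBc : continuous lB by exact: mulmxr_continuous.
have -> : (fun w => lam w + a) = lB \o (cst (exp_inv x0) + (log \o g)) + cst a by [].
apply: (class_CD oO); last exact: class_C_cst.
apply: class_C_linear => //; apply: (class_CD oO); first exact: class_C_cst.
apply: (@class_C_comp _ k _ _ _ O (nball t) g log) => //.
- exact: has_coords_rV.
- by move=> w [_ /interior_subset].
- by apply: class_C_sub gC => w [].
Qed.

(** Near [w0] one writes [E (w B) = x0 E ((w - w0) B)]: the second factor is [l] in the chart at
    [e], and a smooth left translation carries it to [x0]. *)
Lemma of_torus_smooth :
  smooth_map (@torus_atlas R n) (@manifold_atlas R M) of_torus.
Proof.
split; first exact: of_torus_continuous.
move=> c1 c' [c1P c1pi] c'A k; have c'P := atlas_chart c'A.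
apply: class_C_germ => w0 [/= cw0 dw0].
pose x0 := E (w0 *m B).
have x0E : of_torus (chart_from c1 w0) = x0 by rewrite c1pi// of_torus_pi.
rewrite x0E in dw0.
pose p0 := chart_to c e.
pose lB : {linear V -> V} := mulmxr B.
have lBc : continuous lB by exact: mulmxr_continuous.
pose s : V -> V := lB \o (@id V + cst (- w0)).
have cs : continuous s.
  move=> w; apply: continuous_comp; last exact: lBc.
  by apply: continuousD; [exact: cvg_id|exact: cst_continuous].
have s0 : s w0 = 0 by rewrite /s /= /cst fctE subrr mul0mx.
pose h := in_charts c c' (lie_mul G x0).
pose i : V -> V := (l \o s) + cst p0.
have near_d : \forall w \near w0, `|s w| < d.
  by apply: (cs w0 [set u : V | `|u| < d]); rewrite s0; exact: norm_near.
have iE w : `|s w| < d -> chart_from c (i w) = E (s w) by move=> wd; rewrite (exp_point spec).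
have xE w : x0 ** E (s w) = E (w *m B).
  by rewrite -(expD spec) /s /= /cst fctE mulmxBl addrC subrK.
exists (h \o i); split; last first.
  have nc : \forall w \near w0, chart_cod c1 w.
    by apply: open_nbhs_nbhs; split => //; exact: open_cod.
  apply: filterS2 near_d nc => w wd cw.
  by rewrite /h /in_charts /= iE// xE c1pi// of_torus_pi.
pose O := interior [set w | `|s w| < d /\ chart_dom c' (E (w *m B))].
have oO : open O by exact: open_interior.
exists O.
  split => //; apply: filterI => //.
  apply: (@exp_mulmx_continuous w0 (chart_dom c')).
  by apply: open_nbhs_nbhs; split => //; exact: open_dom.
apply: (@class_C_comp _ k _ _ _ O (in_charts_dom c c' (lie_mul G x0)) i h) => //.
- exact: has_coords_rV.
- move=> w /interior_subset[wd dw]; split.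
    by apply: (uc_cod cC); exact: (l_small cC spec).
  by rewrite /= iE// xE.
- apply: (class_CD oO); last exact: class_C_cst.
  apply: (@class_C_comp _ k _ _ _ O (nball d) s l) => //.
  + exact: has_coords_rV.
  + by move=> w /interior_subset[].
  + apply: class_C_linear => //; apply: (class_CD oO); [exact: class_C_id|exact: class_C_cst].
  + exact: (l_smooth cC spec).
- exact: lmul_charts_smooth.
Qed.

End Maps.

Lemma torus_isomorphic : lie_isomorphic G (torus R n).
Proof.
have [B Bu BL] := exp_lattice.
exists (to_torus B), (of_torus B); split.
- exact: to_torusK.
- exact: of_torusK.
- by move=> x y; exact: to_torusM.
- exact: to_torus_smooth.
- exact: of_torus_smooth.
Qed.

End TorusIso.

(** * Triviality of the brace *)

Section SmallSubgroups.
Context {R : realType} {M : smoothManifold R} (G : lieGroupOn M).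
Local Notation "x ** y" := (lie_mul G x y) (at level 40, left associativity).
Local Notation e := (lie_one G).

(** Squaring expands coordinates by at least 3/2. If all iterated squares of [x] stay in the chart
    ball of radius [r], the coordinate of [x] is at most [(2/3)^k r] for every [k], hence 0. *)
Lemma no_small_subgroup : exists2 U : set M, nbhs e U &
  forall H : set M, H `<=` U -> (forall x, H x -> H (x ** x)) -> forall x, H x -> x = e.
Proof.
have [c [r [C cC]]] := unit_chart_exists G.
exists [set x | chart_dom c x /\ `|chart_coord G c x| < r].
  exact: (coord_near cC (uc_r0 cC)).
move=> H HU HH x Hx.
pose sq k := iter k (fun y => y ** y) x.
have Hsq k : H (sq k) by elim: k => //= k; exact: HH.
have bound k : `|chart_coord G c x| <= (2 / 3) ^+ k * `|chart_coord G c (sq k)|.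
  elim: k => [|k IH]; first by rewrite expr0 mul1r.
  have [dk rk] := HU _ (Hsq k).
  apply: (le_trans IH); rewrite exprSr -mulrA ler_wpM2l ?exprn_ge0//.
  by have := law_half_norm cC rk; rewrite /chart_law (coordK cC dk).
have q1 : `|2 / 3 : R| < 1 by rewrite ger0_norm; lra.
have x0 : chart_coord G c x = 0.
  apply/eqP; rewrite -normr_le0 leNgt; apply/negP => xp.
  have : \forall k \near \oo, `|geometric r (2 / 3) k| < `|chart_coord G c x|.
    have /cvgr0Pnorm_lt := @cvg_geometric R r (2 / 3) q1; exact.
  move=> [k _ kP]; have := kP k (leqnn k); rewrite /geometric /= => h.
  have := bound k; have [_ rk] := HU _ (Hsq k).
  have : (2 / 3) ^+ k * `|chart_coord G c (sq k)| <= (2 / 3) ^+ k * r.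
    by rewrite ler_wpM2l ?exprn_ge0// ltW.
  have := ler_norm (r * (2 / 3) ^+ k); rewrite [r * _]mulrC => ? ? ?.
  by rewrite mulrC in h; lra.
have [dx _] := HU _ Hx.
by rewrite -(coordK cC dx) x0 (point0 cC).
Qed.

End SmallSubgroups.

Section BraceTheory.
Context {R : realType} (G : lieSkewBrace R).
Local Notation dG := (dot G).
Local Notation cG := (circ G).
Local Notation "x ** y" := (lie_mul dG x y) (at level 40, left associativity).
Local Notation "x 'oo' y" := (lie_mul cG x y) (at level 40, left associativity).
Local Notation inv := (lie_inv dG).
Local Notation lam := (@brace_lambda R G).

Lemma lambda_mul a b : a ** lam a b = a oo b.
Proof. by rewrite /brace_lambda lmulVKl. Qed.

Lemma lambdaM a b c : lam a (b ** c) = lam a b ** lam a c.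
Proof. by rewrite /brace_lambda braceP !lmulA. Qed.

(** [lambda] is an action of the second group, so the elements acting trivially form a subgroup of
    it, to which [connected_subgroup] applies. *)
Lemma lambda_circ a b x : lam (a oo b) x = lam a (lam b x).
Proof.
have := braceP a b (lam b x); rewrite lambda_mul lmulA => h.
by rewrite /brace_lambda h -!lmulA lmulKl.
Qed.

Lemma lambda1 x : lam (lie_one cG) x = x.
Proof. by rewrite /brace_lambda lmul1 brace_one linv1 lmul1. Qed.

Lemma lambdaV a x : lam a x ** inv x = lie_one dG -> lam a x = x.
Proof. by move=> h; rewrite -(lmulVK dG (lam a x) x) h lmul1. Qed.

Lemma star_continuous : continuous (fun w : G * G => lam w.1 w.2 ** inv w.2).
Proof.
move=> w; have c1 : {for w, continuous (fun w : G * G => w.1)} by exact: cvg_fst.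
have c2 : {for w, continuous (fun w : G * G => w.2)} by exact: cvg_snd.
have c3 := @continuous_lmul _ _ dG _ _ _ w (continuous_linv (G := dG) c1) (continuous_lmul (G := cG) c1 c2).
exact: (@continuous_lmul _ _ dG _ _ _ w c3 (continuous_linv (G := dG) c2)).
Qed.

Lemma abelian_brace_trivial : compact [set: G] -> connected [set: G] ->
  (forall x y, x ** y = y ** x) -> forall a b, a oo b = a ** b.
Proof.
move=> Gcompact Gconnected abel.
suff lam_id a : forall x, lam a x = x by move=> a b; rewrite -lambda_mul lam_id.
apply: (connected_subgroup (G := cG) (H := [set a | forall x, lam a x = x])) => //=.
- exact: lambda1.
- by move=> b c lb lc x; rewrite lambda_circ lc lb.
- by move=> b lb x; rewrite -{1}(lb x) -lambda_circ lmulV lambda1.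
have [U Ue Usmall] := no_small_subgroup dG.
(* At the unit of the second group the map below is constantly [e]; compactness makes the
   neighbourhood of that unit uniform in [x]. *)
have : \forall b \near lie_one cG, [set: G] `<=` (fun x => U (lam b x ** inv x)).
  apply: ((compact_near_coveringP _).1 Gcompact G (nbhs (lie_one cG))
    (fun b x => U (lam b x ** inv x))) => x _.
  have h : \forall w \near ((lie_one cG, x) : G * G), U (lam w.1 w.2 ** inv w.2).
    by apply: star_continuous; rewrite /= lambda1 lmulrV.
  move: h => [[A B] /= [A1 Bx] AB]; exists (B, A) => //.
  by move=> [x' b] [/= Bx' Ab]; exact: (AB (b, x')).
apply: filterS => b bU x; apply: lambdaV.
(* The image of [z |-> lambda_b(z) z^-1], an endomorphism as the group is abelian, so it is closed
   under squaring. *)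
apply: (Usmall [set y | exists z, y = lam b z ** inv z]); last by exists x.
  by move=> _ [z ->]; exact: bU.
move=> _ [z ->]; exists (z ** z).
by rewrite lambdaM linvM (lmulACA abel).
Qed.

(* [brace_derived G k] need not be an ideal, as an intersection of connected
   submanifolds may be neither; but it is normal. *)
Lemma derived_normal k : is_normal dG (brace_derived G k).
Proof.
elim: k => [|k _]; first by split; [split|].
split; first split.
- by move=> I [iI _]; have [[]] := ideal_normal_dot iI.
- move=> x y Dx Dy I II; have [iI _] := II; have [[_ + _] _] := ideal_normal_dot iI.
  by apply; [exact: Dx|exact: Dy].
- move=> x Dx I II; have [iI _] := II; have [[_ _ +] _] := ideal_normal_dot iI.
  by apply; exact: Dx.
move=> a x Dx I II; have [iI _] := II; have [_ +] := ideal_normal_dot iI.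
by apply; exact: Dx.
Qed.

Lemma derived_commutator k x y : brace_derived G k x -> brace_derived G k y ->
  brace_derived G k.+1 (lie_commutator dG x y).
Proof.
move=> Dx Dy I [_ gI]; apply: gI; exists x, y; split => //.
exact: Or31.
Qed.

Lemma solvable_brace_abelian : compact [set: G] -> connected [set: G] ->
  solvable_brace G -> forall x y, x ** y = y ** x.
Proof.
move=> Gcompact Gconnected [n Dn].
apply: (solvable_abelian (D := brace_derived G) (n := n)) => //.
- by rewrite Dn.
- exact: derived_normal.
- exact: derived_commutator.
Qed.

End BraceTheory.

Theorem corollary3p12 (R : realType) (G : lieSkewBrace R)
    (Gcompact : compact [set: G]) (Gconnected : connected [set: G])
    (Gsolvable : solvable_brace G) :
  (exists n : nat, lie_isomorphic (dot G) (torus R n) /\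
                   lie_isomorphic (circ G) (torus R n)) /\
  (forall a b : G, lie_mul (circ G) a b = lie_mul (dot G) a b).
Proof.
have abel := solvable_brace_abelian Gcompact Gconnected Gsolvable.
have mulE := abelian_brace_trivial Gcompact Gconnected abel.
split; last exact: mulE.
have [c [r [C cC]]] := unit_chart_exists (dot G).
have [E [l [d spec]]] := exp_exists abel cC.
have [f [g [fK gK fM sf sg]]] := torus_isomorphic abel Gcompact Gconnected cC spec.
(* The two groups share the manifold and, by now, the operation, so the same pair of maps serves for
   both. *)
exists (manifold_dim G); split; exists f, g; split => // x y.
by rewrite mulE.
Qed.
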